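(* There is an absolute constant $c>0$ such that for every $f\in L\log L(G\times G)$, every $0<p\le 2$ and every $\lambda>0$, $$\mu\left\{(x,y)\in G\times G : H_{\ast}^{p}f(x,y)>\lambda\right\}\le \frac{c}{\lambda}\left(1+\iint_{G\times G}|f|\log^{+}|f|\,d\mu\right),$$ where $$H_{n}^{p}f(x,y):=\left(\frac{1}{2^{n}}\sum_{m=0}^{2^{n}-1}\left|S_{m,m}(x,y,f)\right|^{p}\right)^{1/p}\quad (n\in\mathbb{N}),\qquad H_{\ast}^{p}f:=\sup_{n\in\mathbb{N}}H_{n}^{p}f,$$ and $S_{m,m}(x,y,f)$ are the quadratic partial sums of the two-dimensional Walsh-Fourier series of $f$.
   Context: $\mathbb{N}=\{0,1,2,\dots\}$. $\mathbb{Z}_2=\{0,1\}$ is the discrete cyclic group of order 2 with addition modulo 2, every subset open, and Haar measure giving each singleton measure $1/2$. The Walsh group $G$ is the complete direct product of countably infinitely many copies of $\mathbb{Z}_2$; its elements are sequences $x=(x_0,x_1,\dots)$ with $x_k\in\{0,1\}$, with coordinatewise addition, product topology and product measure $\mu$ (so $\mu(G)=1$). The product measure on $G\times G$ is also denoted by $\mu$. Rademacher functions: $r_k(x):=(-1)^{x_k}$ for $x\in G$, $k\in\mathbb{N}$. Writing $n\in\mathbb{N}$ in base 2 as $n=\sum_{i=0}^{\infty}n_i2^i$ with $n_i\in\{0,1\}$, the Walsh-Paley functions are $w_n(x):=\prod_{k=0}^{\infty}(r_k(x))^{n_k}$, with $w_0:=1$. For an integrable function $f$ on $G\times G$, the Walsh-Fourier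 coefficients are $\widehat{f}(i,j):=\int_{G\times G}f(x,y)w_i(x)w_j(y)\,d\mu(x,y)$, and the rectangular partial sums are $$S_{M,N}(x,y,f):=\sum_{i=0}^{M-1}\sum_{j=0}^{N-1}\widehat{f}(i,j)w_i(x)w_j(y)$$ (an empty sum is $0$). $L\log L(G\times G)$ is the class of measurable functions $f$ on $G\times G$ with $\int_{G\times G}|f|\log^{+}|f|\,d\mu<\infty$, where $\log^{+}u:=\log u$ if $u>1$ and $\log^{+}u:=0$ otherwise. *)

(* Defs.v *)
From HB Require Import structures.
From mathcomp Require Import all_boot all_order all_algebra.
From mathcomp Require Import all_classical all_reals all_analysis.
From mathcomp Require Import measurable_realfun ring.

Set Implicit Arguments.
Unset Strict Implicit.
Unset Printing Implicit Defensive.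

Import Order.TTheory GRing.Theory Num.Theory.
Import numFieldNormedType.Exports.

Local Open Scope classical_set_scope.
Local Open Scope ring_scope.

(* The discrete group Z_2 is represented by [bool] (with [addb]), the complete
   direct product of countably many copies of it by [cantor_space]; the
   sigma-algebra is the product one. *)
Definition coordinate_preimages : set (set cantor_space) :=
  [set A | exists (k : nat) (B : set bool), A = [set x | B (x k)]].

Definition walsh_group : Type := g_sigma_algebraType coordinate_preimages.

HB.instance Definition _ := Measurable.on walsh_group.

(* Product of the Haar probabilities of the factors, given by its values on
   finite-dimensional measurable rectangles: these form a pi-system generating
   the sigma-algebra, so they determine the measure.
   [bernoulli_prob 2^-1] is the Haar measure of Z_2: mass 1/2 on each point. *)
Definition is_product_haar (R : realType) (P : set walsh_group -> \bar R) :=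
  forall (n : nat) (B : nat -> set bool),
    P [set x | forall k, (k < n)%N -> B k (x k)] =
    \big[*%E/1%E]_(k < n) bernoulli_prob (2^-1 : R) (B k).

Section existence.
Context {R : realType}.

Let bits (t : measurableTypeR R) : walsh_group := fun k => odd (Num.truncn (2 ^+ k.+1 * t)).

Let measurable_truncn_eq n : measurable [set t : R | Num.truncn t = n].
Proof.
have mle m : measurable [set t : R | (Num.truncn t <= m)%N].
  rewrite (_ : [set _ | _] = `]-oo, m.+1%:R[%classic) //.
  by apply/seteqP; split => t /=; rewrite in_itv/= truncn_le_nat.
case: n => [|n].
  rewrite (_ : [set _ | _] = [set t : R | (Num.truncn t <= 0)%N]) //.
  by apply/seteqP; split => t /=; rewrite leqn0 => /eqP.
rewrite (_ : [set _ | _] =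
    [set t : R | (Num.truncn t <= n.+1)%N] `\` [set t : R | (Num.truncn t <= n)%N]).
  exact: measurableD.
apply/seteqP; split => t /=.
  by move=> ->; rewrite leqnn ltnn.
by move=> [h1 /negP]; rewrite -ltnNge => h2; apply/eqP; rewrite eqn_leq h1.
Qed.

Let measurable_bit k : measurable_fun [set: R] (fun t => bits t k).
Proof.
move=> _ B _; rewrite setTI.
rewrite (_ : _ @^-1` B = (fun t : R => 2 ^+ k.+1 * t) @^-1`
    \bigcup_(n in [set n | B (odd n)]) [set t : R | Num.truncn t = n]).
  rewrite -[X in measurable X]setTI.
  have mf : measurable_fun [set: R] (fun t : R => 2 ^+ k.+1 * t).
    exact: mulrl_measurable.
  apply: mf => //; apply: bigcup_measurable => n _.
  exact: measurable_truncn_eq.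
apply/seteqP; split => t /=.
  by move=> Bt; exists (Num.truncn (2 ^+ k.+1 * t)).
by move=> [n Bn /= tn]; rewrite /bits tn.
Qed.

Let measurable_bits : measurable_fun [set: R] bits.
Proof.
apply: (@measurability _ _ _ walsh_group _ _ coordinate_preimages) => //.
move=> _ [_ [k [B ->]] <-].
exact: (measurable_bit k measurableT (I : measurable B)).
Qed.

HB.instance Definition _ := @isMeasurableFun.Build _ _ _ _ bits measurable_bits.

Let P : probability walsh_group R :=
  distribution (uniform_prob (@ltr01 R)) bits.


Let measurable_coord k (B : set bool) :
  measurable ([set x | B (x k)] : set walsh_group).
Proof. by apply: sub_sigma_algebra; exists k, B. Qed.

Let box j m (a : nat -> bool) (B : nat -> set bool) : set walsh_group :=
  [set x | (forall i, (i < j)%N -> x i = a i) /\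
           (forall i, (i < m)%N -> B (j + i)%N (x (j + i)%N))].

Let measurable_box j m a B : measurable (box j m a B).
Proof.
rewrite (_ : box j m a B =
  (\bigcap_(i in [set i | (i < j)%N]) [set x : walsh_group | [set a i] (x i)]) `&`
  (\bigcap_(i in [set i | (i < m)%N])
     [set x : walsh_group | B (j + i)%N (x (j + i)%N)])) //.
by apply: measurableI; apply: bigcap_measurableType => k _;
  exact: measurable_coord.
Qed.

Let code (a : nat -> bool) := fix code n :=
  if n is n'.+1 then (a n' + (code n').*2)%N else 0%N.

Let code_lt a n : (code a n < 2 ^ n)%N.
Proof.
elim: n => //= n ih; rewrite expnS mul2n.
by case: (a n) => /=; rewrite ?add1n ?add0n ?ltn_double// ltn_Sdouble.
Qed.

Let truncn_half (u : R) : 0 <= u -> Num.truncn u = (Num.truncn (2 * u))./2.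
Proof.
move=> u0; apply/eqP; rewrite truncn_eq//.
have u20 : 0 <= 2 * u by rewrite mulr_ge0.
have /andP[h1 h2] := truncn_itv u20.
set n := Num.truncn _ in h1 h2 *.
have hn := odd_double_half n.
have le1 : ((n./2).*2 <= n)%N by rewrite -[leqRHS]hn leq_addl.
have le2 : (n.+1 <= (n./2).+1.*2)%N.
  by rewrite -[in leqLHS]hn doubleS; case: (odd n).
rewrite -(ler_pM2l (ltr0n R 2)) -(ltr_pM2l (ltr0n R 2)) -!natrM !mul2n.
apply/andP; split.
  by apply: le_trans h1; rewrite ler_nat.
by apply: lt_le_trans h2 _; rewrite ler_nat.
Qed.

Let bits_code (t : R) a n : 0 <= t < 1 ->
  (forall i, (i < n)%N -> bits t i = a i) <->
  Num.truncn (2 ^+ n * t) = code a n.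
Proof.
move=> /andP[t0 t1]; elim: n => [|n ih].
  split=> //= _; apply/eqP; rewrite expr0 mul1r truncn_eq//.
  by rewrite t0.
have u0 : 0 <= 2 ^+ n * t by rewrite mulr_ge0// exprn_ge0.
have hh := truncn_half u0; rewrite mulrA -exprS in hh.
have he := odd_double_half (Num.truncn (2 ^+ n.+1 * t)).
rewrite -/(bits t n) -hh in he.
split => [h|h].
  rewrite /= -he h//; congr (_ + _.*2)%N.
  by apply/ih => i ilt; apply: h; exact: ltnW.
have hb : bits t n = a n.
  by rewrite /bits h /= oddD odd_double addbF oddb.
have hc : Num.truncn (2 ^+ n * t) = code a n.
  by rewrite hh h /= halfD odd_double andbF add0n doubleK; case: (a n).
move=> i; rewrite ltnS leq_eqVlt => /predU1P[->//|].
by move: i; apply/ih.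
Qed.

Let P_cyl a n : P [set x | forall i, (i < n)%N -> x i = a i] = ((2^-1) ^+ n)%:E.
Proof.
rewrite /P /distribution /pushforward /= /uniform_prob integral_uniform_pdf.
set D := (_ `&` _).
pose c : R := (code a n)%:R / 2 ^+ n.
pose d : R := (code a n).+1%:R / 2 ^+ n.
have n0 : 0 < 2 ^+ n :> R by rewrite exprn_gt0.
have c0 : 0 <= c by rewrite divr_ge0// ltW.
have cd : c < d by rewrite ltr_pM2r ?invr_gt0// ltr_nat.
have d1 : d <= 1.
  by rewrite ler_pdivrMr// mul1r -natrX ler_nat code_lt.
have inD t : (t \in `[c, d[) <-> (0 <= t < 1) /\ (Num.truncn (2 ^+ n * t) = code a n).
  rewrite in_itv/= /c /d ler_pdivrMr// ltr_pdivlMr// (mulrC t).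
  split => [/andP[h1 h2]|[/andP[t0 t1] /eqP]]; last first.
    by rewrite truncn_eq// mulr_ge0// ltW.
  have t0 : 0 <= t.
    by rewrite -(pmulr_rge0 _ n0); apply: le_trans h1.
  split; last by apply/eqP; rewrite truncn_eq ?h1// mulr_ge0// ltW.
  rewrite t0/= -(ltr_pM2l n0) mulr1; apply: lt_le_trans h2 _.
  by rewrite -natrX ler_nat code_lt.
have mD : measurable D.
  apply: measurableI => //; rewrite -[X in measurable X]setTI.
  apply: measurable_bits => //.
  rewrite (_ : [set _ | _] = box n 0 a (fun=> setT)) //.
  by apply/seteqP; split => x /=; [split | case].
pose I := [set` `[c, d[%R] : set R.
have ID : I `<=` D.
  move=> t /inD[t01 /(bits_code _ _ t01) h]; split => //=.
  by rewrite in_itv/=; move/andP: t01 => [-> /ltW ->].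
have DI : D `<=` I `|` [set 1].
  move=> t [/= h]; rewrite in_itv/= => /andP[t0].
  rewrite le_eqVlt => /predU1P[->|t1]; [by right|left].
  by apply/inD; rewrite t0 t1; split => //; apply/bits_code => //; rewrite t0.
rewrite (eq_integral (fun=> 1%:E)); last first.
  move=> t; rewrite inE => -[_] /=; rewrite in_itv/= /uniform_pdf => ->.
  by rewrite subr0 invr1.
rewrite integral_cst// mul1e.
have lI : lebesgue_measure I = ((2^-1) ^+ n)%:E :> \bar R.
  rewrite lebesgue_measure_itv/= lte_fin cd -EFinB /d /c -mulrBl.
  by rewrite -natrB// subSnn mul1r exprVn.
apply/eqP; rewrite eq_le -lI; apply/andP; split; last first.
  by apply: le_measure => //; rewrite inE//; exact: measurable_itv.
apply: le_trans (le_measure _ _ _ DI) _; rewrite ?inE//.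
  by apply: measurableU => //; exact: measurable_itv.
apply: le_trans (measureU2 _ _ _) _ => //.
  exact: measurable_itv.
by rewrite [X in (_ + X)%E]lebesgue_measure_set1 adde0.
Qed.

Let fair (A : set bool) : R := (`[< A true >] + `[< A false >])%:R / 2.

Let bernoulli_fair A : bernoulli_prob (2^-1 : R) A = (fair A)%:E.
Proof.

have -> : A = (A `&` [set true]) `|` (A `&` [set false]).
  by rewrite -setIUr -setT_bool setIT.
rewrite measureU//; last first.
  by apply/seteqP; split => // x [[_ /= ->] []].
have hb b : bernoulli_prob (2^-1 : R) [set b] = (2^-1)%:E.
  rewrite /bernoulli_prob invr_ge0 ler0n/= invf_le1// ler1n/= fsbig_set1.
  case: b => //=; congr (_%:E).
  by rewrite -[X in X - _](@mulfV _ 2)// -[X in _ - X]mul1r -mulrBl -(natrB _ (isT : (1 <= 2)%N)) mul1r.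
have hA b : bernoulli_prob (2^-1 : R) (A `&` [set b]) = (`[< A b >]%:R / 2)%:E.
  case: asboolP => Ab.
    rewrite mul1r -(hb b); congr (bernoulli_prob _ _).
    by apply/seteqP; split => [x []|x /= ->].
  rewrite mul0r -[RHS](measure0 (bernoulli_prob (2^-1 : R))).
  by congr (bernoulli_prob _ _); apply/seteqP; split => // x [/[swap] /= ->].
rewrite [X in (X + _)%E]hA [X in (_ + X)%E]hA -EFinD; congr (_%:E).
rewrite /fair natrD mulrDl; congr (_%:R / _ + _%:R / _); congr nat_of_bool;
  apply: asbool_equiv_eq; split => [h|[[]|[]]]//.
- by left.
- by right.
Qed.

Let P_box j m a B :
  P (box j m a B) = ((2^-1) ^+ j * \prod_(i < m) fair (B (j + i)%N))%:E.
Proof.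
elim: m j a => [|m ih] j a.
  rewrite big_ord0 mulr1 -(P_cyl a); congr (P _).
  by apply/seteqP; split => x /=; [case | split].
pose ext b i := if i == j then b else a i.
have boxE b : box j m.+1 a B `&` [set x | x j = b] =
    if `[< B j b >] then box j.+1 m (ext b) B else set0.
  case: asboolP => Bb; last first.
    apply/seteqP; split => // x [[_ h] /= xj]; apply: Bb.
    by have := h 0%N isT; rewrite addn0 xj.
  apply/seteqP; split => [x [[h1 h2] /= xj]|x [h1 h2]].
    split => [i|i im].
      rewrite ltnS leq_eqVlt /ext => /predU1P[->|ij]; first by rewrite eqxx.
      by rewrite (ltn_eqF ij); exact: h1.
    by have := h2 i.+1 im; rewrite addnS addSn.
  have xj : x j = b by rewrite h1// /ext eqxx.
  split => //; split => [i ij|[_|i im]].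
  - by rewrite (h1 _ (leqW ij)) /ext (ltn_eqF ij).
  - by rewrite addn0 xj.
  - by have := h2 i im; rewrite addnS addSn.
have mb b : measurable (box j m.+1 a B `&` [set x | x j = b]).
  by rewrite boxE; case: ifP.
have -> : box j m.+1 a B = (box j m.+1 a B `&` [set x | x j = true]) `|`
                           (box j m.+1 a B `&` [set x | x j = false]).
  rewrite -setIUr; apply/esym/setIidPl => x _ /=.
  by case: (x j); [left|right].
rewrite measureU//; last first.
  by apply/seteqP; split => // x [[_ /= ->] []].
set Q := \prod_(i < m) fair (B (j.+1 + i)%N).
have Pb b : P (box j m.+1 a B `&` [set x | x j = b]) =
    (`[< B j b >]%:R * ((2^-1) ^+ j.+1 * Q))%:E.
  by rewrite boxE; case: ifP => _; rewrite ?ih ?mul1r// measure0 mul0r.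
rewrite [X in (X + _)%E]Pb [X in (_ + X)%E]Pb -EFinD big_ord_recl addn0 /fair; congr (_%:E).
have -> : \prod_(i < m) ((`[< B (j + lift ord0 i)%N true >] +
    `[< B (j + lift ord0 i)%N false >])%:R / 2) = Q :> R.
  by apply: eq_bigr => i _; rewrite /bump /= /fair addnA addn1.
by rewrite natrD exprSr; set u := _%:R; set v := _%:R; ring.
Qed.

Lemma product_haar_exists : exists P : probability walsh_group R, is_product_haar P.
Proof.
exists P => n B; have := P_box 0 n (fun=> false) B.
rewrite expr0 mul1r => h.
under eq_bigr do rewrite bernoulli_fair.
rewrite prodEFin -h; congr (P _).
by apply/seteqP; split => x /=; [split|case].
Qed.

End existence.

Definition walsh_haar (R : realType) : probability walsh_group R :=
  sval (cid (@product_haar_exists R)).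

Lemma walsh_haarP (R : realType) : is_product_haar (@walsh_haar R).
Proof. exact: (proj2_sig (cid (@product_haar_exists R))). Qed.

Section walsh_fourier.
Context {R : realType}.
Implicit Types (x : walsh_group) (z : walsh_group * walsh_group)
  (f : walsh_group * walsh_group -> R).

Definition walsh_haar2 : {measure set (walsh_group * walsh_group) -> \bar R} :=
  (@walsh_haar R \x @walsh_haar R)%E.

Definition rademacher (k : nat) x : R := (-1) ^+ (x k).

Definition binary_digit (n k : nat) : bool := odd (n %/ 2 ^ k).

(* The digits of [n] of index at least [n] vanish, since [n < 2 ^ n], so the
   infinite product stops at [n]. *)
Definition walsh (n : nat) x : R :=
  \prod_(k < n) rademacher k x ^+ binary_digit n k.

Definition walsh_coef f (i j : nat) : R :=
  \int[walsh_haar2]_z (f z * walsh i z.1 * walsh j z.2).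

Definition walsh_partial_sum (M N : nat) f z : R :=
  \sum_(i < M) \sum_(j < N) walsh_coef f i j * walsh i z.1 * walsh j z.2.

Definition log_plus (u : R) : R := if 1 < u then ln u else 0.

Definition LlogL_integral f : \bar R :=
  (\int[walsh_haar2]_z (`|f z| * log_plus `|f z|)%:E)%E.

Definition LlogL f : Prop :=
  measurable_fun [set: walsh_group * walsh_group] f /\
  (LlogL_integral f < +oo)%E.

Definition strong_mean (n : nat) (p : R) f z : R :=
  ((2 ^+ n)^-1 * \sum_(m < 2 ^ n) `|walsh_partial_sum m m f z| `^ p) `^ p^-1.

Definition strong_maximal (p : R) f z : \bar R :=
  ereal_sup [set (strong_mean n p f z)%:E | n in [set: nat]].

End walsh_fourier.

(* Main.v *)
(* The Dirichlet kernels of order m < 2^n are combinations of dyadic spikes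
   2^k 1_(I_k), I_k = {x | x_0 = ... = x_(k-1) = 0}, times translates by the
   unit vectors e_k of the character w_m.  Orthogonality of the characters,
   summed over m < 2^n, bounds the quadratic strong mean by a square mean [quad]
   of averages of |f|; exponents p < 2 reduce to p = 2 by comparison of power
   means.  Only N coordinates matter for n <= N, so f may be replaced by its
   cell averages phi on a finite dyadic group.

   In the coordinates s = x + y and y, a_l is the dyadic average of order l in y
   and Phi the maximum of the a_l.  The set of s where a dyadic average of Phi
   exceeds lambda is removed by the weak type (1,1) inequality.  Outside of it, a
   stopping time argument bounds [quad], for every n at once, by C lambda^2 plus
   an n-independent majorant of mean C lambda E(phi log^+ phi), to which
   Chebyshev's inequality applies.  The logarithm is the number of truncation
   levels (3/2)^r below phi. *)

Require Import Defs.
From mathcomp Require Import all_boot all_order all_algebra.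
From mathcomp Require Import all_classical all_reals all_analysis.
From mathcomp Require Import measurable_realfun ring lra zify.

Set Implicit Arguments.
Unset Strict Implicit.
Unset Printing Implicit Defensive.

Import Order.TTheory GRing.Theory Num.Theory.
Import numFieldNormedType.Exports.

Local Open Scope classical_set_scope.
Local Open Scope ring_scope.

(** * Conditional expectations on a finite dyadic group *)

(** Two obstacles shape the argument. The supremum over [n] forbids summing bounds for single [n].
    The remedy is that a site which has stopped before [n] has coefficients constant on cells of
    order [n]. The sum over [l] is the second one: [Phi] dominates every [a l], but it gives no
    decay in [l] beyond the stopping order. A second stopping time [square_stop], the first order
    whose average over a dyadic square in [(s, y)] exceeds [lam], sorts these orders. Small square
    averages give 2^-l; averages below [lam] (3/2)^r, with r = l - [square_stop], give (3/4)^r; the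
    rest is carried by the part of [phi] above half that threshold. Squares treat s and y alike, so
    [square_stop] is also a stopping time in y and the y-averages of the truncated parts can be
    undone. Each point is then charged once per level below its value, which costs a single
    logarithm. A product of averages at two sites is charged to the site that stops first, so that
    the stopping time still controls the other factor. *)

Section dyadic_cells.
Context {N : nat}.
Local Notation X := {ffun 'I_N -> bool}.
Implicit Types (u v w s t : X).

Definition subcell (n : nat) w : bool := [forall i : 'I_N, (i < n)%N ==> ~~ w i].

(* The zero vector when [N <= k]. *)
Definition unit_vec (k : nat) : X := [ffun i : 'I_N => (i : nat) == k].

Lemma addXX w : w + w = 0.
Proof. by apply/ffunP => i; rewrite !ffunE; case: (w i). Qed.

Lemma addXK w s : w + s + s = w.
Proof. by rewrite -addrA addXX addr0. Qed.

Lemma addKX w s : w + (w + s) = s.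
Proof. by rewrite addrA addXX add0r. Qed.

Lemma subcellP n w : reflect (forall i : 'I_N, (i < n)%N -> w i = false) (subcell n w).
Proof.
apply: (iffP forallP) => h i; first by move/(implyP (h i))/negbTE.
by apply/implyP => /h ->.
Qed.

Lemma subcell0 w : subcell 0 w.
Proof. by apply/subcellP. Qed.

Lemma subcellD n u w : subcell n u -> subcell n (u + w) = subcell n w.
Proof.
move=> /subcellP hu; apply/subcellP/subcellP => h i ilt.
  by have := h i ilt; rewrite ffunE hu.
by rewrite ffunE hu // h.
Qed.

Lemma subcellDr n u w : subcell n w -> subcell n (u + w) = subcell n u.
Proof. by rewrite addrC; exact: subcellD. Qed.

Lemma subcellW m n w : (m <= n)%N -> subcell n w -> subcell m w.
Proof.
by move=> mn /subcellP h; apply/subcellP => i im; apply: h; exact: leq_trans im mn.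
Qed.

Lemma subcell_unit n k : (n <= k)%N -> subcell n (unit_vec k).
Proof.
move=> nk; apply/subcellP => i ilt; rewrite ffunE.
by apply/negbTE; rewrite neq_ltn (leq_trans ilt nk).
Qed.

Lemma subcell_all n w : (N <= n)%N -> subcell n w -> w = 0.
Proof.
move=> Nn /subcellP h; apply/ffunP => i; rewrite ffunE; apply: h.
exact: leq_trans (ltn_ord i) Nn.
Qed.

Lemma subcell_split n w : (n < N)%N ->
  (subcell n w : nat) = (subcell n.+1 w + subcell n.+1 (w + unit_vec n)%R)%N.
Proof.
move=> nN; pose i0 := Ordinal nN.
case: (boolP (subcell n w)) => [/subcellP h|h]; last first.
  have -> : subcell n.+1 w = false.
    by apply: contraNF h; exact: subcellW.
  suff -> : subcell n.+1 (w + unit_vec n) = false by [].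
  by apply: contraNF h => /(subcellW (leqnSn n)); rewrite subcellDr ?subcell_unit.
have hE (b : X) : (forall i : 'I_N, (i < n)%N -> b i = false) -> subcell n.+1 b = ~~ b i0.
  move=> hb; apply/subcellP/idP => [/(_ i0 (ltnSn _)) -> //|/negbTE b0 i].
  rewrite ltnS leq_eqVlt => /predU1P[e|]; last exact: hb.
  by rewrite (_ : i = i0) //; exact: val_inj.
rewrite !hE //; last first.
  by move=> i ilt; rewrite !ffunE h // (ltn_eqF ilt).
by rewrite !ffunE eqxx; case: (w i0).
Qed.

End dyadic_cells.

Section mean.
Context {R : realFieldType} {N : nat}.
Local Notation X := {ffun 'I_N -> bool}.
Implicit Types (u v w s t : X) (h W : X -> R).

Definition mean h : R := (2 ^+ N)^-1 * \sum_t h t.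

Lemma pow2_gt0 n : 0 < 2 ^+ n :> R.
Proof. by rewrite exprn_gt0. Qed.
Hint Resolve pow2_gt0 : core.

Lemma pow2_neq0 n : 2 ^+ n != 0 :> R.
Proof. by rewrite gt_eqF. Qed.
Hint Resolve pow2_neq0 : core.

Lemma eq_mean h1 h2 : h1 =1 h2 -> mean h1 = mean h2.
Proof. by move=> e; congr (_ * _); exact: eq_bigr. Qed.

Lemma mean_shift s h : mean (fun t => h (t + s)) = mean h.
Proof. by congr (_ * _); rewrite [RHS](reindex_inj (addIr s)). Qed.

Lemma mean_shiftl s h : mean (fun t => h (s + t)) = mean h.
Proof. by rewrite -[RHS](mean_shift s); apply: eq_mean => t; rewrite addrC. Qed.

Lemma meanZ c h : mean (fun t => c * h t) = c * mean h.
Proof. by rewrite /mean -mulr_sumr mulrCA. Qed.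

Lemma meanZr c h : mean (fun t => h t * c) = mean h * c.
Proof. by rewrite mulrC -meanZ; apply: eq_mean => t; rewrite mulrC. Qed.

Lemma meanD h1 h2 : mean (fun t => h1 t + h2 t) = mean h1 + mean h2.
Proof. by rewrite /mean big_split /= mulrDr. Qed.

Lemma mean_sum (I : Type) (r : seq I) (P : pred I) (F : I -> X -> R) :
  mean (fun t => \sum_(i <- r | P i) F i t) = \sum_(i <- r | P i) mean (F i).
Proof. by rewrite /mean exchange_big /= mulr_sumr. Qed.

Lemma mean_swap (N' : nat) (F : X -> {ffun 'I_N' -> bool} -> R) :
  mean (fun t => (2 ^+ N')^-1 * \sum_s F t s) =
  (2 ^+ N')^-1 * \sum_s mean (fun t => F t s).
Proof.
rewrite /mean -[in LHS]mulr_sumr -[in RHS]mulr_sumr exchange_big /=.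
by rewrite mulrCA.
Qed.

Lemma mean_le h1 h2 : (forall t, h1 t <= h2 t) -> mean h1 <= mean h2.
Proof.
move=> e; rewrite ler_pM2l ?invr_gt0 //; apply: ler_sum => t _; exact: e.
Qed.

Lemma mean_ge0 h : (forall t, 0 <= h t) -> 0 <= mean h.
Proof. by move=> e; rewrite mulr_ge0 ?sumr_ge0 // invr_ge0 ltW. Qed.

Lemma card_cells : #|X| = (2 ^ N)%N.
Proof. by rewrite card_ffun card_bool card_ord. Qed.

Lemma mean_cst c : mean (fun=> c) = c.
Proof.
by rewrite /mean sumr_const card_cells -[c *+ _]mulr_natl natrX mulKf.
Qed.

Lemma mean_subcell n : (n <= N)%N -> mean (fun w => (subcell n w)%:R) = (2 ^+ n)^-1.
Proof.
elim: n => [_|n ih nN].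
  by rewrite expr0 invr1 -[RHS]mean_cst; apply: eq_mean => w; rewrite subcell0.
have := ih (ltnW nN); rewrite exprS invfM => <-.
under [in RHS]eq_mean => w do rewrite subcell_split // natrD.
rewrite meanD (mean_shift (unit_vec n) (fun w => (subcell n.+1 w)%:R)).
by set m := mean _; field.
Qed.

(** The conditional expectation of [h] given the first [n] coordinates; the normalisation 2^n is
    exact only for [n <= N]. *)
Definition cell_mean (n : nat) h s : R := 2 ^+ n * mean (fun w => (subcell n w)%:R * h (s + w)).

Lemma cell_mean_ge0 n h s : (forall t, 0 <= h t) -> 0 <= cell_mean n h s.
Proof.
by move=> h0; rewrite mulr_ge0 ?mean_ge0 ?ltW // => w; rewrite mulr_ge0.
Qed.

Lemma cell_mean_le n h1 h2 s : (forall t, h1 t <= h2 t) -> cell_mean n h1 s <= cell_mean n h2 s.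
Proof.
move=> h; rewrite ler_pM2l //; apply: mean_le => w; exact: ler_wpM2l.
Qed.

Lemma eq_cell_mean n h1 h2 s : h1 =1 h2 -> cell_mean n h1 s = cell_mean n h2 s.
Proof. by move=> h; congr (_ * _); apply: eq_mean => w; rewrite h. Qed.

Lemma cell_mean_inv n h s w : subcell n w -> cell_mean n h (s + w) = cell_mean n h s.
Proof.
move=> hw; congr (_ * _).
rewrite -[RHS](mean_shiftl w); apply: eq_mean => t.
by rewrite subcellD // addrA.
Qed.

Lemma cell_mean_cst n c s : (n <= N)%N -> cell_mean n (fun=> c) s = c.
Proof. by move=> nN; rewrite /cell_mean meanZr mean_subcell // mulVKf. Qed.

Lemma cell_meanD n h1 h2 s :
  cell_mean n (fun t => h1 t + h2 t) s = cell_mean n h1 s + cell_mean n h2 s.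
Proof.
rewrite /cell_mean -mulrDr -meanD; congr (_ * _); apply: eq_mean => w.
by rewrite mulrDr.
Qed.

Lemma cell_mean_mono m n h s : (m <= n)%N -> (forall t, 0 <= h t) ->
  cell_mean n h s <= 2 ^+ (n - m) * cell_mean m h s.
Proof.
move=> mn h0; rewrite /cell_mean mulrA -exprD subnK // ler_pM2l //.
apply: mean_le => w; apply: ler_wpM2r => //; rewrite ler_nat.
by case: (boolP (subcell n w)) => // /(subcellW mn) ->.
Qed.

(** Self-adjointness of conditional expectation: a weight constant on cells of order [n] does not
    see the averaging. *)
Lemma mean_cell_mean n W h : (n <= N)%N ->
  (forall s w, subcell n w -> W (s + w) = W s) ->
  mean (fun s => W s * cell_mean n h s) = mean (fun s => W s * h s).
Proof.
move=> nN hW.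
transitivity (2 ^+ n * mean (fun s => (2 ^+ N)^-1 * \sum_w (subcell n w)%:R * (W s * h (s + w)))).
  rewrite -meanZ; apply: eq_mean => s; rewrite /cell_mean /mean mulrCA; congr (_ * _).
  by rewrite [in LHS]mulrCA; congr (_ * _); rewrite mulr_sumr; apply: eq_bigr => w _; rewrite mulrCA.
rewrite mean_swap.
transitivity (2 ^+ n * mean (fun w => (subcell n w)%:R * mean (fun s => W s * h s))).
  congr (_ * _); rewrite -/(mean (fun w => mean (fun s => _))).
  apply: eq_mean => w.
  case: (boolP (subcell n w)) => hw; last first.
    by rewrite mul0r /mean big1 ?mulr0 // => s _; rewrite mul0r.
  rewrite mul1r -[RHS](mean_shift w); apply: eq_mean => s.
  by rewrite mul1r hW.
by rewrite meanZr mean_subcell // mulVKf.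
Qed.

End mean.

Lemma mean_exchange {R : realFieldType} {N N' : nat}
    (F : {ffun 'I_N -> bool} -> {ffun 'I_N' -> bool} -> R) :
  mean (fun t => mean (F t)) = mean (fun s => mean (F^~ s)).
Proof. exact: mean_swap. Qed.
#[global] Hint Extern 0 (is_true (0 < _ ^+ _)) => solve [apply: pow2_gt0] : core.
#[global] Hint Extern 0 (is_true (_ ^+ _ != 0)) => solve [apply: pow2_neq0] : core.

(** * Stopping times and the dyadic maximal function *)

Section stopping.
Context {N : nat}.
Local Notation X := {ffun 'I_N -> bool}.
Variable bad : nat -> X -> bool.
Implicit Types (s w : X).

(* Equal to [N.+1] when no order is bad. *)
Definition first_bad s : nat := find (bad^~ s) (iota 0 N.+1).

Lemma first_bad_min s j : (j <= N)%N -> bad j s -> (first_bad s <= j)%N.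
Proof.
move=> jN bj; rewrite leqNgt; apply/negP => /(before_find 0%N).
by rewrite nth_iota ?ltnS // add0n bj.
Qed.

Lemma first_badP s : (first_bad s <= N)%N -> bad (first_bad s) s.
Proof.
move=> h; have hh : has (bad^~ s) (iota 0 N.+1) by rewrite has_find size_iota ltnS.
by have := nth_find 0%N hh; rewrite nth_iota ?ltnS.
Qed.

Lemma first_bad_gt s j : (j <= N)%N -> (j < first_bad s)%N -> ~~ bad j s.
Proof. by move=> jN; apply: contraL => bj; rewrite -leqNgt first_bad_min. Qed.

Hypothesis bad_inv : forall n s w, subcell n w -> bad n (s + w) = bad n s.

(** The stopping time property: a value at most [n] is decided by the first [n] coordinates, since
    badness of such an order passes both ways between [s] and [s + w]. *)
Lemma first_bad_inv n s w : subcell n w -> (first_bad s <= n)%N ->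
  first_bad (s + w) = first_bad s.
Proof.
move=> hw hn; have [LN|LN] := leqP (first_bad s) N; last first.
  (* Here [n] exceeds [N], so the cell is a single point. *)
  by rewrite (@subcell_all _ n w) ?addr0 // (leq_trans _ hn) // ltnW.
have le1 : (first_bad (s + w)%R <= first_bad s)%N.
  apply: first_bad_min => //; rewrite bad_inv ?first_badP //.
  exact: subcellW hn hw.
apply/eqP; rewrite eqn_leq le1; apply: first_bad_min; first exact: leq_trans le1 LN.
rewrite -(@bad_inv _ _ w) ?first_badP //; first exact: leq_trans le1 LN.
exact: subcellW (leq_trans le1 hn) hw.
Qed.

Lemma first_bad_never s0 s k : (k <= N)%N -> (N < first_bad s0)%N ->
  subcell k (s0 + s) -> (k < first_bad s)%N.
Proof.
move=> kN h0 hs; rewrite ltnNge; apply/negP => hk.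
have := first_bad_gt (leq_trans hk kN) (leq_ltn_trans (leq_trans hk kN) h0).
rewrite -(@bad_inv _ _ (s0 + s)) ?addKX ?first_badP //; first exact: leq_trans hk kN.
exact: subcellW hk hs.
Qed.

Lemma sum_first_bad (R : realFieldType) s (F : nat -> R) :
  \sum_(L < N.+1) (first_bad s == L)%:R * F L = (first_bad s <= N)%N%:R * F (first_bad s).
Proof.
have [LN|LN] := leqP (first_bad s) N; last first.
  rewrite mul0r big1 // => L _; rewrite (_ : (_ == _) = false) ?mul0r //.
  by apply: gtn_eqF; rewrite (leq_trans _ LN) // ltn_ord.
rewrite (bigD1 (Ordinal (LN : (first_bad s < N.+1)%N))) //= eqxx big1 ?addr0 // => L.
by rewrite eq_sym -val_eqE => /negbTE /= ->; rewrite mul0r.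
Qed.

End stopping.

Section maximal.
Context {R : realType} {N : nat}.
Local Notation X := {ffun 'I_N -> bool}.
Implicit Types (s w : X) (h : X -> R).

Definition large_mean (lam : R) h n s : bool := lam < cell_mean n h s.

Lemma large_mean_inv lam h n s w : subcell n w ->
  large_mean lam h n (s + w) = large_mean lam h n s.
Proof. by move=> hw; rewrite /large_mean cell_mean_inv. Qed.

(** Split over the value [L] of the stopping time: that event is a union of cells of order [L] on
    which the average of [h] exceeds [lam], and the averaging can be undone on it. *)
Lemma weak_maximal lam h :
  lam * mean (fun s => (first_bad (large_mean lam h) s <= N)%N%:R) <=
  mean (fun s => (first_bad (large_mean lam h) s <= N)%N%:R * h s).
Proof.
set T := first_bad _.
have e (g : X -> R) : mean (fun s => (T s <= N)%N%:R * g s) =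
    \sum_(L < N.+1) mean (fun s => (T s == L)%:R * g s).
  rewrite -mean_sum; apply: eq_mean => s.
  by rewrite (sum_first_bad _ s (fun=> g s)).
rewrite -meanZ; under eq_mean do rewrite mulrC.
rewrite !e; apply: ler_sum => L _.
have LN : (L <= N)%N by rewrite -ltnS.
rewrite -(@mean_cell_mean _ _ L (fun s => (T s == L)%:R) h LN); last first.
  move=> s w hw; congr (nat_of_bool _)%:R; apply/eqP/eqP => hL.
    have := first_bad_inv (s := s + w) (@large_mean_inv lam h) hw.
    by rewrite addXK -/T hL => ->.
  have := first_bad_inv (s := s) (@large_mean_inv lam h) hw.
  by rewrite -/T hL => ->.
apply: mean_le => s; case: eqP => [TL|]; last by rewrite !mul0r.
rewrite !mul1r -TL; apply/ltW/(@first_badP _ (large_mean lam h)).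
by rewrite -/T TL -ltnS.
Qed.

End maximal.

(** * Level counting and the L log L maximal inequality *)

Section counting.
Context {R : realType}.
Implicit Types x : R.

Definition level_count (J : nat) x : R := \sum_(r < J) ((3 / 2) ^+ r < x)%R%:R.

Lemma pow32_unbounded x : exists J, x <= (3 / 2) ^+ J.
Proof.
have b J : J%:R / 2 <= (3 / 2) ^+ J :> R.
  elim: J => [|J ih]; first by rewrite mul0r.
  have b1 : 1 <= (3 / 2) ^+ J :> R by rewrite exprn_ege1 //; lra.
  by rewrite exprS -natr1; lra.
exists (Num.bound `|2 * x|); apply: le_trans (b _).
by have := archi_boundP (normr_ge0 (2 * x)); have := ler_norm (2 * x); lra.
Qed.

Lemma geom32 J : 2 * (3 / 2) ^+ J <= 2 + \sum_(r < J) (3 / 2) ^+ r :> R.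
Proof.
elim: J => [|J ih]; first by rewrite big_ord0 addr0 expr0 mulr1.
by rewrite big_ord_recr /= exprS; lra.
Qed.

(** Consecutive thresholds 2 (3/2)^r differ by exactly (3/2)^r. The increments up to the first
    threshold not below [x] therefore add up to at least [x - 2]. *)
Lemma level_sum x J : 0 <= x -> x <= 2 * (3 / 2) ^+ J ->
  x <= 2 + \sum_(r < J) (3 / 2) ^+ r * (2 * (3 / 2) ^+ r < x)%R%:R.
Proof.
move=> x0; elim: J => [|J ih] hx; first by rewrite big_ord0 addr0 -[2]mulr1 -(expr0 (3 / 2)).
have p0 r : 0 <= (3 / 2) ^+ r :> R by rewrite exprn_ge0 //; lra.
rewrite big_ord_recr /= addrA.
case: (ltP (2 * (3 / 2) ^+ J) x) => hJ; last first.
  by rewrite mulr0 addr0; exact: ih.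
suff : 2 * (3 / 2) ^+ J <= 2 + \sum_(r < J) (3 / 2) ^+ r * (2 * (3 / 2) ^+ r < x)%R%:R :> R.
  move: hx; rewrite exprS mulr1; lra.
have -> : \sum_(r < J) (3 / 2) ^+ r * (2 * (3 / 2) ^+ r < x)%R%:R = \sum_(r < J) (3 / 2) ^+ r :> R.
  apply: eq_bigr => r _; rewrite (le_lt_trans _ hJ) ?mulr1 // ler_pM2l // ler_weXn2l ?(ltnW (ltn_ord r)) //; lra.
exact: geom32.
Qed.

End counting.

Section doob.
Context {R : realType} {N : nat}.
Local Notation X := {ffun 'I_N -> bool}.
Implicit Types (s w : X) (h : X -> R).

Definition maximal_fun h s : R := \big[Num.max/0]_(l < N.+1) cell_mean l h s.

Lemma maximal_fun_ge0 h s : 0 <= maximal_fun h s.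
Proof. by rewrite /maximal_fun; elim/big_rec: _ => // i x _ x0; rewrite le_max x0 orbT. Qed.

Lemma cell_mean_maximal h l s : (l <= N)%N -> cell_mean l h s <= maximal_fun h s.
Proof. by rewrite -ltnS => lN; exact: (le_bigmax_cond _ (j := Ordinal lN)). Qed.

Lemma maximal_fun_gt h s x : 0 <= x -> x < maximal_fun h s ->
  exists2 l, (l <= N)%N & x < cell_mean l h s.
Proof.
move=> x0; rewrite /maximal_fun; elim/big_rec: _ => [|i y _ ih]; first by rewrite ltNge x0.
rewrite lt_max => /orP[hi|/ih//]; exists i => //.
by rewrite -ltnS.
Qed.

(** Let [g] be the part of [h] above [x]. Since [h <= g + x], an average of [h] above [2 * x] forces
    one of [g] above [x], and the weak type inequality applies to [g]. *)
Lemma weak_maximal_trunc h x : (forall s, 0 <= h s) -> 0 < x ->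
  x * mean (fun s => (2 * x < maximal_fun h s)%R%:R) <= mean (fun s => h s * (x < h s)%R%:R).
Proof.
move=> h0 x0; pose g s := h s * (x < h s)%R%:R.
apply: le_trans (_ : _ <= x * mean (fun s => (first_bad (large_mean x g) s <= N)%N%:R)) _.
  rewrite ler_pM2l //; apply: mean_le => s.
  case: (ltP _ (maximal_fun h s)) => // /maximal_fun_gt[|l lN hl]; first lra.
  rewrite (leq_trans (first_bad_min lN _) lN) // /large_mean.
  have := @cell_mean_le _ _ l h (fun t => g t + x) s.
  rewrite cell_meanD cell_mean_cst // => hle.
  have {}hle : cell_mean l h s <= cell_mean l g s + x.
    by apply: hle => t; rewrite /g; case: ltP => ht; rewrite ?mulr1 ?mulr0; lra.
  lra.
apply: le_trans (weak_maximal _ _) _; apply: mean_le => s.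
rewrite -/(g s) ler_piMl // ?lern1 ?leq_b1 //; rewrite /g mulr_ge0 //.
Qed.

(** Doob's L log L inequality; [B] stays abstract, so that the logarithm enters only through the
    number of levels below [h]. *)
Lemma mean_maximal h (B : R -> R) : (forall s, 0 <= h s) ->
  (forall J x, 0 <= x -> x * level_count J x <= B x) ->
  mean (maximal_fun h) <= 2 + mean (fun s => B (h s)).
Proof.
move=> h0 hB.
(* The sum over the finite group dominates every value, so one [J] serves for all [s]. *)
have [J hJ] := pow32_unbounded (\sum_s maximal_fun h s).
apply: le_trans (_ : _ <= mean (fun s => 2 + \sum_(r < J) (3 / 2) ^+ r *
    (2 * (3 / 2) ^+ r < maximal_fun h s)%R%:R)) _.
  apply: mean_le => s; apply: level_sum; first exact: maximal_fun_ge0.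
  have : maximal_fun h s <= \sum_s maximal_fun h s.
    by rewrite (bigD1 s) //= lerDl sumr_ge0 // => t _; exact: maximal_fun_ge0.
  have : 0 <= (3 / 2) ^+ J :> R by rewrite exprn_ge0 //; lra.
  lra.
rewrite meanD mean_cst lerD2l mean_sum.
apply: le_trans (_ : _ <= \sum_(r < J) mean (fun s => h s * ((3 / 2) ^+ r < h s)%R%:R)) _.
  apply: ler_sum => r _; rewrite meanZ; apply: weak_maximal_trunc => //.
rewrite -mean_sum; apply: mean_le => s; rewrite -mulr_sumr; exact: hB.
Qed.

End doob.

(** * Cauchy-Schwarz weights *)

Section weights.
Context {R : realFieldType} {N : nat}.
Local Notation X := {ffun 'I_N -> bool}.
Implicit Types (s t u w : X) (h W : X -> R).

Lemma mean_cell_mean_shift n W h c : (n <= N)%N ->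
  (forall s w, subcell n w -> W (s + w) = W s) ->
  mean (fun t => W t * cell_mean n h (c + t)) = mean (fun t => W t * h (c + t)).
Proof.
move=> nN hW; rewrite -(mean_cell_mean (fun t => h (c + t)) nN hW).
apply: eq_mean => t; congr (_ * (_ * _)); apply: eq_mean => w.
by rewrite addrA.
Qed.

Lemma mean_subcell_shift n h v s : mean (fun t => (subcell n (t + v))%:R * h (s + t)) =
  (2 ^+ n)^-1 * cell_mean n h (s + v).
Proof.
rewrite /cell_mean mulKf // -[LHS](mean_shiftl v); apply: eq_mean => t.
by rewrite [v + t]addrC addXK [t + v]addrC addrA.
Qed.

(** The condition on [q] says that [u] lies in the cell of order [q] around 0 but not in that of
    order [q.+1]. *)
Lemma sum_subcell_telescope a b u : (a <= b)%N -> (b <= N)%N ->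
  \sum_(a <= q < b) (subcell q.+1 (u + unit_vec q))%:R =
  (subcell a u)%:R - (subcell b u)%:R :> R.
Proof.
elim: b => [|b ih] ab bN.
  by move: ab; rewrite leqn0 => /eqP ->; rewrite big_geq // subrr.
move: ab; rewrite leq_eqVlt => /predU1P[->|ab]; first by rewrite big_geq // subrr.
rewrite big_nat_recr //= ih // ?(ltnW bN) //.
by rewrite (subcell_split u bN) natrD; ring.
Qed.

Lemma sum_subcell_le a b u : (b <= N)%N ->
  \sum_(a <= q < b) (subcell q.+1 (u + unit_vec q))%:R <= (subcell a u)%:R :> R.
Proof.
move=> bN; have [ab|ba] := leqP a b; last by rewrite big_geq // ltnW.
by rewrite sum_subcell_telescope // lerBlDr lerDl.
Qed.

(* The ratio [3 / 2] lies strictly between 1 and 2: the weight of the [k]-th term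
   is [4 ^ k / (3 / 2) ^ k = (8 / 3) ^ k], and [mean_weight] leaves
   [(8 / 3) ^ k * (3 / 4) ^ k = 2 ^ k], which is summable against the stopping
   time. *)
Definition cs_weight (n : nat) t : R := \sum_(j < n.+1) (subcell j t)%:R * (3 / 2) ^+ j.

Lemma cs_weight_inv n s w : subcell n w -> cs_weight n (s + w) = cs_weight n s.
Proof.
move=> hw; apply: eq_bigr => j _; rewrite subcellDr //.
by apply: subcellW hw; rewrite -ltnS.
Qed.

Lemma pow32_gt0 n : 0 < (3 / 2) ^+ n :> R.
Proof. by rewrite exprn_gt0. Qed.

Lemma cs_weight_ge0 n t : 0 <= cs_weight n t.
Proof. by apply: sumr_ge0 => j _; rewrite mulr_ge0 // ltW // pow32_gt0. Qed.

Lemma cs_weight_le m n t : (m <= n)%N -> cs_weight m t <= cs_weight n t.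
Proof.
move=> mn; rewrite /cs_weight -!(big_mkord xpredT (fun j => (subcell j t)%:R * (3 / 2) ^+ j)).
rewrite (@big_cat_nat _ _ _ m.+1 0 n.+1) //= lerDl sumr_ge0 // => j _.
Qed.

(** The Cauchy-Schwarz weight of the [k]-th term after the substitution of [t + unit_vec k] for [t],
    which recentres the sum that it multiplies. *)
Definition weight (n k : nat) t : R := (subcell k t)%:R * cs_weight n (t + unit_vec k).

Lemma weight_ge0 n k t : 0 <= weight n k t.
Proof. by rewrite mulr_ge0 // cs_weight_ge0. Qed.

Lemma weight_le m n k t : (m <= n)%N -> weight m k t <= weight n k t.
Proof. by move=> mn; rewrite ler_wpM2l // cs_weight_le. Qed.

Lemma weight_inv n k s w : (k <= n)%N -> subcell n w -> weight n k (s + w) = weight n k s.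
Proof.
move=> kn hw; rewrite /weight subcellDr; last exact: subcellW hw.
by rewrite addrAC [in LHS]cs_weight_inv.
Qed.

(** After the shift by [unit_vec k] the two indicators multiply to that of order [maxn j k]. Orders
    j < k contribute at most 2 (3/4)^k, the others at most 4 (3/4)^k. *)
Lemma mean_weight k : (k <= N)%N -> mean (weight N k) <= 6 * (3 / 4) ^+ k.
Proof.
move=> kN.
have -> : mean (weight N k) = \sum_(j < N.+1) (2 ^+ maxn j k)^-1 * (3 / 2) ^+ j.
  rewrite -(mean_shift (unit_vec k)).
  transitivity (mean (fun t => \sum_(j < N.+1) (subcell (maxn j k) t)%:R * ((3 / 2) ^+ j : R))).
    apply: eq_mean => t; rewrite /weight addXK subcellDr ?subcell_unit // /cs_weight.
    rewrite mulr_sumr; apply: eq_bigr => j _; rewrite mulrA -natrM mulnb; congr (_%:R * _).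
    congr (nat_of_bool _); case: (leqP j k) => jk.
      by apply: andb_idr; exact: subcellW.
    by apply: andb_idl; apply: subcellW; exact: ltnW.
  rewrite mean_sum; apply: eq_bigr => j _; rewrite meanZr mean_subcell //.
  by rewrite geq_max kN -ltnS ltn_ord.
have small M : (M <= k)%N -> \sum_(j < M) (2 ^+ maxn j k)^-1 * (3 / 2) ^+ j
    <= (2 ^+ k)^-1 * (2 * (3 / 2) ^+ M) :> R.
  elim: M => [_|M ih Mk].
    by rewrite big_ord0 mulr_ge0 ?invr_ge0 ?mulr_ge0 ?ltW // pow32_gt0.
  rewrite big_ord_recr /= (maxn_idPr (ltnW Mk)) exprS.
  have := ih (ltnW Mk); set S := \sum_(j < M) _; set q := (2 ^+ k)^-1; set x := _ ^+ M.
  nra.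
(* The subtracted tail is what makes the induction close. *)
have large M : \sum_(j < k + M) (2 ^+ maxn j k)^-1 * (3 / 2) ^+ j
    <= 6 * (3 / 4) ^+ k - 4 * (3 / 4) ^+ (k + M) :> R.
  elim: M => [|M ih].
    rewrite addn0; apply: le_trans (small k (leqnn k)) _.
    have -> : (3 / 4) ^+ k = (2 ^+ k)^-1 * (3 / 2) ^+ k :> R.
      by rewrite -exprVn -exprMn; congr (_ ^+ _); field.
    lra.
  rewrite addnS big_ord_recr /= (maxn_idPl (leq_addr _ _)).
  have -> : (2 ^+ (k + M))^-1 * (3 / 2) ^+ (k + M) = (3 / 4) ^+ (k + M) :> R.
    by rewrite -exprVn -exprMn; congr (_ ^+ _); field.
  rewrite [_ ^+ (k + M).+1]exprS; lra.
have := large (N.+1 - k)%N; rewrite subnKC ?(leqW kN) // => h.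
apply: le_trans h _; rewrite gerBl mulr_ge0 // exprn_ge0 //; lra.
Qed.

(** 12 is the sum of m^2 2^(1-m) over m >= 1; induction proves the closed form with its exact
    defect. *)
Lemma sum_pow2_sqr n : \sum_(k < n.+1) 2 ^+ k * ((n - k).+1%:R ^+ 2) <= 12 * 2 ^+ n :> R.
Proof.
suff -> : \sum_(k < n.+1) 2 ^+ k * ((n - k).+1%:R ^+ 2) =
    12 * 2 ^+ n - (n%:R ^+ 2 + 6 * n%:R + 11) :> R.
  have : 0 <= n%:R :> R by [].
  by nra.
elim: n => [|n ih]; first by rewrite big_ord1 /= subnn expr0; ring.
rewrite big_ord_recl /=.
under eq_bigr do rewrite /bump /= add1n subSS exprS -mulrA.
by rewrite -mulr_sumr ih subn0 -!natr1 !exprS; ring.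
Qed.

Lemma sum_pow34 n m : \sum_(m <= l < n) (3 / 4) ^+ (l - m) <= 4 :> R.
Proof.
have h j : \sum_(l < j) (3 / 4) ^+ l = 4 - 4 * (3 / 4) ^+ j :> R.
  elim: j => [|j ih]; first by rewrite big_ord0 expr0; ring.
  by rewrite big_ord_recr /= ih exprS; field.
rewrite -{1}[m]add0n big_addn.
under eq_bigr do rewrite addnK.
rewrite big_mkord h gerBl mulr_ge0 // exprn_ge0 //; lra.
Qed.

End weights.

Lemma le_add3 (R : realFieldType) (A B C D : R) : 0 <= B -> 0 <= C -> 0 <= D ->
  [\/ A <= B, A <= C | A <= D] -> A <= B + C + D.
Proof. by move=> B0 C0 D0 [] h; lra. Qed.

Lemma pow2_tail (R : realFieldType) (L M : nat) :
  \sum_(l < L.+1 + M) (L < l)%N%:R * (2 ^+ l)^-1 = (2 ^+ L)^-1 - (2 ^+ (L + M))^-1 :> R.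
Proof.
elim: M => [|M ih].
  rewrite !addn0 subrr big1 // => -[l lL] _ /=.
  by rewrite ltnNge -ltnS lL mul0r.
rewrite addnS big_ord_recr /= ih addSn ltnS leq_addr mul1r addnS exprS invfM.
by move: (_ ^+ L)^-1 (_ ^+ (L + M))^-1 => x y; lra.
Qed.

Lemma pow34_ge0 (R : realFieldType) n : 0 <= (3 / 4) ^+ n :> R.
Proof. by rewrite exprn_ge0. Qed.

Lemma sum_ltn (R : realFieldType) (M L : nat) (F : nat -> R) : (L <= M)%N ->
  \sum_(k < M) (k < L)%N%:R * F k = \sum_(k < L) F k.
Proof.
move=> LM; rewrite -(big_mkord xpredT (fun k => (k < L)%N%:R * F k)).
rewrite (@big_cat_nat _ _ _ L 0 M) //= [X in _ + X]big_nat [X in _ + X]big1 ?addr0.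
  by rewrite big_mkord; apply: eq_bigr => k _; rewrite ltn_ord mul1r.
by move=> k /andP[h _]; rewrite ltnNge h mul0r.
Qed.

Lemma sum_pow2 (R : realFieldType) (L : nat) : \sum_(k < L) 2 ^+ k <= 2 ^+ L :> R.
Proof.
elim: L => [|L ih]; first by rewrite big_ord0 expr0.
by rewrite big_ord_recr /= exprS; lra.
Qed.

Lemma bool_mul4 (R : realFieldType) (b : bool) (p A O : R) : 0 <= p * A ->
  4 * (b%:R * (p * (A + O))) <= p * (4 * A) + p * (4 * (b%:R * O)).
Proof. by case: b => pA; rewrite ?(mul1r, mul0r, mulr0, addr0); nra. Qed.

Lemma sum_widen (R : realFieldType) (m n : nat) (F : nat -> R) : (m <= n)%N ->
  (forall i, 0 <= F i) -> \sum_(i < m) F i <= \sum_(i < n) F i.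
Proof.
move=> mn F0; rewrite -!(big_mkord xpredT F) (@big_cat_nat _ _ _ m 0 n) //= lerDl.
by apply: sumr_ge0.
Qed.

Lemma sum_range_le (R : realFieldType) (n k L : nat) :
  \sum_(l < n) (k <= l <= L)%N%:R <= (L - k).+1%:R :> R.
Proof.
rewrite -natr_sum ler_nat.
suff : (\sum_(l < n) (k <= l <= L) <= minn n L.+1 - k)%N.
  by move=> h; apply: leq_trans h _; lia.
elim: n => [|n ih]; first by rewrite big_ord0.
rewrite big_ord_recr /=; move: (\sum_(i < n) _)%N ih => S.
by case: (leqP k n); case: (leqP n L) => /= *; lia.
Qed.

Ltac nonneg := repeat first [assumption | exact: ler0n |
  (rewrite invr_ge0; apply: ltW; exact: pow2_gt0) | apply: mulr_ge0].

(** * The one-variable stopping time estimate *)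

Section core.
Context {R : realType} {N : nat}.
Local Notation X := {ffun 'I_N -> bool}.
Local Notation e := (@unit_vec N).
Implicit Types (s t u w : X).
(* In the application, [a l] is the average of order [l] in the second variable,
   [Phi] the maximum of the [a l], and [d r l] the average of order [l] of the
   part of the function that exceeds [lam * (3 / 2) ^+ r / 2]. *)
Variables (lam : R) (a : nat -> X -> R) (Phi : X -> R) (d : nat -> nat -> X -> R).
Hypothesis lam_gt0 : 0 < lam.
Hypothesis a_ge0 : forall l s, 0 <= a l s.
Hypothesis Phi_ge0 : forall s, 0 <= Phi s.
Hypothesis a_le : forall l s, (l <= N)%N -> a l s <= Phi s.
Hypothesis d_ge0 : forall r l s, 0 <= d r l s.
Hypothesis d_trunc : forall r l n s, (l <= N)%N -> (n <= N)%N ->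
  lam * (3 / 2) ^+ r < cell_mean n (a l) s ->
  cell_mean n (a l) s <= 2 * cell_mean n (d r l) s.

Definition stop s := first_bad (large_mean lam Phi) s.

(** In the application [a n] is an average of order [n] in y, so this concerns the average over a
    dyadic square in the coordinates [(s, y)]. *)
Definition square_large n s : bool := lam < cell_mean n (a n) s.

Definition square_stop s := first_bad square_large s.

Lemma square_large_inv n s w : subcell n w -> square_large n (s + w) = square_large n s.
Proof. by move=> hw; rewrite /square_large cell_mean_inv. Qed.

Lemma stop_inv n s w : subcell n w -> (stop s <= n)%N -> stop (s + w) = stop s.
Proof. exact: (first_bad_inv (@large_mean_inv _ _ lam Phi)). Qed.

Lemma square_stop_inv n s w : subcell n w -> (square_stop s <= n)%N ->
  square_stop (s + w) = square_stop s.
Proof. exact: (first_bad_inv square_large_inv). Qed.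

(** Truncation at [n] makes the stopping time a function of the first [n] coordinates, whatever its
    value. *)
Lemma stop_min_inv n s w : subcell n w -> minn n (stop (s + w)%R) = minn n (stop s).
Proof.
move=> hw; have [h|h] := leqP (stop s) n; first by rewrite (stop_inv hw h) (minn_idPr h).
have [h'|//] := leqP (stop (s + w)) n.
have := stop_inv hw h'; rewrite addXK => e.
by rewrite e in h; rewrite ltnNge h' in h.
Qed.

Lemma square_stop_le_inv n l s w : subcell n w -> (l <= n)%N ->
  (square_stop (s + w)%R <= l)%N = (square_stop s <= l)%N.
Proof.
move=> hw ln; apply/idP/idP => h.
  have := square_stop_inv hw (leq_trans h ln); rewrite addXK => e.
  by rewrite e.
by rewrite (square_stop_inv hw (leq_trans h ln)).
Qed.

Lemma cell_mean_Phi_ge0 n s : 0 <= cell_mean n Phi s.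
Proof. exact: cell_mean_ge0. Qed.

Lemma cell_mean_a_ge0 n l s : 0 <= cell_mean n (a l) s.
Proof. exact: cell_mean_ge0. Qed.

Lemma cell_mean_a_le n l s : (l <= N)%N -> cell_mean n (a l) s <= cell_mean n Phi s.
Proof. by move=> lN; apply: cell_mean_le => t; exact: a_le. Qed.

(** The order before [L] is good, and one further order at most doubles an average. Order 0 has no
    predecessor; there [0 < stop s] gives the bound directly. *)
Lemma cell_mean_Phi_le L s : (L <= N)%N -> (L <= stop s)%N -> (0 < stop s)%N ->
  cell_mean L Phi s <= 2 * lam.
Proof.
case: L => [_ _ h0|L LN Ls _].
  have := first_bad_gt (leq0n N) h0; rewrite /large_mean -leNgt.
  by move=> h; apply: le_trans h _; have h2 := lam_gt0; lra.
have := first_bad_gt (ltnW LN) Ls; rewrite /large_mean -leNgt => h.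
apply: le_trans (cell_mean_mono s (leqnSn L) Phi_ge0) _.
by rewrite subSnn expr1; lra.
Qed.

(** The left side is the integral over a cell of order [n], hence at most the integral over the
    surrounding cell of order [L]. *)
Lemma cell_mean_Phi_scaled n L s : (n <= N)%N -> (L <= n)%N -> (L <= stop s)%N -> (0 < stop s)%N ->
  (2 ^+ n)^-1 * cell_mean n Phi s <= 2 * lam / 2 ^+ L.
Proof.
move=> nN Ln Ls s0; rewrite ler_pdivlMr // -mulrA mulrC ler_pdivrMr //.
have := cell_mean_mono s Ln Phi_ge0.
have := cell_mean_Phi_le (leq_trans Ln nN) Ls s0.
have -> : 2 ^+ n = 2 ^+ (n - L) * 2 ^+ L :> R by rewrite -exprD subnK.
have := pow2_gt0 (R := R) L; have := pow2_gt0 (R := R) (n - L).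
set x := 2 ^+ L; set y := 2 ^+ (n - L); set u := cell_mean L _ _; set v := cell_mean n _ _ => y0 x0 hu hv.
apply: le_trans (_ : _ <= y * u * x) _; first by rewrite ler_pM2r.
have : y * x * u <= y * x * (2 * lam) by rewrite ler_pM2l ?mulr_gt0.
lra.
Qed.

Lemma stop_le_square_stop s : (square_stop s <= N)%N -> (stop s <= square_stop s)%N.
Proof.
move=> h; apply: first_bad_min => //.
have := first_badP h; rewrite /square_large /large_mean => /lt_le_trans; apply.
exact: cell_mean_a_le.
Qed.

Lemma diag_small n l s : (n <= N)%N -> (l <= N)%N -> (stop s <= n)%N -> (0 < stop s)%N ->
  (2 ^+ n)^-1 * cell_mean n (a l) s ^+ 2 <= cell_mean n Phi s * (2 * lam / 2 ^+ stop s).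
Proof.
move=> nN lN hs s0.
have h1 := cell_mean_Phi_scaled nN hs (leqnn _) s0.
have h2 := cell_mean_a_le n s lN.
have x0 := cell_mean_a_ge0 n l s.
apply: le_trans (_ : _ <= cell_mean n Phi s * ((2 ^+ n)^-1 * cell_mean n Phi s)) _.
  by rewrite [leRHS]mulrCA ler_pM2l ?invr_gt0 // expr2 ler_pM.
by rewrite ler_wpM2l // cell_mean_Phi_ge0.
Qed.

(** The level varies with the point but not with [n]. For [l < square_stop s] natural subtraction
    gives level 0, a case excluded by the indicator that multiplies this term in the estimates. *)
Definition trunc_part l s : R := d (l - square_stop s) l s.

Definition decay l s : R := (square_stop s <= l)%N%:R * (3 / 4) ^+ (l - square_stop s).

Lemma decay_ge0 l s : 0 <= decay l s.
Proof. by rewrite mulr_ge0 // exprn_ge0 //; lra. Qed.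

Lemma trunc_part_mean n l s : (n <= N)%N -> (l <= n)%N -> (square_stop s <= l)%N ->
  cell_mean n (d (l - square_stop s) l) s = cell_mean n (trunc_part l) s.
Proof.
move=> nN ln hl; congr (_ * _); apply: eq_mean => w.
case: (boolP (subcell n w)) => hw; last by rewrite !mul0r.
by rewrite /trunc_part (square_stop_inv hw (leq_trans hl ln)).
Qed.

(** Let r = l - [square_stop s]. If the square average of order [l] is small, the average of order
    [n] is at most 2^(n-l) [lam]. If it is large and the average of order [n] is at most [lam]
    (3/2)^r, then [stop s] + r <= l <= n leaves (3/4)^r. Otherwise [d_trunc] replaces one factor by
    the truncated part, and the stopping time bounds the other. *)
Lemma diag_large n l s : (n <= N)%N -> (l <= n)%N -> (stop s < l)%N -> (0 < stop s)%N ->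
  (2 ^+ n)^-1 * cell_mean n (a l) s ^+ 2 <=
  cell_mean n Phi s * (lam * ((2 ^+ l)^-1 + (2 ^+ stop s)^-1 * decay l s))
  + (square_stop s <= l)%N%:R * (4 * lam / 2 ^+ stop s) * cell_mean n (trunc_part l) s.
Proof.
move=> nN ln sl s0; have lN := leq_trans ln nN.
have ls := leq_trans (ltnW sl) ln.
have c0 := cell_mean_a_ge0 n l s.
have cP := cell_mean_a_le n s lN.
have p0 := cell_mean_Phi_ge0 n s.
have i0 m : 0 < (2 ^+ m)^-1 :> R by rewrite invr_gt0.
have j0 m : 0 <= (2 ^+ m)^-1 :> R by exact: ltW.
have lam0 := ltW lam_gt0.
have t0 : 0 <= cell_mean n (trunc_part l) s by apply: cell_mean_ge0 => t; exact: d_ge0.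
have dec0 := decay_ge0 l s.
have pd : 0 <= cell_mean n Phi s * (lam * ((2 ^+ stop s)^-1 * decay l s)).
  nonneg.
have pl : 0 <= cell_mean n Phi s * (lam * (2 ^+ l)^-1).
  nonneg.
have pt : 0 <= (square_stop s <= l)%N%:R * (4 * lam / 2 ^+ stop s) * cell_mean n (trunc_part l) s.
  nonneg.
rewrite !mulrDr.
case: (boolP (square_large l s)) => [sq|]; last first.
  rewrite /square_large -leNgt => sq.
  apply: le_add3 => //; apply: Or31.
  have h := cell_mean_mono s ln (a_ge0 l).
  have e : (2 ^+ n)^-1 * 2 ^+ (n - l) = (2 ^+ l)^-1 :> R.
    by rewrite -{1}(subnK ln) exprD invfM mulrC mulVKf.
  apply: le_trans (_ : _ <= (2 ^+ n)^-1 * (cell_mean n Phi s * (2 ^+ (n - l) * lam))) _.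
    rewrite ler_pM2l // expr2 ler_pM //; apply: le_trans h _.
    by rewrite ler_pM2l.
  by rewrite le_eqVlt -e; apply/orP; left; apply/eqP; ring.
have hl : (square_stop s <= l)%N by exact: first_bad_min.
have hN : (stop s <= square_stop s)%N by apply: stop_le_square_stop; exact: leq_trans hl lN.
move: pd pt; rewrite /decay hl !mul1r -(trunc_part_mean nN ln hl) => pd pt.
set r := (l - square_stop s)%N in pd pt *.
case: (leP (cell_mean n (a l) s) (lam * (3 / 2) ^+ r)) => hc.
  apply: le_add3 => //; apply: Or32.
  apply: le_trans (_ : _ <= (2 ^+ n)^-1 * (cell_mean n Phi s * (lam * (3 / 2) ^+ r))) _.
    by rewrite ler_pM2l // expr2 ler_pM.
  rewrite mulrCA ler_wpM2l // mulrCA ler_pM2l //.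
  have -> : (3 / 4) ^+ r = (2 ^+ r)^-1 * (3 / 2) ^+ r :> R.
    by rewrite -exprVn -exprMn; congr (_ ^+ _); field.
  rewrite mulrA ler_pM2r ?pow32_gt0 // -invfM -exprD lef_pV2 ?posrE //.
  rewrite ler_eXn2l ?ltr1n //.
  by apply: leq_trans ln; rewrite -[leqRHS](subnK hl) [leqRHS]addnC leq_add2r.
have h1 := d_trunc lN nN hc.
have h2 := cell_mean_Phi_scaled nN ls (leqnn _) s0.
have D0 : 0 <= cell_mean n (d r l) s by apply: cell_mean_ge0 => t; exact: d_ge0.
apply: le_add3 => //; apply: Or33.
apply: le_trans (_ : _ <= (2 * lam / 2 ^+ stop s) * (2 * cell_mean n (d r l) s)) _.
  rewrite expr2 mulrA; apply: ler_pM => //; first by nonneg.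
  by apply: le_trans _ h2; rewrite ler_pM2l.
by rewrite le_eqVlt; apply/orP; left; apply/eqP; ring.
Qed.

(** * Off-diagonal products *)

Definition off_cond k l l' s : R :=
  ((k <= l') && (l' != l :> nat) && (stop s < maxn l l'))%N%:R.

Definition off_n n k l s : R := \sum_(l' < n) off_cond k l l' s *
  ((minn n (stop s) <= minn n (stop (s + (e l + e l'))%R))%N%:R *
   ((2 ^+ n)^-1 * cell_mean n Phi (s + (e l + e l')))).

(** The substitute for a term of [off_n] that is free of [n]: the cell is enlarged to order
    [(maxn l l').+1], and the comparison of stopping times moves to the point of integration. *)
Definition off_mean l l' s : R :=
  mean (fun t => (subcell (maxn l l').+1 (t + (e l + e l')))%:R *
    ((stop s <= stop (s + t)%R)%N%:R * Phi (s + t))).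

Definition off k l s : R := (l < N)%N%:R * \sum_(l' < N) off_cond k l l' s * off_mean l l' s.

Lemma off_mean_ge0 l l' s : 0 <= off_mean l l' s.
Proof. by apply: mean_ge0 => t; nonneg; exact: Phi_ge0. Qed.

(** As [l] and [l'] are below [n], the cell of order [n] lies in the enlarged one. Truncated
    stopping times are constant on it, and [stop s < n] removes the truncation. *)
Lemma off_n_le n k l s : (n <= N)%N -> (l < n)%N -> (stop s < n)%N -> off_n n k l s <= off k l s.
Proof.
move=> nN ln sn; rewrite /off (leq_trans ln nN) mul1r.
apply: le_trans (sum_widen (F := fun l' => off_cond k l l' s * off_mean l l' s) nN _); last first.
  by move=> l'; rewrite mulr_ge0 // off_mean_ge0.
apply: ler_sum => -[l' l'n] _ /=; apply: ler_wpM2l => //.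
case: leqP => hm; last by rewrite mul0r off_mean_ge0.
rewrite mul1r -mean_subcell_shift; apply: mean_le => t.
case: (boolP (subcell n _)) => ht; last by rewrite mul0r; nonneg; exact: Phi_ge0.
have mx : ((maxn l l').+1 <= n)%N by rewrite gtn_max ln l'n.
rewrite (subcellW mx ht) !mul1r.
suff -> : (stop s <= stop (s + t)%R)%N by rewrite mul1r.
have := stop_min_inv (s + t) ht.
rewrite -[s + t + _]addrA addKX => h.
rewrite h (minn_idPr (ltnW sn)) in hm.
by apply: leq_trans hm _; exact: geq_minr.
Qed.

Definition shifted_sum n k s : R := \sum_(l < n.+1) (k <= l)%N%:R * cell_mean n (a l) (s + e l).

Definition pair_bound n k l s : R := 4 * cell_mean n (a l) s ^+ 2 +
  4 * ((l < n)%N%:R * \sum_(l' < n) ((k <= l') && (l' != l :> nat))%N%:R *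
     ((minn n (stop s) <= minn n (stop (s + (e l + e l'))%R))%N%:R *
     (cell_mean n (a l) s * cell_mean n (a l') (s + (e l + e l'))))).

(** Totality keeps each product in at least one of its two orders, and the factor 2 pays for the
    other. *)
Lemma sqr_sum_sym (I : finType) (c : rel I) (y : I -> R) : total c ->
  (forall i, 0 <= y i) ->
  (\sum_i y i) ^+ 2 <= 2 * \sum_i (y i ^+ 2 + \sum_(j | j != i) (c i j)%:R * (y i * y j)).
Proof.
move=> tc y0.
apply: le_trans (_ : _ <= 2 * \sum_i \sum_j (c i j)%:R * (y i * y j)) _; last first.
  rewrite ler_pM2l //; apply: ler_sum => i _; rewrite (bigD1 i) //= lerD2r.
  by rewrite expr2 ler_piMl ?mulr_ge0 // lern1 leq_b1.
rewrite expr2 mulr_suml; under eq_bigr do rewrite mulr_sumr.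
rewrite [leRHS]mulr_natl [leRHS]mulr2n [X in _ <= _ + X]exchange_big /= -big_split /=.
apply: ler_sum => i _; rewrite -big_split /=; apply: ler_sum => j _.
rewrite [y j * y i]mulrC -mulrDl ler_peMl ?mulr_ge0 // -natrD (ler_nat _ 1).
by have := tc i j; case: (c i j) (c j i) => [] [].
Qed.

(** The sites are compared by their truncated stopping times, so each product is charged to the site
    that stops first. The order [l = n] is split off: a pair containing it would need a cell of
    order [n.+1], finer than the averages. *)
Lemma shifted_sum_sqr n k s : (k <= n)%N -> shifted_sum n k s ^+ 2 <= \sum_(l < n.+1) (k <= l)%N%:R * pair_bound n k l (s + e l).
Proof.
move=> kn; rewrite /shifted_sum big_ord_recr /= kn mul1r.
pose y l := (k <= l)%N%:R * cell_mean n (a l) (s + e l).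
have y0 l : 0 <= y l by rewrite mulr_ge0 ?cell_mean_a_ge0.
have sq2 (u v : R) : (u + v) ^+ 2 <= 2 * u ^+ 2 + 4 * v ^+ 2 by nra.
apply: le_trans (sq2 _ _) _; rewrite [leRHS]big_ord_recr /= kn mul1r.
apply: lerD; last first.
  by rewrite /pair_bound ltnn mul0r mulr0 addr0.
pose c (i j : 'I_n) := (minn n (stop (s + e i)%R) <= minn n (stop (s + e j)%R))%N.
have tc : total c by move=> i j; exact: leq_total.
have := @sqr_sum_sym _ c (fun l : 'I_n => y l) tc (fun l => y0 l).
move/(ler_wpM2l (ler0n R 2)) => h; apply: le_trans h _.
rewrite mulrA -natrM mulr_sumr; apply: ler_sum => -[l ln] _ /=.
rewrite /y /pair_bound ln mul1r; case: (leqP k l) => kl; last first.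
  rewrite !mul0r expr0n /= add0r big1 ?mulr0 // => j _.
  by rewrite mul0r mulr0.
rewrite !mul1r -mulrDr ler_pM2l // lerD2l.
rewrite [leRHS](bigID (fun j : 'I_n => j != Ordinal ln)) /=.
rewrite -[leLHS]addr0; apply: lerD; last first.
  by apply: sumr_ge0 => j _; do 3?[apply: mulr_ge0 => //]; exact: cell_mean_a_ge0.
apply: ler_sum => j jl; rewrite /c /=.
have e1 : s + e l + (e l + e j) = s + e j by rewrite addrA addXK.
rewrite e1 le_eqVlt; apply/orP; left; apply/eqP.
rewrite (_ : (j != l :> nat)) ?andbT; first by ring.
by rewrite -val_eqE in jl.
Qed.

Ltac nonneg ::= repeat first [assumption | exact: ler0n | exact: ltW lam_gt0 |
  exact: cell_mean_Phi_ge0 | exact: cell_mean_a_ge0 | exact: sqr_ge0 |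
  (rewrite invr_ge0; apply: ltW; exact: pow2_gt0) | (apply: ltW; exact: pow2_gt0) |
  apply: mulr_ge0 | apply: addr_ge0].
Local Opaque cell_mean mean.

(** For [l <= stop s], 16 is 8 from the diagonal and 8 from the pairs with both orders at most
    [stop s]; all other pairs go to [off]. *)
Definition near_part k l s : R :=
  (l <= stop s)%N%:R * (16 * lam / 2 ^+ stop s * (stop s - k).+1%:R) +
  (stop s < l)%N%:R * (4 * (lam * ((2 ^+ l)^-1 + (2 ^+ stop s)^-1 * decay l s))).

Definition average_coef_n n k l s : R := near_part k l s + 4 * ((l < n)%N%:R * off_n n k l s).

Definition average_coef k l s : R := near_part k l s + 4 * off k l s.

Definition trunc_coef l s : R :=
  (stop s < l)%N%:R * ((square_stop s <= l)%N%:R * (16 * lam / 2 ^+ stop s)).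

(** Every average is at most [2 * lam]; at the second site this follows from the comparison of
    stopping times. *)
Lemma pair_bound_before_stop n k l s : (n <= N)%N -> (k <= l <= n)%N -> (n <= stop s)%N -> (0 < stop s)%N ->
  pair_bound n k l s <= 32 * lam ^+ 2 * (n - k).+1%:R.
Proof.
move=> nN /andP[kl ln] ns s0; have lN := leq_trans ln nN.
have x1 : cell_mean n (a l) s <= 2 * lam.
  exact: le_trans (cell_mean_a_le n s lN) (cell_mean_Phi_le nN ns s0).
have x0 := cell_mean_a_ge0 n l s.
have xx (x y : R) : 0 <= x -> 0 <= y -> x <= 2 * lam -> y <= 2 * lam -> x * y <= 4 * lam ^+ 2.
  move=> *; apply: le_trans (_ : _ <= (2 * lam) * (2 * lam)) _; first exact: ler_pM.
  by rewrite le_eqVlt; apply/orP; left; apply/eqP; ring.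
rewrite /pair_bound.
set S := \sum_(l' < n) _.
have S1 : S <= 4 * lam ^+ 2 * (n - k).+1%:R.
  apply: le_trans (_ : _ <= 4 * lam ^+ 2 * \sum_(l' < n) (k <= l' <= n)%N%:R) _; last first.
    by apply: ler_wpM2l; [nonneg | exact: sum_range_le].
  rewrite mulr_sumr; apply: ler_sum => -[l' l'n] _ /=.
  rewrite mulrC (ltnW l'n) andbT; apply: ler_pM => //.
  - nonneg.
  - case: leqP => hm; last by rewrite mul0r; nonneg.
    rewrite mul1r (minn_idPl ns) leq_min leqnn /= in hm *.
    apply: xx => //; first exact: cell_mean_a_ge0.
    apply: le_trans (cell_mean_a_le n _ (leq_trans (ltnW l'n) nN)) _.
    apply: cell_mean_Phi_le => //; apply: leq_trans hm; exact: leq_ltn_trans l'n.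
  - by rewrite ler_nat; case: (k <= l')%N => //; rewrite leq_b1.
have := xx _ _ x0 x0 x1 x1.
have : (l < n)%N%:R * S <= 4 * lam ^+ 2 * (n - k).+1%:R.
  case: (l < n)%N; rewrite ?mul1r ?mul0r // ; nonneg.
have : 1 <= (n - k).+1%:R :> R by rewrite ler1n.
have : 0 <= lam ^+ 2 by exact: sqr_ge0.
rewrite expr2; set m := (n - k).+1%:R; set T := _ * S; set x := cell_mean _ _ _ * _; set q := lam ^+ 2.
by move=> q0 m1 h1 h2; nra.
Qed.

(** If both orders are at most [stop s], the second site does not stop earlier than [s], and its
    scaled average obeys the bound at order [stop s]. The remaining pairs stay in [off_n]. *)
Lemma off_sum_le n k l s : (n <= N)%N -> (l <= n)%N -> (stop s < n)%N -> (0 < stop s)%N ->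
  (2 ^+ n)^-1 * \sum_(l' < n) ((k <= l') && (l' != l :> nat))%N%:R *
     ((minn n (stop s) <= minn n (stop (s + (e l + e l'))%R))%N%:R *
     (cell_mean n (a l) s * cell_mean n (a l') (s + (e l + e l')))) <=
  cell_mean n Phi s * ((l <= stop s)%N%:R * (2 * lam / 2 ^+ stop s * (stop s - k).+1%:R) + off_n n k l s).
Proof.
move=> nN ln sn s0; have lN := leq_trans ln nN.
apply: le_trans (_ : _ <= cell_mean n Phi s * ((l <= stop s)%N%:R * (2 * lam / 2 ^+ stop s *
   \sum_(l' < n) (k <= l' <= stop s)%N%:R) + off_n n k l s)) _; last first.
  apply: ler_wpM2l; first exact: cell_mean_Phi_ge0.
  rewrite lerD2r; apply: ler_wpM2l => //; apply: ler_wpM2l; last exact: sum_range_le.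
  nonneg.
rewrite mulr_sumr /off_n mulr_sumr mulr_sumr -big_split mulr_sumr /=.
apply: ler_sum => -[l' l'n] _ /=; set s' := s + (e l + e l').
have p0 := cell_mean_Phi_ge0 n s.
have q0 : 0 <= (2 ^+ n)^-1 * cell_mean n Phi s'.
  nonneg.
have l0 : 0 <= 2 * lam / 2 ^+ stop s by nonneg.
have xx : (2 ^+ n)^-1 * (cell_mean n (a l) s * cell_mean n (a l') s') <=
    cell_mean n Phi s * ((2 ^+ n)^-1 * cell_mean n Phi s').
  rewrite [leRHS]mulrCA ler_pM2l ?invr_gt0 //; apply: ler_pM; rewrite ?cell_mean_a_ge0 //.
    exact: cell_mean_a_le.
  by apply: cell_mean_a_le; exact: leq_trans (ltnW l'n) nN.
rewrite /off_cond; case: (leqP k l') => kl' /=; last by rewrite !mul0r !mulr0 addr0 mulr0.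
case: (boolP (l' != l)) => ll' /=; last first.
  by rewrite !mul0r !mulr0 addr0; nonneg.
rewrite mul1r; case: (boolP (minn n _ <= _)%N) => hm; last first.
  by rewrite !mul0r !mulr0 addr0; nonneg.
rewrite !mul1r; apply: le_trans xx _; apply: ler_wpM2l => //.
rewrite leq_max; case: (leqP l (stop s)) => ls /=; last by rewrite !mul0r !mul1r add0r.
case: (leqP l' (stop s)) => l's /=; last by rewrite !mul1r lerDr mulr_ge0.
rewrite mul0r addr0 mul1r mulr1.
rewrite (minn_idPr (ltnW sn)) leq_min (ltnW sn) /= in hm.
apply: cell_mean_Phi_scaled => //; first exact: ltnW.
exact: leq_trans s0 hm.
Qed.

Lemma pair_bound_after_stop n k l s : (n <= N)%N -> (k <= l <= n)%N -> (stop s < n)%N -> (0 < stop s)%N ->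
  (2 ^+ n)^-1 * pair_bound n k l s <=
  cell_mean n Phi s * average_coef_n n k l s + trunc_coef l s * cell_mean n (trunc_part l) s.
Proof.
move=> nN /andP[kl ln] sn s0; have lN := leq_trans ln nN.
have p0 := cell_mean_Phi_ge0 n s.
have l0 : 0 <= lam / 2 ^+ stop s by nonneg.
have m1 : 1 <= (stop s - k).+1%:R :> R by rewrite ler1n.
have t0 : 0 <= cell_mean n (trunc_part l) s by apply: cell_mean_ge0 => t; exact: d_ge0.
rewrite /pair_bound mulrDr; set S := \sum_(l' < n) _.
have hS : (2 ^+ n)^-1 * ((l < n)%N%:R * S) <= (l < n)%N%:R * (cell_mean n Phi s *
    ((l <= stop s)%N%:R * (2 * lam / 2 ^+ stop s * (stop s - k).+1%:R) + off_n n k l s)).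
  by rewrite mulrCA ler_wpM2l // off_sum_le.
have {}hS : (2 ^+ n)^-1 * (4 * ((l < n)%N%:R * S)) <= cell_mean n Phi s *
    ((l <= stop s)%N%:R * (8 * lam / 2 ^+ stop s * (stop s - k).+1%:R)) +
     cell_mean n Phi s * (4 * ((l < n)%N%:R * off_n n k l s)).
  rewrite mulrCA; apply: le_trans (ler_wpM2l (ler0n R 4) hS) _.
  set A := (l <= stop s)%N%:R * (2 * lam / 2 ^+ stop s * _).
  have A0 : 0 <= A by nonneg.
  have -> : (l <= stop s)%N%:R * (8 * lam / 2 ^+ stop s * (stop s - k).+1%:R) = 4 * A.
    by rewrite /A; ring.
  have pA : 0 <= cell_mean n Phi s * A by nonneg.
  exact: bool_mul4.
apply: le_trans (lerD (lexx _) hS) _.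
rewrite /average_coef_n /near_part /trunc_coef; case: (leqP l (stop s)) => ls; rewrite ?mul1r ?mul0r ?addr0 ?add0r.
  have h := diag_small nN lN (ltnW sn) s0.
  have {}h : (2 ^+ n)^-1 * (4 * cell_mean n (a l) s ^+ 2) <=
      cell_mean n Phi s * (8 * lam / 2 ^+ stop s * (stop s - k).+1%:R).
    apply: le_trans (_ : _ <= cell_mean n Phi s * (8 * lam / 2 ^+ stop s)) _.
      rewrite mulrCA; apply: le_trans (ler_wpM2l (ler0n R 4) h) _.
      by rewrite le_eqVlt; apply/orP; left; apply/eqP; ring.
    by apply: ler_wpM2l => //; apply: ler_peMr => //; nonneg.
  apply: le_trans (lerD h (lexx _)) _.
  by rewrite le_eqVlt; apply/orP; left; apply/eqP; ring.
have h := diag_large nN ln ls s0.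
rewrite [X in _ <= X + _]mulrDr addrAC; apply: lerD; last by rewrite mulr0 add0r.
rewrite mulrCA; apply: le_trans (ler_wpM2l (ler0n R 4) h) _.
by rewrite le_eqVlt; apply/orP; left; apply/eqP; ring.
Qed.

(** * The majorant free of n *)

Definition site_majorant k l s : R := (k <= l)%N%:R * ((k < stop s)%N%:R * ((stop s <= N)%N%:R *
  (Phi s * average_coef k l s + trunc_coef l s * trunc_part l s))).

Definition majorant s : R := \sum_(k < N.+1) (8 / 3) ^+ k *
  \sum_(l < N.+1) mean (fun t => weight N k t * site_majorant k l (s + e l + t)).

Lemma near_part_ge0 k l s : 0 <= near_part k l s.
Proof. by rewrite /near_part; have := decay_ge0 l s => h; nonneg. Qed.

Lemma off_cond_ge0 k l l' s : 0 <= off_cond k l l' s.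
Proof. exact: ler0n. Qed.

Lemma average_coef_ge0 k l s : 0 <= average_coef k l s.
Proof.
have h1 := near_part_ge0 k l s.
rewrite /average_coef /off; nonneg; apply: sumr_ge0 => l' _.
by rewrite mulr_ge0 ?off_mean_ge0 ?off_cond_ge0.
Qed.

Lemma trunc_coef_ge0 l s : 0 <= trunc_coef l s.
Proof. by rewrite /trunc_coef; nonneg. Qed.

Lemma trunc_part_ge0 l s : 0 <= trunc_part l s.
Proof. exact: d_ge0. Qed.

Lemma site_majorant_ge0 k l s : 0 <= site_majorant k l s.
Proof.
have h1 := average_coef_ge0 k l s; have h2 := trunc_coef_ge0 l s; have h3 := trunc_part_ge0 l s.
have h4 := Phi_ge0 s.
by rewrite /site_majorant; nonneg.
Qed.

Lemma average_coef_n_inv n k l s w : (l <= n)%N -> subcell n w -> (stop s < n)%N ->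
  average_coef_n n k l (s + w) = average_coef_n n k l s.
Proof.
move=> ln hw sn; have sE := stop_inv hw (ltnW sn).
have -> : average_coef_n n k l s = near_part k l s + 4 * ((l < n)%N%:R * off_n n k l s) by [].
rewrite /average_coef_n /near_part sE /decay (square_stop_le_inv s hw ln); congr (_ + _ + _ * (_ * _)).
  case: (leqP (square_stop s) l) => h; rewrite ?mul0r //.
  by rewrite (square_stop_inv hw (leq_trans h ln)).
apply: eq_bigr => l' _; rewrite /off_cond sE; congr (_ * (_ * (_ * _))).
  by rewrite [s + w + _]addrAC (stop_min_inv _ hw).
by rewrite [s + w + _]addrAC (cell_mean_inv _ _ hw).
Qed.

Lemma trunc_coef_inv n l s w : (l <= n)%N -> subcell n w -> (stop s < n)%N -> trunc_coef l (s + w) = trunc_coef l s.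
Proof.
move=> ln hw sn; rewrite /trunc_coef (stop_inv hw (ltnW sn)).
by rewrite (square_stop_le_inv s hw ln).
Qed.

Lemma stop_lt_inv n s w : subcell n w -> (stop (s + w)%R < n)%N = (stop s < n)%N.
Proof.
move=> hw; have := stop_min_inv s hw; lia.
Qed.

Lemma average_coef_n_le n k l s : (n <= N)%N -> (stop s < n)%N -> average_coef_n n k l s <= average_coef k l s.
Proof.
move=> nN sn; rewrite /average_coef_n /average_coef lerD2l ler_wpM2l //.
case: (ltnP l n) => ln; first by rewrite mul1r; exact: off_n_le.
rewrite mul0r /off; nonneg; apply: sumr_ge0 => l' _.
by rewrite mulr_ge0 ?off_mean_ge0 ?off_cond_ge0.
Qed.

(** Sites stopped before [n] have coefficients [K], [K'] constant on cells of order [n], so [Phi]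
    and [trunc_part] replace their averages; then [weight] and [average_coef_n] increase to
    expressions without [n]. The other sites give the constant term. *)
Lemma mean_pair_bound_le n k l s : (n <= N)%N -> (k <= l <= n)%N -> (N < stop s)%N ->
  mean (fun t => weight n k t * ((2 ^+ n)^-1 * pair_bound n k l (s + e l + t))) <=
  mean (fun t => weight n k t * ((2 ^+ n)^-1 * (32 * lam ^+ 2 * (n - k).+1%:R))) +
  mean (fun t => weight N k t * site_majorant k l (s + e l + t)).
Proof.
move=> nN /andP[kl ln] never; have lN := leq_trans ln nN; have kn := leq_trans kl ln.
set c := s + e l; set Q := (2 ^+ n)^-1 * (32 * _ * _).
have Q0 : 0 <= Q by rewrite /Q; nonneg.
pose G t : R := (stop (c + t)%R < n)%N%:R * (k < stop (c + t)%R)%N%:R.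
pose K t := weight n k t * (G t * average_coef_n n k l (c + t)).
pose K' t := weight n k t * (G t * trunc_coef l (c + t)).
have G_inv t w : subcell n w -> G (t + w) = G t.
  move=> hw; rewrite /G addrA (stop_lt_inv _ hw).
  by case: (ltnP (stop (c + t)) n) => h; rewrite ?mul0r // (stop_inv hw (ltnW h)).
have K_inv t w : subcell n w -> K (t + w) = K t.
  move=> hw; rewrite /K (G_inv _ _ hw) weight_inv //; congr (_ * _).
  rewrite /G addrA; case: (ltnP (stop (c + t)) n) => h; rewrite ?mul0r //.
  by rewrite (average_coef_n_inv _ ln hw h).
have K'_inv t w : subcell n w -> K' (t + w) = K' t.
  move=> hw; rewrite /K' (G_inv _ _ hw) weight_inv //; congr (_ * _).
  rewrite /G addrA; case: (ltnP (stop (c + t)) n) => h; rewrite ?mul0r //.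
  by rewrite (trunc_coef_inv ln hw h).
apply: le_trans (_ : _ <= mean (fun t => weight n k t * Q + (K t * cell_mean n Phi (c + t)
   + K' t * cell_mean n (trunc_part l) (c + t)))) _.
  apply: mean_le => t.
  have w0 := weight_ge0 (R := R) n k t.
  case: (boolP (subcell k t)) => kt; last first.
    by rewrite /K /K' /weight (negbTE kt) !mul0r !addr0.
  (* Both [t] and [e l] vanish on the first [k] coordinates, so the site shares these with [s],
     which never stops. *)
  have ks : (k < stop (c + t)%R)%N.
    apply: (first_bad_never (@large_mean_inv _ _ lam Phi)) never _; first exact: leq_trans kn nN.
    by rewrite /c -addrA addKX subcellD // subcell_unit.
  have s0 : (0 < stop (c + t)%R)%N by exact: leq_trans ks.
  rewrite /K /K' /G ks mulr1; move: (weight n k t) w0 => wt w0.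
  rewrite [leRHS](_ : _ = wt * (Q + (stop (c + t)%R < n)%N%:R *
    (cell_mean n Phi (c + t) * average_coef_n n k l (c + t) +
     trunc_coef l (c + t) * cell_mean n (trunc_part l) (c + t)))); last by ring.
  apply: ler_wpM2l => //; case: (ltnP (stop (c + t)) n) => sn.
    rewrite mul1r; apply: le_trans (pair_bound_after_stop nN _ sn s0) _; first by rewrite kl.
    by rewrite lerDr.
  rewrite mul0r addr0; apply: ler_wpM2l; first by nonneg.
  by apply: pair_bound_before_stop => //; rewrite kl.
rewrite meanD lerD2l meanD (mean_cell_mean_shift _ _ nN K_inv) (mean_cell_mean_shift _ _ nN K'_inv).
rewrite -meanD; apply: mean_le => t; rewrite /K /K' /G.
have w0 := weight_ge0 (R := R) n k t.
have h1 := average_coef_ge0 k l (c + t); have h2 := trunc_coef_ge0 l (c + t); have h3 := trunc_part_ge0 l (c + t).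
have h4 := Phi_ge0 (c + t).
have h5 := site_majorant_ge0 k l (c + t).
apply: le_trans (_ : _ <= weight n k t * site_majorant k l (c + t)) _; last first.
  by apply: ler_wpM2r => //; exact: weight_le.
move: (weight n k t) w0 => wt w0.
rewrite [leLHS](_ : _ = wt * ((stop (c + t)%R < n)%N%:R * ((k < stop (c + t)%R)%N%:R *
  (Phi (c + t) * average_coef_n n k l (c + t) + trunc_coef l (c + t) * trunc_part l (c + t))))); last by ring.
apply: ler_wpM2l => //.
case: (ltnP (stop (c + t)) n) => sn; rewrite ?mul0r ?addr0 ?mul1r //.
rewrite /site_majorant kl (leq_trans (ltnW sn) nN) !mul1r; apply: ler_wpM2l => //; rewrite lerD2r.
by apply: ler_wpM2l => //; exact: average_coef_n_le.
Qed.

Definition cs_sum n s : R := (2 ^+ n)^-1 *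
  \sum_(k < n.+1) (8 / 3) ^+ k * mean (fun t => weight n k t * shifted_sum n k (s + t) ^+ 2).

Lemma mean_weight_le n k : (k <= n)%N -> (n <= N)%N -> mean (weight (R := R) (N := N) n k) <= 6 * (3 / 4) ^+ k.
Proof.
move=> kn nN; apply: le_trans (mean_weight (leq_trans kn nN)).
by apply: mean_le => t; exact: weight_le.
Qed.

Lemma pow83_ge0 k : 0 <= (8 / 3) ^+ k :> R.
Proof. by rewrite exprn_ge0. Qed.

(** 2304 = 32 * 6 * 12, from [pair_bound_before_stop], [mean_weight] and [sum_pow2_sqr]. One factor
    n - k + 1 comes from the pairs, the other from the sum over [l]. *)
Lemma cs_sum_le n s : (n <= N)%N -> (N < stop s)%N -> cs_sum n s <= 2304 * lam ^+ 2 + majorant s.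
Proof.
move=> nN never.
pose Qc k : R := (2 ^+ n)^-1 * (32 * lam ^+ 2 * (n - k).+1%:R).
have Qc0 k : 0 <= Qc k by rewrite /Qc; nonneg.
pose M k l : R := mean (fun t => weight N k t * site_majorant k l (s + e l + t)).
have M0 k l : 0 <= M k l.
  by apply: mean_ge0 => t; apply: mulr_ge0; [exact: weight_ge0 | exact: site_majorant_ge0].
have step (k : 'I_n.+1) : (2 ^+ n)^-1 * mean (fun t => weight n k t * shifted_sum n k (s + t) ^+ 2) <=
    6 * (3 / 4) ^+ k * Qc k * (n - k).+1%:R + \sum_(l < n.+1) M k l.
  have kn : (k <= n)%N by rewrite -ltnS.
  apply: le_trans (_ : _ <= \sum_(l < n.+1) (k <= l)%N%:R *
      mean (fun t => weight n k t * ((2 ^+ n)^-1 * pair_bound n k l (s + e l + t)))) _.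
    under [leRHS]eq_bigr do rewrite -meanZ.
    rewrite -meanZ -mean_sum; apply: mean_le => t.
    have := shifted_sum_sqr (s + t) kn.
    have w0 := weight_ge0 (R := R) n k t; have i0 : 0 <= (2 ^+ n)^-1 :> R by nonneg.
    move/(ler_wpM2l w0)/(ler_wpM2l i0) => h; apply: le_trans h _.
    rewrite mulr_sumr mulr_sumr; apply: ler_sum => l _.
    rewrite [s + t + _]addrAC le_eqVlt; apply/orP; left; apply/eqP; ring.
  apply: le_trans (_ : _ <= \sum_(l < n.+1) ((k <= l <= n)%N%:R * (6 * (3 / 4) ^+ k * Qc k) + M k l)) _.
    apply: ler_sum => l _; have ln : (l <= n)%N by rewrite -ltnS.
    rewrite ln andbT; case: (leqP k l) => kl; last by rewrite !mul0r add0r.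
    rewrite !mul1r; have kln : (k <= l <= n)%N by rewrite kl ln.
    apply: le_trans (mean_pair_bound_le nN kln never) _; rewrite lerD2r meanZr.
    by apply: ler_wpM2r; [exact: Qc0 | exact: mean_weight_le].
  rewrite big_split /= lerD2r -mulr_suml mulrC; apply: ler_wpM2l; last exact: sum_range_le.
  apply: mulr_ge0 => //; apply: mulr_ge0 => //; exact: exprn_ge0.
rewrite /cs_sum mulr_sumr.
apply: le_trans (_ : _ <= \sum_(k < n.+1) (8 / 3) ^+ k * (6 * (3 / 4) ^+ k * Qc k * (n - k).+1%:R
    + \sum_(l < n.+1) M k l)) _.
  apply: ler_sum => k _; rewrite mulrCA; apply: ler_wpM2l; [exact: pow83_ge0 | exact: step].
under eq_bigr do rewrite mulrDr.
rewrite big_split /=; apply: lerD.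
  apply: le_trans (_ : _ <= 192 * lam ^+ 2 * ((2 ^+ n)^-1 *
     \sum_(k < n.+1) 2 ^+ k * ((n - k).+1%:R ^+ 2))) _.
    rewrite mulrA mulr_sumr; apply: ler_sum => k _.
    have -> : 2 ^+ k = (8 / 3) ^+ k * (3 / 4) ^+ k :> R.
      by rewrite -exprMn; congr (_ ^+ _); field.
    by rewrite /Qc le_eqVlt; apply/orP; left; apply/eqP; ring.
  have -> : 2304 * lam ^+ 2 = 192 * lam ^+ 2 * 12 by ring.
  apply: ler_wpM2l; first by nonneg.
  by rewrite mulrC ler_pdivrMr ?sum_pow2_sqr.
have inner k : \sum_(l < n.+1) M k l <= \sum_(l < N.+1) M k l.
  exact: (sum_widen (F := M k)).
apply: le_trans (_ : _ <= \sum_(k < n.+1) (8 / 3) ^+ k * \sum_(l < N.+1) M k l) _.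
  by apply: ler_sum => k _; apply: ler_wpM2l; [exact: pow83_ge0 | exact: inner].
apply: (sum_widen (F := fun k => (8 / 3) ^+ k * \sum_(l < N.+1) M k l)) => // k.
by apply: mulr_ge0; [exact: pow83_ge0 | exact: sumr_ge0].
Qed.

(** * The mean of the majorant *)

Lemma near_mean v s : (0 < stop s)%N -> (stop s <= N)%N ->
  mean (fun t => (subcell (stop s) (t + v))%:R * ((stop s <= stop (s + t)%R)%N%:R * Phi (s + t))) <=
  2 * lam / 2 ^+ stop s.
Proof.
move=> s0 sN.
case: (boolP [exists t : X, subcell (stop s) (t + v) && (stop s <= stop (s + t)%R)%N]).
  (* One point of the cell that stops late enough bounds the average of [Phi] on the whole cell;
     without such a point the integrand vanishes. *)
  move=> /existsP[t0 /andP[ht0 st0]].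
  apply: le_trans (_ : _ <= mean (fun t => (subcell (stop s) (t + v))%:R * Phi (s + t))) _.
    apply: mean_le => t; apply: ler_wpM2l => //; apply: ler_piMl; first exact: Phi_ge0.
    by rewrite lern1 leq_b1.
  rewrite mean_subcell_shift mulrC ler_pM2r ?invr_gt0 //.
  rewrite -(cell_mean_inv _ _ ht0) addrACA addXX addr0.
  by apply: cell_mean_Phi_le => //; exact: leq_trans s0 st0.
move=> /existsPn h; rewrite [leLHS](_ : _ = 0); first by nonneg.
apply: etrans (mean_cst (N := N) 0); apply: eq_mean => t.
have := h t; rewrite negb_and => /orP[/negbTE -> | /negbTE ->]; by rewrite ?(mul0r, mulr0).
Qed.

Definition pair_term k p q t s : R := ((k <= p) && (p < q) && (stop s < q))%N%:R *
  (subcell q.+1 (t + (e p + e q)))%:R.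

(** For fixed [p] the conditions on [q] describe disjoint sets inside one cell around [e p]. For [p]
    beyond [stop s] these cells are again disjoint, inside the cell of order [stop s] around 0, and
    the telescoping applies a second time. *)
Lemma pair_sum k t s : (stop s <= N)%N ->
  \sum_(p < N) \sum_(q < N) pair_term k p q t s <=
  \sum_(p < N) (k <= p <= stop s)%N%:R * (subcell (stop s) (t + e p))%:R + (subcell (stop s) t)%:R.
Proof.
move=> sN; set L := stop s.
have b01 (b : bool) (x : R) : 0 <= x -> b%:R * x <= x.
  by move=> x0; case: b; rewrite ?mul1r // mul0r.
apply: le_trans (_ : _ <= \sum_(p < N) (k <= p)%N%:R * (subcell (maxn p.+1 L) (t + e p))%:R) _.
  apply: ler_sum => p _; apply: le_trans (_ : _ <= (k <= p)%N%:R *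
     \sum_(maxn p.+1 L <= q < N) (subcell q.+1 (t + e p + e q))%:R) _; last first.
    by apply: ler_wpM2l => //; apply: sum_subcell_le.
  rewrite /pair_term; case: (leqP k p) => kp /=; last by rewrite mul0r big1 // => q _; rewrite mul0r.
  rewrite mul1r -(big_mkord xpredT (fun q => ((p < q) && (L < q))%N%:R * (subcell q.+1 (t + (e p + e q)))%:R)).
  have pN : (maxn p.+1 L <= N)%N by rewrite geq_max ltn_ord.
  rewrite (@big_cat_nat _ _ _ (maxn p.+1 L) 0 N) //= big_nat big1 ?add0r; last first.
    move=> q; rewrite leq_max => /orP[h|h].
      by rewrite ltnS leqNgt in h; rewrite (negbTE h) mul0r.
    by rewrite [(L < q)%N]ltnNge (ltnW h) andbF mul0r.
  by apply: ler_sum => q _; rewrite addrA; exact: b01.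
apply: le_trans (_ : _ <= \sum_(p < N) ((k <= p <= L)%N%:R * (subcell L (t + e p))%:R +
    (L <= p)%N%:R * (subcell p.+1 (t + e p))%:R)) _.
  apply: ler_sum => p _; case: (leqP p L) => pL; last first.
    rewrite andbF mul0r add0r (ltnW pL) mul1r (maxn_idPl _) ?b01 //.
    exact: leq_trans (ltnW pL) (leqnSn _).
  rewrite andbT; case: (leqP k p) => kp; last by rewrite !mul0r add0r mulr_ge0.
  rewrite !mul1r; have : (subcell (maxn p.+1 L) (t + e p))%:R <= (subcell L (t + e p))%:R :> R.
    rewrite ler_nat; case: (boolP (subcell (maxn p.+1 L) (t + e p))) => // h.
    by rewrite (subcellW _ h) // leq_maxr.
  by move=> h; apply: le_trans h _; rewrite lerDl mulr_ge0.
rewrite big_split /= lerD2l -(big_mkord xpredT (fun p => (L <= p)%N%:R * (subcell p.+1 (t + e p))%:R)).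
rewrite (@big_cat_nat _ _ _ L 0 N) //= big_nat big1 ?add0r; last first.
  by move=> p /andP[_ pL]; rewrite leqNgt pL mul0r.
apply: le_trans (_ : _ <= \sum_(L <= p < N) (subcell p.+1 (t + e p))%:R) _.
  by apply: ler_sum => p _; exact: b01.
exact: sum_subcell_le.
Qed.

(** The pairs are summed pointwise before integrating. The constant is 2 for the two orders of a
    pair, 2 from [near_mean], and 2 for absorbing the additional cell around 0. *)
Lemma off_sum k s : (0 < stop s)%N -> (stop s <= N)%N ->
  \sum_(l < N.+1) (k <= l)%N%:R * off k l s <= 8 * lam / 2 ^+ stop s * (stop s - k).+1%:R.
Proof.
move=> s0 sN; rewrite big_ord_recr /= [off k N s]/off ltnn mul0r mulr0 addr0.
pose P t : R := (stop s <= stop (s + t)%R)%N%:R * Phi (s + t).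
have P0 t : 0 <= P t by apply: mulr_ge0 => //; exact: Phi_ge0.
apply: le_trans (_ : _ <= mean (fun t => 2 * ((\sum_(p < N) \sum_(q < N) pair_term k p q t s) * P t))) _.
  have -> : \sum_(l < N) (k <= l)%N%:R * off k l s =
      mean (fun t => (\sum_(l < N) \sum_(l' < N) (k <= l)%N%:R * off_cond k l l' s *
         (subcell (maxn l l').+1 (t + (e l + e l')))%:R) * P t).
    under eq_mean do rewrite mulr_suml.
    rewrite mean_sum; apply: eq_bigr => l _; rewrite /off ltn_ord mul1r mulr_sumr.
    under eq_mean do rewrite mulr_suml.
    rewrite mean_sum; apply: eq_bigr => l' _; rewrite mulrA -meanZ; apply: eq_mean => t.
    by rewrite /P; ring.
  apply: mean_le => t; rewrite mulrA; apply: ler_wpM2r; first exact: P0.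
  rewrite mulr_natl mulr2n [X in _ <= _ + X]exchange_big /= -big_split; apply: ler_sum => l _ /=.
  rewrite -big_split; apply: ler_sum => l' _ /=; rewrite /pair_term /off_cond.
  rewrite [e l' + e l]addrC -natrM mulnb; case: (ltngtP l l') => ll' /=.
  - rewrite andbT andbF /= mul0r addr0; apply: ler_wpM2r => //.
    by rewrite ler_nat; case: (k <= l)%N; case: (k <= l')%N; case: (stop s < l')%N.
  - rewrite andbT andbF /= mul0r add0r; apply: ler_wpM2r => //.
    by rewrite ler_nat; case: (k <= l)%N; case: (k <= l')%N; case: (stop s < l)%N.
  - by rewrite !andbF mul0r addr_ge0 // mulr_ge0.
rewrite meanZ; apply: le_trans (_ : _ <= 2 * (2 * lam / 2 ^+ stop s * (2 * (stop s - k).+1%:R))) _; last first.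
  by rewrite le_eqVlt; apply/orP; left; apply/eqP; ring.
apply: ler_wpM2l => //; apply: le_trans (_ : _ <= mean (fun t =>
    \sum_(p < N) (k <= p <= stop s)%N%:R * ((subcell (stop s) (t + e p))%:R * P t) +
    (subcell (stop s) (t + 0))%:R * P t)) _.
  apply: mean_le => t; apply: le_trans (ler_wpM2r (P0 t) (pair_sum k t sN)) _.
  rewrite addr0 mulrDl mulr_suml lerD2r; apply: ler_sum => p _.
  by rewrite mulrA.
have c0 : 0 <= 2 * lam / 2 ^+ stop s by nonneg.
have c1 : 1 <= (stop s - k).+1%:R :> R by rewrite ler1n.
rewrite meanD mean_sum; apply: le_trans (_ : _ <=
   2 * lam / 2 ^+ stop s * \sum_(p < N) (k <= p <= stop s)%N%:R + 2 * lam / 2 ^+ stop s) _.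
  apply: lerD; last exact: near_mean.
  rewrite mulr_sumr; apply: ler_sum => p _; rewrite meanZ mulrC; apply: ler_wpM2r => //.
  exact: near_mean.
rewrite -[X in _ + X]mulr1 -mulrDr; apply: ler_wpM2l => //.
by apply: le_trans (lerD (sum_range_le R N k (stop s)) c1) _; rewrite mulr_natl mulr2n.
Qed.

(** Beyond [stop s] the series of 2^-l and of (3/4)^(l - [square_stop s]) contribute 4 + 16 = 20,
    next to 16 from the orders up to [stop s]. *)
Lemma near_sum k s : (k < stop s)%N -> (stop s <= N)%N ->
  \sum_(l < N.+1) (k <= l)%N%:R * near_part k l s <=
  36 * lam / 2 ^+ stop s * (stop s - k).+1%:R ^+ 2.
Proof.
move=> ks sN; set L := stop s; set m := (L - k).+1%:R.
have l0 : 0 <= lam / 2 ^+ L by nonneg.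
have m1 : 1 <= m by rewrite ler1n.
have m0 : 0 <= m by rewrite ler0n.
have dec0 l := decay_ge0 l s.
apply: le_trans (_ : _ <= \sum_(l < N.+1) ((k <= l <= L)%N%:R * (16 * lam / 2 ^+ L * m) +
    ((L < l)%N%:R * (2 ^+ l)^-1 * (4 * lam) + decay l s * (4 * (lam / 2 ^+ L))))) _.
  apply: ler_sum => l _; rewrite /near_part -/L -/m.
  have Z0 : 0 <= (L < l)%N%:R * (2 ^+ l)^-1 * (4 * lam) by nonneg.
  have Z1 : 0 <= decay l s * (4 * (lam / 2 ^+ L)).
    by apply: mulr_ge0; [exact: dec0 | nonneg].
  case: (leqP k l) => kl /=; last by rewrite !mul0r add0r addr_ge0.
  rewrite mul1r lerD2l; case: (L < l)%N; last by rewrite !mul0r add0r.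
  by rewrite !mul1r le_eqVlt; apply/orP; left; apply/eqP; ring.
rewrite !big_split /= -!mulr_suml.
have h1 := sum_range_le R N.+1 k L.
have h2 : \sum_(l < N.+1) (L < l)%N%:R * (2 ^+ l)^-1 <= (2 ^+ L)^-1 :> R.
  rewrite -(subnKC (sN : (L.+1 <= N.+1)%N)) pow2_tail gerBl; nonneg.
have h3 : \sum_(l < N.+1) decay l s <= 4.
  rewrite /decay -(big_mkord xpredT (fun l => (square_stop s <= l)%N%:R * (3 / 4) ^+ (l - square_stop s))).
  have [sq|sq] := leqP (square_stop s) N.+1; last first.
    rewrite big_nat big1 // => l /andP[_ lN].
    by rewrite leqNgt (ltn_trans lN sq) mul0r.
  rewrite (@big_cat_nat _ _ _ (square_stop s) 0 N.+1) //= big_nat big1 ?add0r; last first.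
    by move=> l /andP[_ h]; rewrite leqNgt h mul0r.
  apply: le_trans (_ : _ <= \sum_(square_stop s <= l < N.+1) (3 / 4) ^+ (l - square_stop s)) _;
    last exact: sum_pow34.
  apply: ler_sum => l _.
  by apply: ler_piMl; [rewrite pow34_ge0 | rewrite lern1 leq_b1].
apply: le_trans (_ : _ <= m * (16 * lam / 2 ^+ L * m) + ((2 ^+ L)^-1 * (4 * lam) + 4 * (4 * (lam / 2 ^+ L)))) _.
  by apply: lerD; [|apply: lerD]; apply: ler_wpM2r => //; nonneg.
have : 20 * (lam / 2 ^+ L) * 1 <= 20 * (lam / 2 ^+ L) * m ^+ 2.
  by apply: ler_wpM2l; [nonneg | rewrite expr_ge1].
move=> h; rewrite [leLHS](_ : _ = 16 * (lam / 2 ^+ L) * m ^+ 2 + 20 * (lam / 2 ^+ L) * 1); last by ring.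
apply: le_trans (lerD (lexx _) h) _.
by rewrite le_eqVlt; apply/orP; left; apply/eqP; ring.
Qed.

(** The cut-off [k < stop s] makes 2^k summable against 2^-[stop s], even with the square of
    [(stop s - k).+1]. Here 1200 = 100 * 12, and 100 exceeds 36 + 4 * 8. *)
Lemma sum_site_majorant s : \sum_(k < N.+1) 2 ^+ k * \sum_(l < N.+1) site_majorant k l s <=
  1200 * lam * Phi s + 16 * lam * \sum_(l < N.+1) (square_stop s <= l)%N%:R * trunc_part l s.
Proof.
have Phi0 := Phi_ge0 s.
set T := \sum_(l < N.+1) (square_stop s <= l)%N%:R * trunc_part l s.
have T0 : 0 <= T by apply: sumr_ge0 => l _; rewrite mulr_ge0 // trunc_part_ge0.
have rhs0 : 0 <= 1200 * lam * Phi s + 16 * lam * T by nonneg.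
case: (leqP (stop s) N) => sN; last first.
  rewrite big1 // => k _; rewrite big1 ?mulr0 // => l _.
  by rewrite /site_majorant [(stop s <= N)%N]leqNgt sN mul0r !mulr0.
set L := stop s.
have step k : \sum_(l < N.+1) site_majorant k l s <= (k < L)%N%:R *
    (Phi s * (100 * lam / 2 ^+ L * (L - k).+1%:R ^+ 2) + 16 * lam / 2 ^+ L * T).
  case: (ltnP k L) => kL; last first.
    by rewrite mul0r big1 // => l _; rewrite /site_majorant -/L [(k < L)%N]ltnNge kL mul0r mulr0.
  rewrite mul1r; have s0 : (0 < stop s)%N by exact: leq_trans kL.
  apply: le_trans (_ : _ <= \sum_(l < N.+1) (Phi s * ((k <= l)%N%:R * near_part k l s +
     4 * ((k <= l)%N%:R * off k l s)) + 16 * lam / 2 ^+ L * ((square_stop s <= l)%N%:R * trunc_part l s))) _.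
    apply: ler_sum => l _; rewrite /site_majorant -/L kL sN !mul1r /average_coef /trunc_coef -/L.
    have t0 := trunc_part_ge0 l s.
    case: (k <= l)%N; last by rewrite !mul0r mulr0 addr0 mulr0 add0r; nonneg.
    rewrite !mul1r lerD2l; case: (L < l)%N; last by rewrite !mul0r; nonneg.
    by rewrite mul1r le_eqVlt; apply/orP; left; apply/eqP; ring.
  rewrite big_split /= -!mulr_sumr lerD2r; apply: ler_wpM2l => //.
  rewrite big_split /= -mulr_sumr.
  apply: le_trans (lerD (near_sum kL sN) (ler_wpM2l (ler0n R 4) (off_sum k s0 sN))) _.
  rewrite -/L; set m := (L - k).+1%:R.
  have m1 : 1 <= m by rewrite ler1n.
  have mm : m <= m ^+ 2 by rewrite expr2 ler_peMr // (le_trans ler01).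
  have l0 : 0 <= 32 * (lam / 2 ^+ L) by nonneg.
  have h := ler_wpM2l l0 mm.
  rewrite [leLHS](_ : _ = 36 * (lam / 2 ^+ L) * m ^+ 2 + 32 * (lam / 2 ^+ L) * m); last by ring.
  apply: le_trans (lerD (lexx _) h) _.
  rewrite -mulrDl; apply: ler_wpM2r; first by rewrite sqr_ge0.
  by rewrite -mulrDl -mulrA; apply: ler_wpM2r; [nonneg | rewrite -natrD ler_nat].
have LN : (L <= N.+1)%N by exact: leqW.
apply: le_trans (_ : _ <= \sum_(k < N.+1) 2 ^+ k * ((k < L)%N%:R *
    (Phi s * (100 * lam / 2 ^+ L * (L - k).+1%:R ^+ 2) + 16 * lam / 2 ^+ L * T))) _.
  by apply: ler_sum => k _; apply: ler_wpM2l; [rewrite ltW | exact: step].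
under eq_bigr do rewrite mulrCA.
rewrite (sum_ltn (fun k => 2 ^+ k *
  (Phi s * (100 * lam / 2 ^+ L * (L - k).+1%:R ^+ 2) + 16 * lam / 2 ^+ L * T)) LN).
under eq_bigr do rewrite mulrDr.
rewrite big_split /=; apply: lerD.
  apply: le_trans (_ : _ <= 100 * lam * Phi s * ((2 ^+ L)^-1 *
     \sum_(k < L.+1) 2 ^+ k * ((L - k).+1%:R ^+ 2))) _.
    rewrite [leRHS]mulrA [leRHS]mulr_sumr [leRHS]big_ord_recr /= -[leLHS]addr0.
    apply: lerD; last by nonneg.
    by apply: ler_sum => k _; rewrite le_eqVlt; apply/orP; left; apply/eqP; ring.
  have -> : 1200 * lam * Phi s = 100 * lam * Phi s * 12 by ring.
  apply: ler_wpM2l; first by nonneg.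
  by rewrite mulrC ler_pdivrMr ?sum_pow2_sqr.
rewrite -mulr_suml [leLHS](_ : _ = 16 * lam * T * ((2 ^+ L)^-1 * \sum_(k < L) 2 ^+ k)); last by ring.
apply: ler_piMr; first by nonneg.
by rewrite mulrC ler_pdivrMr // mul1r sum_pow2.
Qed.

(** Translation invariance separates the weight from the site, and [mean_weight] turns (8/3)^k into
    6 times 2^k. *)
Lemma mean_majorant : mean majorant <= 6 * mean (fun s => 1200 * lam * Phi s +
  16 * lam * \sum_(l < N.+1) (square_stop s <= l)%N%:R * trunc_part l s).
Proof.
rewrite -meanZ.
apply: le_trans (_ : _ <= mean (fun s => 6 * \sum_(k < N.+1) 2 ^+ k * \sum_(l < N.+1) site_majorant k l s)) _; last first.
  by apply: mean_le => s; apply: ler_wpM2l => //; exact: sum_site_majorant.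
rewrite /majorant [leLHS]mean_sum [leRHS]meanZ [X in 6 * X]mean_sum mulr_sumr; apply: ler_sum => k _.
have kN : (k <= N)%N by rewrite -ltnS.
rewrite [leLHS]meanZ [X in _ * X <= _]mean_sum [X in 6 * X]meanZ [X in 6 * (_ * X)]mean_sum.
have eq1 l : mean (fun s => mean (fun t => weight N k t * site_majorant k l (s + e l + t))) =
    mean (weight (N := N) N k) * mean (site_majorant k l).
  rewrite mean_exchange -[RHS]meanZr; apply: eq_mean => t /=; rewrite meanZ; congr (_ * _).
  rewrite -[RHS](mean_shift (e l + t)); apply: eq_mean => s.
  by rewrite addrA.
under eq_bigr do rewrite eq1.
rewrite -mulr_sumr [leLHS]mulrA [leRHS]mulrA; apply: ler_wpM2r.
  by apply: sumr_ge0 => l _; apply: mean_ge0 => s; exact: site_majorant_ge0.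
apply: le_trans (ler_wpM2l (pow83_ge0 k) (mean_weight kN)) _.
rewrite mulrCA -exprMn [8 / 3 * _](_ : _ = 2) //.
by field.
Qed.

End core.

(** * The weak type estimate on the finite group *)

Section jensen.
Context {R : realFieldType}.

Lemma jensen_sqr (I : finType) (w g : I -> R) : (forall i, 0 <= w i) ->
  (\sum_i w i * g i) ^+ 2 <= (\sum_i w i) * \sum_i w i * g i ^+ 2.
Proof.
move=> w0; rewrite -(@ler_pM2l _ 2) // expr2 !mulr_suml !mulr_sumr.
have -> : \sum_i 2 * (w i * \sum_j w j * g j ^+ 2) =
    \sum_i \sum_j w i * w j * (g i ^+ 2 + g j ^+ 2).
  transitivity (\sum_i \sum_j w i * w j * g j ^+ 2 + \sum_i \sum_j w i * w j * g j ^+ 2).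
    rewrite -big_split; apply: eq_bigr => i _ /=; rewrite mulr_natl mulr2n mulr_sumr.
    by congr (_ + _); apply: eq_bigr => j _; rewrite mulrA.
  rewrite [X in X + _]exchange_big -big_split; apply: eq_bigr => i _ /=.
  by rewrite -big_split; apply: eq_bigr => j _ /=; ring.
apply: ler_sum => i _; rewrite !mulr_sumr; apply: ler_sum => j _.
rewrite [leLHS](_ : _ = w i * w j * (2 * g i * g j)); last by ring.
apply: ler_wpM2l; first exact: mulr_ge0.
have := sqr_ge0 (g i - g j); rewrite sqrrB; lra.
Qed.

Lemma quarter_lt (A B L : R) : 4 * L < 2 * A + 2 * B -> A <= L -> L < B.
Proof. lra. Qed.

End jensen.

Section two_dim.
Context {R : realType} {N : nat}.
Local Notation X := {ffun 'I_N -> bool}.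
Local Notation e := (@unit_vec N).
Implicit Types (s t u w x y : X) (phi : X -> X -> R).

(** Convolution of [phi] with spikes of orders [k] and [l], localised at [t]: the product of the
    characters at u + e_k and v + e_l depends only on u + v + e_k + e_l. *)
Definition kernel_term n phi k l x y t : R := 2 ^+ (k + l) * mean (fun u => mean (fun v =>
  (subcell k u)%:R * (subcell l v)%:R * (subcell n (u + v + e k + e l + t))%:R *
  phi (x + u) (y + v))).

Definition spread n phi x y t : R := \sum_(k < n.+1) \sum_(l < n.+1) kernel_term n phi k l x y t.

Definition quad n phi x y : R := 2 ^+ n * mean (fun t => spread n phi x y t ^+ 2).

Definition half_spread n phi x y t : R :=
  \sum_(k < n.+1) \sum_(l < n.+1) (k <= l)%N%:R * kernel_term n phi k l x y t.

Definition half_quad n phi x y : R := 2 ^+ n * mean (fun t => half_spread n phi x y t ^+ 2).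

(* In the coordinates [s = x + y] and [y] the constraint on [u + v] in
   [kernel_term] becomes an average in [s] alone. *)
Definition shear phi s y := phi (s + y) y.

Definition swap phi y x := phi x y.

Lemma kernel_term_ge0 n phi k l x y t : (forall x y, 0 <= phi x y) ->
  0 <= kernel_term n phi k l x y t.
Proof.
move=> h; apply: mulr_ge0; first exact: ltW.
by apply: mean_ge0 => u; apply: mean_ge0 => v; rewrite !mulr_ge0 // mulr_ge0 // mulr_ge0.
Qed.

Lemma half_spread_ge0 n phi x y t : (forall x y, 0 <= phi x y) ->
  0 <= half_spread n phi x y t.
Proof.
move=> h; apply: sumr_ge0 => k _; apply: sumr_ge0 => l _.
by apply: mulr_ge0 => //; exact: kernel_term_ge0.
Qed.

Lemma kernel_term_swap n phi k l x y t :
  kernel_term n (swap phi) l k y x t = kernel_term n phi k l x y t.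
Proof.
rewrite /kernel_term addnC mean_exchange; congr (_ * _).
apply: eq_mean => u; apply: eq_mean => v; rewrite /swap.
rewrite [(subcell l _)%:R * _]mulrC; congr (_ * (subcell n _)%:R * _).
by rewrite [v + u]addrC [u + v + e l + _]addrAC.
Qed.

Lemma spread_le n phi x y t : (forall x y, 0 <= phi x y) ->
  spread n phi x y t <= half_spread n phi x y t + half_spread n (swap phi) y x t.
Proof.
move=> h; rewrite [X in _ <= _ + X]exchange_big /= -big_split; apply: ler_sum => k _ /=.
rewrite -big_split; apply: ler_sum => l _ /=; rewrite kernel_term_swap -mulrDl.
apply: ler_peMl; first exact: kernel_term_ge0.
by rewrite -natrD (ler_nat _ 1); case: (leqP k l) => // /ltnW ->.
Qed.

Lemma quad_le n phi x y : (forall x y, 0 <= phi x y) ->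
  quad n phi x y <= 2 * half_quad n phi x y + 2 * half_quad n (swap phi) y x.
Proof.
move=> h; apply: le_trans (_ : _ <= 2 ^+ n * mean (fun t =>
    2 * half_spread n phi x y t ^+ 2 + 2 * half_spread n (swap phi) y x t ^+ 2)) _; last first.
  by rewrite meanD !meanZ mulrDr ![2 ^+ n * (2 * _)]mulrCA.
rewrite ler_pM2l //; apply: mean_le => t.
have h1 := half_spread_ge0 n x y t h.
have h2 : 0 <= half_spread n (swap phi) y x t by apply: half_spread_ge0 => *; exact: h.
have h3 : 0 <= spread n phi x y t.
  by apply: sumr_ge0 => k _; apply: sumr_ge0 => l _; exact: kernel_term_ge0.
have h4 := spread_le n x y t h.
apply: le_trans (_ : _ <= (half_spread n phi x y t + half_spread n (swap phi) y x t) ^+ 2) _.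
  by rewrite ler_sqr ?nnegrE // addr_ge0.
have := sqr_ge0 (half_spread n phi x y t - half_spread n (swap phi) y x t).
rewrite sqrrB sqrrD; lra.
Qed.

Definition avg phi y l s : R := cell_mean l (shear phi s) y.

(** On the support, u = v + e_k + e_l + t + w with w in the cell of order [n]. So v averages [phi]
    at fixed s, w averages over s, and, as [k <= l], the condition on u becomes one on [t]. *)
Lemma kernel_term_avg n phi k l x y t : (k <= l)%N -> (l <= n)%N ->
  kernel_term n phi k l x y t = (2 ^+ n)^-1 *
    ((subcell k t)%:R * 2 ^+ k * cell_mean n (avg phi y l) (x + y + (t + e k) + e l)).
Proof.
move=> kl ln; rewrite /kernel_term /cell_mean exprD mean_exchange.
have -> : (2 ^+ n)^-1 * ((subcell k t)%:R * 2 ^+ k * (2 ^+ n *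
   mean (fun w => (subcell n w)%:R * avg phi y l (x + y + (t + e k) + e l + w)))) =
   2 ^+ k * (subcell k t)%:R * mean (fun w => (subcell n w)%:R * avg phi y l (x + y + (t + e k) + e l + w)).
  by rewrite [_ * (2 ^+ n * _)]mulrCA mulKf //; ring.
transitivity (2 ^+ k * (subcell k t)%:R * mean (fun w => mean (fun v =>
    (subcell n w)%:R * (2 ^+ l * ((subcell l v)%:R *
      phi (x + y + (t + e k) + e l + w + (y + v)) (y + v)))))); last first.
  congr (_ * _); apply: eq_mean => w; rewrite meanZ meanZ /avg /cell_mean.
  by [].
rewrite [in RHS]mean_exchange -mulrA -[in LHS]meanZ -[in RHS]mulrA -[in RHS]meanZ; congr (_ * _).
apply: eq_mean => v; rewrite -[in RHS]meanZ -[in LHS]meanZ.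
rewrite -[LHS](mean_shift (v + e k + e l + t)); apply: eq_mean => w.
case: (boolP (subcell l v)) => hv; last by rewrite !(mul0r, mulr0).
have hk m : (k <= m)%N -> subcell k (e m) by exact: subcell_unit.
have -> : w + (v + e k + e l + t) + v + e k + e l + t = w.
  by rewrite -[RHS](addXK w (v + e k + e l + t)) !addrA.
case: (boolP (subcell n w)) => hw; last by rewrite !(mul0r, mulr0).
have -> : subcell k (w + (v + e k + e l + t)) = subcell k t.
  rewrite subcellD ?(subcellW (leq_trans kl ln) hw) // -!addrA.
  by rewrite subcellD ?(subcellW kl hv) // !subcellD ?hk.
have -> : x + (w + (v + e k + e l + t)) = x + y + (t + e k) + e l + w + (y + v).
  move: (e k) (e l) => a b; apply/ffunP => i; rewrite !ffunE.
  by move: (x i) (y i) (t i) (v i) (w i) (a i) (b i) => [] [] [] [] [] [] [].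
ring.
Qed.

(** Cauchy-Schwarz in [k]: 2^k splits as (3/2)^k (4/3)^k, and squaring the second factor leaves
    (3/2)^k (4/3)^(2k) = (8/3)^k. *)
Lemma half_quad_le n phi x y : (n <= N)%N -> (forall x y, 0 <= phi x y) ->
  half_quad n phi x y <= cs_sum (avg phi y) n (x + y).
Proof.
move=> nN h.
pose b t k := shifted_sum (avg phi y) n k (x + y + (t + e k)).
have hs t : half_spread n phi x y t =
    (2 ^+ n)^-1 * \sum_(k < n.+1) (subcell k t)%:R * (3 / 2) ^+ k * ((4 / 3) ^+ k * b t k).
  rewrite /half_spread mulr_sumr; apply: eq_bigr => k _.
  rewrite /b /shifted_sum !mulr_sumr; apply: eq_bigr => l _.
  case: (leqP k l) => kl; last by rewrite !(mul0r, mulr0).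
  rewrite kernel_term_avg // -1?ltnS // !mul1r.
  have -> : 2 ^+ k = (3 / 2) ^+ k * (4 / 3) ^+ k :> R.
    by rewrite -exprMn; congr (_ ^+ _); field.
  ring.
have step t : half_spread n phi x y t ^+ 2 <= (2 ^+ n)^-1 ^+ 2 *
   (cs_weight n t * \sum_(k < n.+1) (subcell k t)%:R * (8 / 3) ^+ k * b t k ^+ 2).
  rewrite hs exprMn; apply: ler_wpM2l; first exact: sqr_ge0.
  apply: le_trans (jensen_sqr _ _) _.
    by move=> k; rewrite mulr_ge0.
  apply: ler_wpM2l; first exact: cs_weight_ge0.
  rewrite le_eqVlt; apply/orP; left; apply/eqP; apply: eq_bigr => k _.
  have -> : (8 / 3) ^+ k = (3 / 2) ^+ k * ((4 / 3) ^+ k) ^+ 2 :> R.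
    by rewrite exprAC -exprMn; congr (_ ^+ _); field.
  rewrite [(_ * b t k) ^+ 2]exprMn; ring.
rewrite /half_quad; apply: le_trans (_ : _ <= (2 ^+ n)^-1 * mean (fun t =>
   cs_weight n t * \sum_(k < n.+1) (subcell k t)%:R * (8 / 3) ^+ k * b t k ^+ 2)) _.
  apply: le_trans (_ : _ <= 2 ^+ n * mean (fun t => (2 ^+ n)^-1 ^+ 2 *
    (cs_weight n t * \sum_(k < n.+1) (subcell k t)%:R * (8 / 3) ^+ k * b t k ^+ 2))) _.
    by rewrite ler_pM2l //; exact: mean_le.
  by rewrite meanZ expr2 -mulrA mulVKf.
rewrite /cs_sum ler_pM2l ?invr_gt0 //.
under eq_mean do rewrite mulr_sumr.
rewrite mean_sum; apply: ler_sum => k _; rewrite -meanZ -(mean_shift (e k)).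
apply: mean_le => t; rewrite /weight /b addXK subcellDr ?subcell_unit //.
rewrite le_eqVlt; apply/orP; left; apply/eqP; ring.
Qed.

Section weak.
Variables (phi : X -> X -> R) (lam : R) (cost : R -> R).
Hypothesis phi_ge0 : forall x y, 0 <= phi x y.
Hypothesis lam_ge2 : 2 <= lam.
Hypothesis cost_count : forall J z, 0 <= z -> z * level_count J z <= cost z.

Let lam_gt0 : 0 < lam. Proof. exact: lt_le_trans lam_ge2. Qed.

Definition excess r s y : R :=
  shear phi s y * (lam * (3 / 2) ^+ r / 2 < shear phi s y)%R%:R.

Definition avg_excess y r l s : R := cell_mean l (excess r s) y.

Definition avg_max y s : R := maximal_fun (shear phi s) y.

Let shear_ge0 s y : 0 <= shear phi s y. Proof. exact: phi_ge0. Qed.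

Lemma avg_ge0 y l s : 0 <= avg phi y l s.
Proof. exact: cell_mean_ge0. Qed.

Lemma excess_ge0 r s y : 0 <= excess r s y.
Proof. exact: mulr_ge0. Qed.

Lemma avg_excess_ge0 y r l s : 0 <= avg_excess y r l s.
Proof. by apply: cell_mean_ge0 => t; exact: excess_ge0. Qed.

Lemma avg_max_ge0 y s : 0 <= avg_max y s.
Proof. exact: maximal_fun_ge0. Qed.

Lemma avg_le_max y l s : (l <= N)%N -> avg phi y l s <= avg_max y s.
Proof. exact: cell_mean_maximal. Qed.

(** Up to [tau / 2], [phi] is its part above [tau / 2]; so an average above [tau] is at most the
    truncated average plus half of itself. *)
Lemma avg_trunc y r l n s : (l <= N)%N -> (n <= N)%N ->
  lam * (3 / 2) ^+ r < cell_mean n (avg phi y l) s ->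
  cell_mean n (avg phi y l) s <= 2 * cell_mean n (avg_excess y r l) s.
Proof.
move=> lN nN; set tau := lam * (3 / 2) ^+ r => h.
have h1 u : avg phi y l u <= avg_excess y r l u + tau / 2.
  rewrite /avg /avg_excess -[X in _ <= _ + X](cell_mean_cst (tau / 2) y lN) -cell_meanD.
  apply: cell_mean_le => v; rewrite /excess -/tau; case: ltP => hv; rewrite ?mulr1 ?mulr0 ?add0r //.
  rewrite lerDl divr_ge0 // mulr_ge0 ?ltW // pow32_gt0 //.
have := cell_mean_le n s h1.
rewrite cell_meanD cell_mean_cst //; move: h.
move: (cell_mean n (avg phi y l) s) (cell_mean n (avg_excess y r l) s) => A D; lra.
Qed.

Ltac core_hyp := solve [exact: lam_gt0 | exact: avg_ge0 | exact: avg_max_ge0 |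
  exact: avg_le_max | exact: avg_excess_ge0 | exact: avg_trunc].

Definition exceptional y s : bool := (first_bad (large_mean lam (avg_max y)) s <= N)%N.

Definition row_bound y s : R := majorant lam (avg phi y) (avg_max y) (avg_excess y) s.

Lemma row_bound_ge0 y s : 0 <= row_bound y s.
Proof.
apply: sumr_ge0 => k _; apply: mulr_ge0; first exact: pow83_ge0.
apply: sumr_ge0 => l _; apply: mean_ge0 => t; apply: mulr_ge0; first exact: weight_ge0.
apply: site_majorant_ge0; core_hyp.
Qed.

Lemma half_quad_bound n x y : (n <= N)%N -> ~~ exceptional y (x + y) ->
  half_quad n phi x y <= 2304 * lam ^+ 2 + row_bound y (x + y).
Proof.
move=> nN; rewrite -ltnNge => h; apply: le_trans (half_quad_le x y nN phi_ge0) _.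
apply: cs_sum_le => //; core_hyp.
Qed.

Lemma mean_row_bound y : mean (row_bound y) <= 6 * mean (fun s => 1200 * lam * avg_max y s +
  16 * lam * \sum_(l < N.+1) (square_stop lam (avg phi y) s <= l)%N%:R *
    avg_excess y (l - square_stop lam (avg phi y) s) l s).
Proof.
apply: mean_majorant; core_hyp.
Qed.

(** For fixed [s] the square stopping order [T] is a stopping time in y, so on [T = L <= l] the
    average of order [l] can be undone. Distinct [l] then use distinct levels [l - T y], and the sum
    is at most the value times the number of levels below it. *)
Lemma mean_excess s : mean (fun y => \sum_(l < N.+1) (square_stop lam (avg phi y) s <= l)%N%:R *
    avg_excess y (l - square_stop lam (avg phi y) s) l s) <= mean (fun y => cost (shear phi s y)).
Proof.
pose T y := square_stop lam (avg phi y) s.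
have T_inv n y w : subcell n w -> (T y <= n)%N -> T (y + w) = T y.
  have := @first_bad_inv N (fun l y => square_large lam (avg phi y) l s) _ n y w; apply.
  move=> m u v hv; rewrite /square_large; congr (_ < _); apply: eq_cell_mean => t.
  exact: cell_mean_inv.
have T_eq (L : nat) n y w : (L <= n)%N -> subcell n w -> (T (y + w)%R == L) = (T y == L).
  move=> Ln hw; apply/eqP/eqP => h.
    by have := T_inv n (y + w) w hw; rewrite addXK h => ->.
  by rewrite (T_inv n) ?h.
pose F y l L : R := (T y == L)%:R * (L <= l)%N%:R.
have e1 (G : nat -> nat -> X -> R) y : \sum_(l < N.+1) (T y <= l)%N%:R * G (l - T y)%N l y =
    \sum_(l < N.+1) \sum_(L < N.+1) F y l L * G (l - L)%N l y.
  apply: eq_bigr => l _; case: (leqP (T y) l) => h.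
    have TN : (T y < N.+1)%N by exact: leq_ltn_trans h (ltn_ord l).
    rewrite (bigD1 (Ordinal TN)) //= /F eqxx h !mul1r big1 ?addr0 // => L.
    by rewrite -val_eqE eq_sym => /negbTE /= ->; rewrite !mul0r.
  rewrite mul0r big1 // => L _; rewrite /F; case: eqP => [<-|]; last by rewrite !mul0r.
  by rewrite leqNgt h mulr0 mul0r.
rewrite (eq_mean (fun y => e1 (fun r l y => avg_excess y r l s) y)).
apply: le_trans (_ : _ <= mean (fun y => \sum_(l < N.+1) (T y <= l)%N%:R * excess (l - T y) s y)) _.
  rewrite (eq_mean (fun y => e1 (fun r l y => excess r s y) y)) !mean_sum.
  apply: ler_sum => l _; rewrite !mean_sum; apply: ler_sum => L _.
  have lN : (l <= N)%N by rewrite -ltnS.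
  rewrite (@mean_cell_mean _ _ l (fun y => F y l L) (excess (l - L) s) lN) //.
  move=> y w hw; rewrite /F; case: (leqP L l) => h; last by rewrite !mulr0.
  by rewrite (T_eq _ _ _ _ h hw).
apply: mean_le => y; apply: le_trans (cost_count N.+1 (shear_ge0 s y)).
apply: le_trans (_ : _ <= \sum_(r < N.+1) excess r s y) _; last first.
  rewrite mulr_sumr; apply: ler_sum => r _; rewrite /excess; apply: ler_wpM2l => //.
  rewrite ler_nat; case: ltP => // h; rewrite (le_lt_trans _ h) //.
  (* [lam >= 2] makes the truncation threshold at least (3/2)^r. *)
  rewrite mulrAC; apply: ler_peMl; first by rewrite ltW // pow32_gt0.
  by rewrite ler_pdivlMr // mul1r.
rewrite -(big_mkord xpredT (fun l => (T y <= l)%N%:R * excess (l - T y) s y)).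
have [TN|TN] := leqP (T y) N.+1; last first.
  rewrite big_nat big1 ?sumr_ge0 // => [r _|l /andP[_ lN]]; first exact: excess_ge0.
  by rewrite leqNgt (ltn_trans lN TN) mul0r.
rewrite (@big_cat_nat _ _ _ (T y) 0 N.+1) //= big_nat big1 ?add0r; last first.
  by move=> l /andP[_ h]; rewrite leqNgt h mul0r.
rewrite -{1}[T y]add0n big_addn.
under eq_bigr do rewrite addnK leq_addl mul1r.
rewrite big_mkord; apply: (sum_widen (F := fun r => excess r s y)); first exact: leq_subr.
by move=> r; exact: excess_ge0.
Qed.

Lemma mean_shear (g : R -> R) : mean (fun y => mean (fun s => g (shear phi s y))) =
  mean (fun x => mean (fun y => g (phi x y))).
Proof.
rewrite [RHS]mean_exchange; apply: eq_mean => y.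
by rewrite -[RHS](mean_shift y).
Qed.

(** Off the exceptional set a value above 2305 [lam]^2 forces [row_bound] above [lam]^2. The mean of
    [row_bound] is linear in [lam], so Chebyshev's inequality leaves one factor 1/[lam]. *)
Lemma half_weak : mean (fun y => mean (fun x =>
    [exists n : 'I_N.+1, 2305 * lam ^+ 2 < half_quad n phi x y]%R%:R)) <=
  15000 / lam * (1 + mean (fun x => mean (fun y => cost (phi x y)))).
Proof.
set K := mean (fun x => mean (fun y => cost (phi x y))).
have lam0 := ltW lam_gt0.
have mmax : mean (fun y => mean (avg_max y)) <= 2 + K.
  rewrite mean_exchange /K -mean_shear [X in _ <= 2 + X]mean_exchange -(mean_cst (N := N) 2) -meanD.
  apply: mean_le => s; apply: mean_maximal => //; exact: cost_count.
have step y : mean (fun x => [exists n : 'I_N.+1, 2305 * lam ^+ 2 < half_quad n phi x y]%R%:R) <=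
   lam^-1 * mean (avg_max y) + (lam ^+ 2)^-1 * mean (row_bound y).
  apply: le_trans (_ : _ <= mean (fun s => (exceptional y s)%:R + (lam ^+ 2)^-1 * row_bound y s)) _.
    rewrite -[leRHS](mean_shift y); apply: mean_le => x.
    have r0 : 0 <= (lam ^+ 2)^-1 * row_bound y (x + y).
      by rewrite mulr_ge0 ?row_bound_ge0 // invr_ge0 sqr_ge0.
    case: (boolP (exceptional y (x + y))) => hE.
      apply: le_trans (_ : 1 <= _); last by rewrite lerDl.
      by rewrite lern1 leq_b1.
    rewrite add0r; case: existsP => [[n hn]|_] //.
    have nN : (n <= N)%N by rewrite -ltnS.
    have := half_quad_bound nN hE => h.
    rewrite mulrC ler_pdivlMr ?exprn_gt0 // mul1r.
    by have := lt_le_trans hn h; move: (row_bound y (x + y)) => Z; lra.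
  rewrite meanD meanZ lerD2r mulrC ler_pdivlMr // mulrC.
  apply: le_trans (weak_maximal _ _) _; apply: mean_le => s.
  by apply: ler_piMl; [exact: avg_max_ge0 | rewrite lern1 leq_b1].
apply: le_trans (mean_le step) _; rewrite meanD (meanZ lam^-1) (meanZ (lam ^+ 2)^-1).
have mrow : mean (fun y => mean (row_bound y)) <= 6 * (1200 * lam * (2 + K) + 16 * lam * K).
  apply: le_trans (mean_le mean_row_bound) _; rewrite meanZ ler_pM2l //.
  under eq_mean do rewrite meanD (meanZ (1200 * lam)) (meanZ (16 * lam)).
  rewrite meanD (meanZ (1200 * lam)) (meanZ (16 * lam)).
  have a1 : 0 <= 1200 * lam by lra.
  have a2 : 0 <= 16 * lam by lra.
  apply: lerD; [exact: (ler_wpM2l a1 mmax) | apply: (ler_wpM2l a2)].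
  rewrite mean_exchange /K -mean_shear [leRHS]mean_exchange.
  by apply: mean_le => s; exact: mean_excess.
have K0 : 0 <= K.
  apply: mean_ge0 => x; apply: mean_ge0 => y; apply: le_trans (cost_count 0 (phi_ge0 x y)).
  by rewrite /level_count big_ord0 mulr0.
have i1 : 0 <= lam^-1 by rewrite invr_ge0.
have i2 : 0 <= (lam ^+ 2)^-1 by rewrite invr_ge0 sqr_ge0.
apply: le_trans (lerD (ler_wpM2l i1 mmax) (ler_wpM2l i2 mrow)) _.
rewrite [leLHS](_ : _ = lam^-1 * (14402 + 7297 * K)); last first.
  by field; rewrite gt_eqF.
rewrite [leRHS](_ : _ = lam^-1 * (15000 + 15000 * K)); last by ring.
apply: ler_wpM2l; first by rewrite invr_ge0.
move: K0; move: K {mmax mrow} => K K0; lra.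
Qed.

End weak.

Lemma quad_weak phi (lam : R) (cost : R -> R) : (forall x y, 0 <= phi x y) -> 2 <= lam ->
  (forall J z, 0 <= z -> z * level_count J z <= cost z) ->
  mean (fun x => mean (fun y => [exists n : 'I_N.+1, 4 * (2305 * lam ^+ 2) < quad n phi x y]%R%:R)) <=
  2 * (15000 / lam * (1 + mean (fun x => mean (fun y => cost (phi x y))))).
Proof.
move=> phi0 lam2 hcost; set K := mean (fun x => mean (fun y => cost _)).
have h1 := half_weak phi0 lam2 hcost.
have h2 := @half_weak (swap phi) lam cost (fun x y => phi0 y x) lam2 hcost.
rewrite -/K mean_exchange in h1.
have KE : mean (fun x => mean (fun y => cost (swap phi x y))) = K by rewrite [LHS]mean_exchange.
rewrite KE in h2.
rewrite [leRHS]mulr_natl [leRHS]mulr2n.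
apply: le_trans (lerD h1 h2); rewrite -meanD; apply: mean_le => x.
rewrite -meanD; apply: mean_le => y.
case: existsP => [[n hn]|_]; last by rewrite addr_ge0.
rewrite -natrD ler_nat addn_gt0 !lt0b.
apply/orP; have hq := lt_le_trans hn (quad_le n x y phi0).
case: (ltP (2305 * lam ^+ 2) (half_quad n phi x y)) => h; [left|right].
  by apply/existsP; exists n.
by apply/existsP; exists n; exact: quarter_lt hq h.
Qed.

End two_dim.

(** * Walsh functions and Dirichlet kernels *)

Section walsh_functions.
Context {R : realType}.
Implicit Types (x u v : walsh_group).

Definition walsh_upto (M n : nat) x : R := \prod_(k < M) rademacher k x ^+ binary_digit n k.

Lemma binary_digit_small n k : (n < 2 ^ k)%N -> binary_digit n k = false.
Proof. by move=> h; rewrite /binary_digit divn_small. Qed.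

Lemma walsh_upto_widen m M n x : (m <= M)%N -> (n < 2 ^ m)%N ->
  walsh_upto M n x = walsh_upto m n x.
Proof.
move=> mM nm; rewrite /walsh_upto -!(big_mkord xpredT (fun k => rademacher k x ^+ binary_digit n k)).
rewrite (@big_cat_nat _ _ _ m 0 M) //= [X in _ * X]big_nat [X in _ * X]big1 ?mulr1 // => k /andP[mk _].
by rewrite binary_digit_small ?expr0 // (leq_trans nm) // leq_exp2l.
Qed.

Lemma walshE m n x : (n < 2 ^ m)%N -> walsh n x = walsh_upto m n x.
Proof.
move=> nm; rewrite -(walsh_upto_widen x (leq_maxl m n) nm).
by rewrite (walsh_upto_widen x (leq_maxr m n)) // ltn_expl.
Qed.

Definition addx x u : walsh_group := fun k => addb (x k) (u k).

Lemma rademacherM k x u : rademacher k (addx x u) = rademacher k x * rademacher k u :> R.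
Proof. by rewrite /rademacher /addx signr_addb. Qed.

Lemma walshM n x u : walsh n (addx x u) = walsh n x * walsh n u :> R.
Proof.
rewrite /walsh -big_split; apply: eq_bigr => k _ /=.
by rewrite rademacherM exprMn.
Qed.

Lemma rademacher_sqr k x : rademacher k x * rademacher k x = 1 :> R.
Proof. by rewrite /rademacher -signr_addb addbb. Qed.

Lemma binary_digit_add n m k : (m < 2 ^ n)%N -> (k < n)%N ->
  binary_digit (m + 2 ^ n) k = binary_digit m k.
Proof.
move=> mn kn; have -> : (2 ^ n = 2 ^ (n - k) * 2 ^ k)%N by rewrite -expnD subnK // ltnW.
rewrite /binary_digit addnC divnMDl ?expn_gt0 // oddD oddX.
by rewrite -[(n - k)%N]prednK ?subn_gt0.
Qed.

Lemma binary_digit_top n m : (m < 2 ^ n)%N -> binary_digit (m + 2 ^ n) n.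
Proof.
move=> mn; rewrite /binary_digit addnC -[X in (X + _)%N]mul1n divnMDl ?expn_gt0 //.
by rewrite divn_small.
Qed.

Lemma walsh_add n m x : (m < 2 ^ n)%N -> walsh (m + 2 ^ n) x = walsh m x * rademacher n x :> R.
Proof.
move=> mn; have mn2 : (m + 2 ^ n < 2 ^ n.+1)%N by rewrite expnS mul2n -addnn ltn_add2r.
rewrite (walshE x mn2) (walshE x mn) /walsh_upto big_ord_recr /= binary_digit_top // expr1.
by congr (_ * _); apply: eq_bigr => k _; rewrite binary_digit_add.
Qed.

Lemma eq_walsh n m x u : (m < 2 ^ n)%N -> (forall k, (k < n)%N -> x k = u k) ->
  walsh m x = walsh m u :> R.
Proof.
move=> mn h; rewrite !(walshE _ mn); apply: eq_bigr => k _.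
by rewrite /rademacher h.
Qed.

Lemma walsh_zero n m x : (m < 2 ^ n)%N -> (forall k, (k < n)%N -> x k = false) ->
  walsh m x = 1 :> R.
Proof.
move=> mn h; rewrite (walshE _ mn) /walsh_upto big1 // => k _.
by rewrite /rademacher h // expr0 expr1n.
Qed.

Definition zero_prefix n x : bool := [forall k : 'I_n, ~~ x k].

Lemma zero_prefixP n x : reflect (forall k, (k < n)%N -> x k = false) (zero_prefix n x).
Proof.
apply: (iffP forallP) => [h k kn|h k]; last by rewrite h.
by have := h (Ordinal kn) => /negbTE.
Qed.

Lemma zero_prefixS n x : (zero_prefix n.+1 x)%:R = (zero_prefix n x)%:R * ((1 + rademacher n x) / 2) :> R.
Proof.
have -> : zero_prefix n.+1 x = zero_prefix n x && ~~ x n.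
  apply/zero_prefixP/andP => [h|[/zero_prefixP h hn] k].
    by split; [apply/zero_prefixP => k kn; apply: h; exact: leqW | rewrite h].
  by rewrite ltnS leq_eqVlt => /predU1P[->|]; [exact: negbTE | exact: h].
by rewrite -mulnb natrM /rademacher; case: (x n) => /=; rewrite ?expr0 ?expr1; field.
Qed.

Definition dirichlet m x : R := \sum_(i < m) walsh i x.

Lemma dirichlet_add n m x : (m <= 2 ^ n)%N ->
  dirichlet (m + 2 ^ n) x = dirichlet (2 ^ n) x + rademacher n x * dirichlet m x.
Proof.
move=> mn; rewrite /dirichlet -!(big_mkord xpredT (fun i => walsh i x)).
rewrite (@big_cat_nat _ _ _ (2 ^ n) 0 (m + 2 ^ n)) //= ?leq_addl //; congr (_ + _).
rewrite -{1}[(2 ^ n)%N]add0n big_addn addnK mulr_sumr big_nat [RHS]big_nat.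
by apply: eq_bigr => i /andP[_ im]; rewrite walsh_add ?(leq_trans im) // mulrC.
Qed.

Lemma dirichlet_pow n x : dirichlet (2 ^ n) x = 2 ^+ n * (zero_prefix n x)%:R.
Proof.
elim: n => [|n ih].
  rewrite expn0 /dirichlet big_ord1 /walsh big_ord0 expr0 mul1r.
  by case: zero_prefixP => // h; case: h.
by rewrite expnS mul2n -addnn dirichlet_add // ih zero_prefixS exprS; field.
Qed.

(** Induction on the leading digit through [dirichlet_add]; on the support of the kernel of order
    2^n every character of index below 2^n equals 1. *)
Lemma dirichletE n m x : (m < 2 ^ n)%N ->
  dirichlet m x = walsh m x * \sum_(k < n) (binary_digit m k)%:R *
    (2 ^+ k * (rademacher k x * (zero_prefix k x)%:R)).
Proof.
elim: n m => [|n ih] m mn.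
  move: mn; rewrite expn0 ltnS leqn0 => /eqP ->.
  by rewrite /dirichlet !big_ord0 mulr0.
rewrite big_ord_recr /=; have [mn'|nm] := ltnP m (2 ^ n).
  by rewrite (binary_digit_small mn') mul0r addr0 ih.
have m'n : (m - 2 ^ n < 2 ^ n)%N by rewrite ltn_subLR // addnn -mul2n -expnS.
rewrite -(subnK nm); move: (m - 2 ^ n)%N m'n => m' m'n {m mn nm}.
rewrite (dirichlet_add _ (ltnW m'n)) (walsh_add _ m'n) dirichlet_pow binary_digit_top // mul1r.
rewrite ih //; under [in RHS]eq_bigr => k _ do rewrite binary_digit_add //.
have e1 : walsh m' x * (zero_prefix n x)%:R = (zero_prefix n x)%:R :> R.
  case: zero_prefixP => h; last by rewrite mulr0.
  by rewrite (walsh_zero m'n h) mulr1.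
have e2 : rademacher n x * rademacher n x = 1 :> R := rademacher_sqr n x.
rewrite mulrDr addrC; congr (_ + _); first by ring.
by rewrite -{1}e1 -[LHS]mulr1 -e2; ring.
Qed.

(** The [k]-th term is the difference of the Dirichlet kernels of orders 2^(k+1) and 2^k. *)
Lemma sum_rademacher n x : \sum_(k < n) 2 ^+ k * (rademacher k x * (zero_prefix k x)%:R) =
  2 ^+ n * (zero_prefix n x)%:R - 1 :> R.
Proof.
elim: n => [|n ih].
  rewrite big_ord0 expr0 mul1r; case: zero_prefixP => [_|h]; first by rewrite subrr.
  by case: h.
by rewrite big_ord_recr /= ih zero_prefixS exprS; field.
Qed.

End walsh_functions.

(** * Kernel spikes and orthogonality of characters *)

Section spikes.
Context {R : realType} {N : nat}.
Local Notation X := {ffun 'I_N.+1 -> bool}.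
Local Notation e := (@unit_vec N.+1).
Implicit Types (x : walsh_group) (u v w : X).

(* Coordinate [0] of a cell is a dummy; coordinate [k.+1] stands for coordinate
   [k] of the Walsh group.  The dummy gives the constant term of the kernel
   expansion its own frequency [unit_vec 0], distinct from the others. *)
Definition tail w : walsh_group := fun k => if insub k.+1 is Some i then w i else false.

Definition prefix x : X := [ffun i : 'I_N.+1 => if val i is j.+1 then x j else false].

Lemma tailD u w : tail (u + w) = addx (tail u) (tail w).
Proof. by apply/funext => k; rewrite /addx /tail; case: insub => [i|//]; rewrite ffunE. Qed.

Lemma tail_in w k (kN : (k.+1 < N.+1)%N) : tail w k = w (Ordinal kN).
Proof. by rewrite /tail insubT. Qed.

Lemma tail_prefix x k : (k < N)%N -> tail (prefix x) k = x k.
Proof. by move=> kN; rewrite (tail_in _ (kN : (k.+1 < N.+1)%N)) ffunE. Qed.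

Lemma prefix0 x : prefix x ord0 = false.
Proof. by rewrite ffunE. Qed.

Lemma tail_unit k j : (j < N)%N -> tail (e k) j = (j.+1 == k).
Proof. by move=> jN; rewrite (tail_in _ (jN : (j.+1 < N.+1)%N)) ffunE. Qed.

Lemma zero_prefix_tail n w : (n <= N)%N -> w ord0 = false ->
  zero_prefix n (tail w) = subcell n.+1 w.
Proof.
move=> nN w0; apply/zero_prefixP/subcellP => [h [[|i] iN] /= ilt|h k kn].
- by rewrite -[RHS]w0; congr (w _); exact: val_inj.
- by rewrite -(tail_in w iN); apply: h.
- have kN : (k.+1 < N.+1)%N by exact: leq_trans kn nN.
  by rewrite (tail_in w kN); apply: h.
Qed.

Lemma zero_prefix_split n w : (n <= N)%N ->
  (zero_prefix n (tail w))%:R = (subcell n.+1 w)%:R + (subcell n.+1 (w + e 0))%:R :> R.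
Proof.
move=> nN.
have e0 : tail (e 0) = fun=> false.
  apply/funext => k; rewrite /tail; case: insubP => [i _ ik|//].
  by rewrite ffunE ik.
have t0 : tail (w + e 0) = tail w.
  by rewrite tailD e0; apply/funext => k; rewrite /addx addbF.
have nz (u : X) : u ord0 = true -> subcell n.+1 u = false.
  by move=> u0; apply/negbTE/negP => /subcellP /(_ ord0 isT); rewrite u0.
have we : (w + e 0) ord0 = ~~ w ord0 by rewrite !ffunE /=; case: (w ord0).
case w0 : (w ord0).
  by rewrite (nz w) // add0r -(zero_prefix_tail nN) ?t0 // we w0.
by rewrite (nz (w + e 0)) ?we ?w0 // addr0 (zero_prefix_tail nN).
Qed.

Definition character m w : R := walsh m (tail w).

Lemma characterM m u w : character m (u + w) = character m u * character m w.
Proof. by rewrite /character tailD walshM. Qed.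

Lemma character_unit0 m n : (n <= N)%N -> (m < 2 ^ n)%N -> character m (e 0) = 1.
Proof.
move=> nN mn; apply: (walsh_zero mn) => k kn.
by rewrite tail_unit // (leq_trans kn).
Qed.

Lemma character_unit m n k : (n <= N)%N -> (m < 2 ^ n)%N -> (k < N)%N ->
  character m (e k.+1) = (-1) ^+ binary_digit m k.
Proof.
move=> nN mn kN; have mN : (m < 2 ^ N)%N by rewrite (leq_trans mn) // leq_exp2l.
rewrite /character (walshE _ mN) /walsh_upto (bigD1 (Ordinal kN)) //= big1 ?mulr1.
  by rewrite /rademacher tail_unit // eqxx.
move=> i; rewrite -val_eqE /= => ik.
by rewrite /rademacher tail_unit // eqSS (negbTE ik) expr0 expr1n.
Qed.

(** Write the digit m_k as (1 - (-1)^m_k) / 2, the sign being the character at [e k.+1]. Indices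
    [kap = k.+1] with k < n carry the signs; 0 and [n.+1] carry the two terms of half of
    [sum_rademacher]. *)
Definition spike (n kap : nat) w : R :=
  if kap is k.+1 then
    if (k < n)%N then - (2^-1 * (2 ^+ k * (rademacher k (tail w) * (zero_prefix k (tail w))%:R)))
    else 2^-1 * (2 ^+ n * (zero_prefix n (tail w))%:R)
  else - 2^-1.

Lemma dirichlet_spike m n w : (n <= N)%N -> (m < 2 ^ n)%N ->
  dirichlet m (tail w) = \sum_(kap < n.+2) spike n kap w * character m (w + e kap).
Proof.
move=> nN mn; have sr := sum_rademacher (R := R) n (tail w).
rewrite (dirichletE _ mn).
under [RHS]eq_bigr do rewrite characterM mulrCA.
rewrite -mulr_sumr; congr (_ * _); rewrite big_ord_recl big_ord_recr /= ltnn.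
rewrite (character_unit0 nN mn) mulr1.
(* The index [m < 2 ^ n] has no digit at position [n]. *)
have -> : character m (e (bump 0 n)) = 1.
  apply: (walsh_zero mn) => k kn; rewrite tail_unit ?(leq_trans kn) //.
  by rewrite /bump /= add1n eqSS; apply: ltn_eqF.
pose b k : R := 2 ^+ k * (rademacher k (tail w) * (zero_prefix k (tail w))%:R).
have -> : 2 ^+ n * (zero_prefix n (tail w))%:R = \sum_(k < n) b k + 1 :> R by rewrite sr subrK.
rewrite [X in _ = _ + (X + _)](eq_bigr (fun i : 'I_n => - (2^-1 * b i) * (-1) ^+ binary_digit m i)); last first.
  move=> i _; rewrite /= ltn_ord (character_unit nN mn) //.
  exact: leq_trans nN.
transitivity (\sum_(i < n) - (2^-1 * b i) * (-1) ^+ binary_digit m i + 2^-1 * \sum_(k < n) b k).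
  rewrite mulr_sumr -big_split; apply: eq_bigr => k _ /=; rewrite -/(b k).
  by case: (binary_digit m k); rewrite /= ?expr0 ?expr1 ?mul1r ?mul0r; field.
by field.
Qed.

Lemma spike_le n kap w : (n <= N)%N -> (kap <= n.+1)%N -> w ord0 = false ->
  `|spike n kap w| <= 2 ^+ kap * (subcell kap w)%:R.
Proof.
move=> nN; case: kap => [_ _|k kn w0].
  rewrite /spike subcell0 expr0 mulr1 normrN ger0_norm ?invr_ge0 //.
  by rewrite invf_le1 // ler1n.
have nr j (u : walsh_group) : `|rademacher j u| = 1 :> R by rewrite /rademacher normrX normrN1 expr1n.
have half (z : R) : 0 <= z -> 2^-1 * z <= 2 * z by move=> z0; lra.
rewrite /spike; case: ltnP => h.
  rewrite normrN !normrM nr mul1r !ger0_norm ?invr_ge0 ?exprn_ge0 //.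
  rewrite (zero_prefix_tail _ w0) ?(leq_trans (ltnW h)) // exprS -mulrA.
  by apply: half; rewrite mulr_ge0 // exprn_ge0.
have -> : k = n by apply/eqP; rewrite eqn_leq h andbT -ltnS.
rewrite !normrM !ger0_norm ?invr_ge0 ?exprn_ge0 //.
rewrite (zero_prefix_tail _ w0) // exprS -mulrA.
by apply: half; rewrite mulr_ge0 // exprn_ge0.
Qed.

Lemma sum_character_sqr n (I : finType) (C : I -> R) (p : I -> X) :
  \sum_(m < 2 ^ n) (\sum_i C i * character m (p i)) ^+ 2 =
  2 ^+ n * \sum_i \sum_j C i * C j * (zero_prefix n (tail (p i + p j)))%:R.
Proof.
transitivity (\sum_(m < 2 ^ n) \sum_i \sum_j C i * C j * character m (p i + p j)).
  apply: eq_bigr => m _; rewrite expr2 mulr_suml; apply: eq_bigr => i _.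
  rewrite mulr_sumr; apply: eq_bigr => j _; rewrite characterM; ring.
rewrite exchange_big mulr_sumr; apply: eq_bigr => i _ /=.
rewrite exchange_big mulr_sumr; apply: eq_bigr => j _ /=.
by rewrite -mulr_sumr -/(dirichlet _ _) dirichlet_pow mulrCA.
Qed.

Lemma mean_subcell2 m (p q : X) : (m <= N.+1)%N ->
  mean (fun t => (subcell m (p + t))%:R * (subcell m (q + t))%:R) =
  (2 ^+ m)^-1 * (subcell m (p + q))%:R :> R.
Proof.
move=> mN; rewrite -(mean_subcell mN) -meanZr -(mean_shiftl p).
apply: eq_mean => t; rewrite addKX; case: (boolP (subcell m t)) => ht; last by rewrite !mul0r.
by rewrite !mul1r addrA (subcellDr _ ht) addrC.
Qed.

(** Orthogonality ignores the dummy coordinate, so its coincidence set is two cells of order [n.+1].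
    They are the correlations of [T] at lags 0 and [e 0], and the second is at most the first. *)
Lemma mean_character_sqr n (I : finType) (C D : I -> R) (p : I -> X) : (n <= N)%N ->
  (forall i, `|C i| <= D i) ->
  (2 ^+ n)^-1 * \sum_(m < 2 ^ n) (\sum_i C i * character m (p i)) ^+ 2 <=
  2 * (2 ^+ n.+1 * mean (fun t => (\sum_i D i * (subcell n.+1 (p i + t))%:R) ^+ 2)).
Proof.
move=> nN CD; rewrite sum_character_sqr mulKf //.
pose T t : R := \sum_i D i * (subcell n.+1 (p i + t))%:R.
have D0 i : 0 <= D i by exact: le_trans (CD i).
have corr a : 2 ^+ n.+1 * mean (fun t => T t * T (t + a)) =
    \sum_i \sum_j D i * D j * (subcell n.+1 (p i + p j + a))%:R.
  have -> : mean (fun t => T t * T (t + a)) = \sum_i \sum_j D i * D j *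
      mean (fun t => (subcell n.+1 (p i + t))%:R * (subcell n.+1 (p j + a + t))%:R).
    rewrite /T; under eq_mean do rewrite mulr_suml.
    rewrite mean_sum; apply: eq_bigr => i _; under eq_mean do rewrite mulr_sumr.
    rewrite mean_sum; apply: eq_bigr => j _; rewrite -meanZ; apply: eq_mean => t.
    by rewrite -[p j + a + t]addrA [a + t]addrC; ring.
  rewrite mulr_sumr; apply: eq_bigr => i _; rewrite mulr_sumr; apply: eq_bigr => j _.
  by rewrite (mean_subcell2 _ _ (nN : (n.+1 <= N.+1)%N)) mulrCA mulVKf // addrA.
apply: le_trans (_ : _ <= \sum_i \sum_j D i * D j *
   ((subcell n.+1 (p i + p j + 0))%:R + (subcell n.+1 (p i + p j + e 0))%:R)) _.
  apply: ler_sum => i _; apply: ler_sum => j _; rewrite addr0 -zero_prefix_split //.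
  apply: ler_wpM2r => //; apply: le_trans (ler_norm _) _; rewrite normrM.
  exact: ler_pM.
under eq_bigr do under eq_bigr do rewrite mulrDr.
under eq_bigr do rewrite big_split.
rewrite big_split /= -!corr -mulrDr mulrCA ler_pM2l // mulr_natl mulr2n; apply: lerD.
  by apply: mean_le => t; rewrite addr0.
have -> : mean (fun t => T t ^+ 2) = mean (fun t => 2^-1 * (T t ^+ 2 + T (t + e 0) ^+ 2)).
  by rewrite meanZ meanD (mean_shift (e 0) (fun t => T t ^+ 2)); field.
apply: mean_le => t; have := sqr_ge0 (T t - T (t + e 0)); rewrite sqrrB; lra.
Qed.

Definition quadratic_sum (M : X -> X -> R) m (x y : X) : R :=
  \sum_c \sum_d M c d * dirichlet m (tail (x + c)) * dirichlet m (tail (y + d)).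

(** 32 = 2 * 4^2, where 4 is the ratio of 4^(N+1) to 4^N due to the two dummy coordinates. Vanishing
    of [M] there restricts to arguments for which [spike_le] holds. *)
Lemma quadratic_mean_le (M phi : X -> X -> R) n (x y : X) : (n <= N)%N ->
  x ord0 = false -> y ord0 = false ->
  (forall c d : X, c ord0 || d ord0 -> M c d = 0) ->
  (forall c d : X, `|M c d| <= (4 ^+ N)^-1 * phi c d) ->
  (2 ^+ n)^-1 * \sum_(m < 2 ^ n) quadratic_sum M m x y ^+ 2 <= 32 * quad n.+1 phi x y.
Proof.
move=> nN x0 y0 M0 Mphi.
pose I : finType := ((X * X) * ('I_n.+2 * 'I_n.+2))%type.
pose C (i : I) : R := M (x + i.1.1) (y + i.1.2) * (spike n i.2.1 i.1.1 * spike n i.2.2 i.1.2).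
pose p (i : I) : X := i.1.1 + i.1.2 + e i.2.1 + e i.2.2.
pose D (i : I) : R := (4 ^+ N)^-1 * phi (x + i.1.1) (y + i.1.2) *
  (2 ^+ i.2.1 * (subcell i.2.1 i.1.1)%:R * (2 ^+ i.2.2 * (subcell i.2.2 i.1.2)%:R)).
have phi0 c d : 0 <= (4 ^+ N)^-1 * phi c d by exact: le_trans (Mphi c d).
have CD i : `|C i| <= D i.
  case: i => [[u v] [k l]]; rewrite /C /D /=.
  case: (boolP ((x + u) ord0 || (y + v) ord0)) => h.
    rewrite (M0 _ _ h) mul0r normr0; apply: mulr_ge0; first exact: phi0.
    by rewrite !mulr_ge0 // exprn_ge0.
  move: h; rewrite negb_or !ffunE x0 y0 => /andP[u0 v0].
  have {}u0 : u ord0 = false by move: u0; case: (u ord0).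
  have {}v0 : v ord0 = false by move: v0; case: (v ord0).
  rewrite !normrM; apply: ler_pM; [exact: normr_ge0 | by rewrite mulr_ge0 | exact: Mphi |].
  by apply: ler_pM => //; apply: spike_le => //; rewrite -ltnS.
have SE (m : 'I_(2 ^ n)) : quadratic_sum M m x y = \sum_i C i * character m (p i).
  transitivity (\sum_(u : X) \sum_(v : X) \sum_(k < n.+2) \sum_(l < n.+2)
      C ((u, v), (k, l)) * character m (p ((u, v), (k, l)))).
    rewrite /quadratic_sum (reindex_inj (addrI x)) /=; apply: eq_bigr => u _.
    rewrite (reindex_inj (addrI y)) /=; apply: eq_bigr => v _.
    rewrite !addKX !(dirichlet_spike _ nN (ltn_ord m)) -mulrA mulr_suml mulr_sumr; apply: eq_bigr => k _.
    rewrite 2!mulr_sumr; apply: eq_bigr => l _; rewrite /C /p /=.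
    by rewrite [u + v + _]addrAC -[u + e k + v + _]addrA [character m (u + e k + _)]characterM; ring.
  rewrite pair_bigA; under eq_bigr do rewrite pair_bigA.
  by rewrite pair_bigA; apply: eq_bigr => -[[u v] [k l]].
have TE t : \sum_i D i * (subcell n.+1 (p i + t))%:R = 4 * spread n.+1 phi x y t.
  transitivity (\sum_(k < n.+2) \sum_(l < n.+2) \sum_(u : X) \sum_(v : X)
      D ((u, v), (k, l)) * (subcell n.+1 (p ((u, v), (k, l)) + t))%:R).
    rewrite pair_bigA; under [in RHS]eq_bigr do rewrite pair_bigA.
    rewrite /= exchange_big pair_bigA /=.
    by apply: eq_bigr => -[[u v] [k l]].
  rewrite /spread mulr_sumr; apply: eq_bigr => k _; rewrite mulr_sumr; apply: eq_bigr => l _.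
  rewrite /kernel_term /mean.
  rewrite [RHS]mulrA [RHS]mulrA [RHS]mulr_sumr; apply: eq_bigr => u _.
  rewrite [RHS]mulrA [RHS]mulr_sumr; apply: eq_bigr => v _.
  rewrite /D /p exprD /=; have -> : (4 ^+ N)^-1 = 4 * ((2 ^+ N.+1)^-1 * (2 ^+ N.+1)^-1) :> R.
    have -> : 4 ^+ N = 2 ^+ N * 2 ^+ N :> R by rewrite -exprMn; congr (_ ^+ _); ring.
    by rewrite exprS; move: (pow2_neq0 (R := R) N) => h; field.
  ring.
under eq_bigr do rewrite SE.
apply: le_trans (mean_character_sqr p nN CD) _.
under eq_mean do rewrite TE exprMn.
by rewrite meanZ /quad le_eqVlt; apply/orP; left; apply/eqP; ring.
Qed.

End spikes.

(** * Passage to the Walsh group *)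

Section cells.
Context {R : realType} {N : nat}.
Local Notation X := {ffun 'I_N.+1 -> bool}.
Local Notation W := walsh_group.
Local Notation mu := (@walsh_haar2 R).
Implicit Types (c d : X) (f g : W * W -> R).

Lemma measurable_cylinder (n : nat) (B : nat -> set bool) :
  measurable ([set x | forall k, (k < n)%N -> B k (x k)] : set W).
Proof.
rewrite (_ : [set x | _] =
  \bigcap_(k in [set k | (k < n)%N]) [set x : W | B k (x k)]) //.
apply: bigcap_measurableType => k _.
by apply: sub_sigma_algebra; exists k, (B k).
Qed.

Lemma prefix_cylinder c : c ord0 = false ->
  [set x | prefix (N := N) x = c] = [set x : W | forall k, (k < N)%N -> [set tail c k] (x k)].
Proof.
move=> c0; apply/seteqP; split => [x /= <- k kN|x /= h]; first by rewrite /= tail_prefix.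
apply/ffunP => -[[|i] iN]; rewrite ffunE /=.
  by rewrite -c0; congr (c _); exact: val_inj.
by rewrite h // tail_in.
Qed.

Lemma prefix_empty c : c ord0 = true -> [set x | prefix (N := N) x = c] = set0.
Proof.
by move=> c0; apply/seteqP; split => // x /= xc; rewrite -xc prefix0 in c0.
Qed.

Lemma measurable_prefix c : measurable [set x | prefix (N := N) x = c].
Proof.
case c0 : (c ord0); first by rewrite prefix_empty.
by rewrite prefix_cylinder //; exact: (measurable_cylinder N (fun k => [set tail c k])).
Qed.

Lemma bernoulli_half b : bernoulli_prob (2^-1 : R) [set b] = (2^-1)%:E.
Proof.
rewrite /bernoulli_prob invr_ge0 ler0n /= invf_le1 // ler1n /= fsbig_set1 /bernoulli_pmf.
by case: b => //=; congr (_%:E); field.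
Qed.

Lemma haar_prefix c : (walsh_haar R [set x | prefix (N := N) x = c] =
  ((2 ^+ N)^-1 * (~~ c ord0)%:R)%:E)%E.
Proof.
case c0 : (c ord0); first by rewrite prefix_empty // measure0 mulr0.
rewrite prefix_cylinder // (@walsh_haarP R N (fun k => [set tail c k])) mulr1.
under eq_bigr do rewrite bernoulli_half.
by rewrite prodEFin prodr_const card_ord exprVn.
Qed.

Definition cell c d : set (W * W) := [set x | prefix x = c] `*` [set y | prefix y = d].

Lemma measurable_cell c d : measurable (cell c d).
Proof. by apply: measurableX; exact: measurable_prefix. Qed.

Lemma haar2_cell c d : (mu (cell c d) = ((4 ^+ N)^-1 * (~~ c ord0 && ~~ d ord0)%:R)%:E)%E.
Proof.
have -> : (mu (cell c d) = walsh_haar R [set x | prefix x = c] * walsh_haar R [set y | prefix y = d])%E.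
  by apply: product_measure1E; exact: measurable_prefix.
rewrite !haar_prefix -EFinM; congr (_%:E); rewrite -mulnb natrM.
have -> : 4 ^+ N = 2 ^+ N * 2 ^+ N :> R by rewrite -exprMn; congr (_ ^+ _); ring.
by rewrite invfM; ring.
Qed.

Lemma haar2_setT : (mu setT = 1)%E.
Proof.
rewrite (_ : setT = [set: W] `*` [set: W]); last by apply/seteqP; split.
have -> : (mu ([set: W] `*` [set: W]) = walsh_haar R [set: W] * walsh_haar R [set: W])%E.
  exact: product_measure1E.
by rewrite !probability_setT mule1.
Qed.

Lemma cell_partition (h : W * W -> R) z :
  h z = \sum_c \sum_d (h \_ (cell c d)) z.
Proof.
rewrite (bigD1 (prefix z.1)) //= (bigD1 (prefix z.2)) //=.
rewrite [X in _ + X + _]big1 ?addr0 => [|d hd]; last first.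
  rewrite patchE memNset // => -[_ /= e]; by rewrite e eqxx in hd.
rewrite [X in _ + X]big1 ?addr0 => [|c hc]; last first.
  rewrite big1 // => d _; rewrite patchE memNset // => -[/= e _]; by rewrite e eqxx in hc.
by rewrite patchE mem_set.
Qed.

Lemma Rintegral_cells f (v : X -> X -> R) : mu.-integrable setT (EFin \o f) ->
  \int[mu]_z (f z * v (prefix z.1) (prefix z.2)) =
  \sum_c \sum_d (\int[mu]_(z in cell c d) f z) * v c d.
Proof.
move=> intf.
have int1 c d : mu.-integrable setT (EFin \o (f \_ (cell c d))).
  rewrite -restrict_EFin; apply/(integrable_mkcond _ (measurable_cell c d)).
  by apply: integrableS intf => //; exact: measurable_cell.
have int2 c d : mu.-integrable setT (EFin \o (fun z => v c d * (f \_ (cell c d)) z)).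
  exact: (integrableZl measurableT (v c d) (int1 c d)).
have int3 c : mu.-integrable setT (EFin \o (fun z => \sum_d v c d * (f \_ (cell c d)) z)).
  have := @integrable_sum _ _ _ mu setT measurableT X (index_enum X) xpredT _ (fun d _ => int2 c d).
  by apply: eq_integrable => // z _ /=; rewrite sumEFin.
transitivity (\int[mu]_z (\sum_c \sum_d v c d * (f \_ (cell c d)) z)).
  apply: eq_Rintegral => z _; rewrite {1}(cell_partition f z) mulr_suml.
  apply: eq_bigr => c _; rewrite mulr_suml; apply: eq_bigr => d _; rewrite mulrC patchE.
  by case: ifPn => [/set_mem[/= -> ->]|_]; rewrite ?mulr0.
have Rsum (F : X -> W * W -> R) : (forall c, mu.-integrable setT (EFin \o F c)) ->
    \int[mu]_z (\sum_c F c z) = \sum_c \int[mu]_z F c z.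
  move=> iF; rewrite /Rintegral.
  rewrite (eq_integral (fun z => (\sum_c (EFin \o F c) z)%E)); last by move=> z _; rewrite sumEFin.
  rewrite integral_sum // sum_fine // => c _.
  exact: (integrable_fin_num measurableT (iF c)).
rewrite Rsum //; apply: eq_bigr => c _; rewrite Rsum //; apply: eq_bigr => d _.
by rewrite RintegralZl // mulrC -Rintegral_mkcond.
Qed.

Definition cell_integral f c d : R := \int[mu]_(z in cell c d) f z.

Lemma walsh_prefix m x : (m < 2 ^ N)%N -> walsh m x = walsh m (tail (prefix (N := N) x)) :> R.
Proof. by move=> mN; apply: (@eq_walsh _ N _ _ _ mN) => k kN; rewrite tail_prefix. Qed.

Lemma walsh_coefE f i j : mu.-integrable setT (EFin \o f) -> (i < 2 ^ N)%N -> (j < 2 ^ N)%N ->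
  walsh_coef f i j = \sum_c \sum_d cell_integral f c d * (walsh i (tail c) * walsh j (tail d)).
Proof.
move=> intf iN jN.
rewrite -(Rintegral_cells (fun c d => walsh i (tail c) * walsh j (tail d)) intf).
apply: eq_Rintegral => z _.
by rewrite mulrA -(walsh_prefix z.1 iN) -(walsh_prefix z.2 jN).
Qed.

Lemma dirichlet_prefix m c x : (m <= 2 ^ N)%N ->
  dirichlet m (tail (prefix x + c)) = \sum_(i < m) walsh i (tail c) * walsh i x :> R.
Proof.
move=> mN; apply: eq_bigr => i _; rewrite tailD walshM mulrC; congr (_ * _).
by rewrite -walsh_prefix // (leq_trans (ltn_ord i)).
Qed.

(** Characters of index below 2^N see only [N] coordinates, so the coefficients are finite sums over
    cells; multiplicativity regroups them into Dirichlet kernels. *)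
Lemma walsh_partial_sumE f m z : mu.-integrable setT (EFin \o f) -> (m <= 2 ^ N)%N ->
  walsh_partial_sum m m f z = quadratic_sum (cell_integral f) m (prefix z.1) (prefix z.2).
Proof.
move=> intf mN; rewrite /quadratic_sum.
transitivity (\sum_c \sum_d \sum_(i < m) \sum_(j < m) cell_integral f c d *
   (walsh i (tail c) * walsh i z.1) * (walsh j (tail d) * walsh j z.2)); last first.
  apply: eq_bigr => c _; apply: eq_bigr => d _.
  rewrite !dirichlet_prefix // -mulrA mulr_suml mulr_sumr; apply: eq_bigr => i _.
  by rewrite 2!mulr_sumr; apply: eq_bigr => j _; ring.
rewrite pair_bigA /=; under [RHS]eq_bigr do rewrite pair_bigA /=.
rewrite exchange_big /= /walsh_partial_sum pair_bigA /=; apply: eq_bigr => -[i j] _ /=.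
rewrite (walsh_coefE intf) ?(leq_trans (ltn_ord _)) // pair_bigA /= !mulr_suml.
by apply: eq_bigr => -[c d] _ /=; ring.
Qed.

Lemma integrable_cell f c d : mu.-integrable setT (EFin \o f) ->
  mu.-integrable (cell c d) (EFin \o f).
Proof. by move=> intf; apply: integrableS intf => //; exact: measurable_cell. Qed.

Lemma cell_integral_ge0 f c d : (forall z, 0 <= f z) -> 0 <= cell_integral f c d.
Proof. by move=> f0; apply: Rintegral_ge0. Qed.

Lemma cell_integral_empty f c d : c ord0 || d ord0 -> cell_integral f c d = 0.
Proof.
move=> h; rewrite /cell_integral (_ : cell c d = set0) ?Rintegral_set0 //.
by rewrite /cell; case/orP: h => h; rewrite (prefix_empty h) ?set0X ?setX0.
Qed.

Lemma cell_integral_norm f c d : mu.-integrable setT (EFin \o f) ->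
  `|cell_integral f c d| <= cell_integral (fun z => `|f z|) c d.
Proof.
move=> intf; apply: le_normr_Rintegral; first exact: measurable_cell.
exact: integrable_cell.
Qed.

Lemma sum_cell_integral f : mu.-integrable setT (EFin \o f) ->
  \sum_c \sum_d cell_integral f c d = \int[mu]_z f z.
Proof.
move=> intf; have := Rintegral_cells (fun _ _ => 1) intf.
under eq_Rintegral do rewrite mulr1.
move=> ->; apply: eq_bigr => c _; apply: eq_bigr => d _; by rewrite mulr1.
Qed.

(** A nonempty cell has measure 4^-N; a cell with a dummy bit set is empty and gets the value 0. *)
Definition cell_average f c d : R := 4 ^+ N * cell_integral f c d.

Lemma ler_ln1 (u : R) : 0 < u -> 1 - u^-1 <= ln u.
Proof.
move=> u0; have := le_ln1Dx (x := u^-1 - 1).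
rewrite addrCA subrr addr0 lnV ?posrE // => h.
have {}h : - ln u <= u^-1 - 1 by apply: h; rewrite ltrBrDl subrr invr_gt0.
lra.
Qed.

Lemma log_plus_ge0 (u : R) : 0 <= log_plus u.
Proof. by rewrite /log_plus; case: ltP => // /ltW; exact: ln_ge0. Qed.

Lemma le_log_plus (u : R) : 0 <= u -> u <= 1 + u * log_plus u.
Proof.
move=> u0; rewrite /log_plus; case: ltP => u1; last by rewrite mulr0 addr0.
have up : 0 < u by exact: lt_trans u1.
have := ler_wpM2l u0 (ler_ln1 up); rewrite mulrBr mulr1 divff ?gt_eqF //; lra.
Qed.

(* The tangent to the convex function [u log^+ u] at [a]. *)
Lemma log_plus_tangent (u a : R) : 0 <= u -> 1 < a ->
  u * (1 + ln a) - a <= u * log_plus u.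
Proof.
move=> u0 a1; have a0 : 0 < a by exact: lt_trans a1.
have la := ln_gt0 a1; rewrite /log_plus; case: ltP => u1.
  have up : 0 < u by exact: lt_trans u1.
  have := ler_ln1 (divr_gt0 up a0); rewrite ln_div ?posrE // invf_div => h.
  have := ler_wpM2l u0 h; rewrite mulrBr mulrCA divff ?gt_eqF //; lra.
rewrite mulr0 subr_le0; apply: le_trans (_ : 1 + ln a <= _).
  by apply: ler_piMl => //; lra.
have := le_ln1Dx (x := a - 1); rewrite addrCA subrr addr0 => h.
have : ln a <= a - 1 by apply: h; lra.
lra.
Qed.

End cells.

Section log_counting.
Context {R : realType}.

(** If level [J] is counted, then [J] ln(3/2) < ln x, and ln(3/2) >= 1/3. *)
Lemma level_count_le J (x : R) : 1 < x -> level_count J x <= 1 + 3 * ln x.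
Proof.
move=> x1; have l0 := ln_gt0 x1; rewrite /level_count.
elim: J => [|J ih]; first by rewrite big_ord0; lra.
rewrite big_ord_recr /=; case: ltP => h; [rewrite -[X in _ + X <= _]/(1 : R) | by rewrite addr0].
have c : \sum_(r < J) ((3 / 2) ^+ r < x)%R%:R <= J%:R :> R.
  apply: le_trans (_ : _ <= \sum_(r < J) 1) _; last by rewrite sumr_const card_ord.
  by apply: ler_sum => r _; rewrite lern1 leq_b1.
have p0 : 0 < 3 / 2 :> R by lra.
have := ler_ln1 p0; rewrite invf_div => h1.
have : ln ((3 / 2) ^+ J) < ln x by rewrite ltr_ln ?posrE ?exprn_gt0 // (lt_trans ltr01).
rewrite lnXn // -[_ *+ J]mulr_natl => h2.
have : J%:R * (1 - 2 / 3) <= J%:R * ln (3 / 2) :> R by rewrite ler_wpM2l.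
move=> h3; apply: le_trans (lerD c (lexx _)) _; move: h2 h3; move: (J%:R : R) => j; lra.
Qed.

Lemma level_count_cost J (x : R) : 0 <= x -> x * level_count J x <= 1 + 4 * (x * log_plus x).
Proof.
move=> x0; have h := le_log_plus x0; have l0 : 0 <= x * log_plus x by rewrite mulr_ge0 ?log_plus_ge0.
case: (ltP 1 x) => x1; last first.
  rewrite /level_count big1 ?mulr0; first lra.
  move=> r _; rewrite ltNge (le_trans x1) // exprn_ege1 //; lra.
apply: le_trans (ler_wpM2l x0 (level_count_le J x1)) _.
move: h l0; rewrite /log_plus x1; lra.
Qed.

(** Young's inequality t^p <= (p/2) t^2 + 1 - p/2, taken at t = |a_i| / [lam] and averaged. *)
Lemma power_mean_le (I : finType) (w p lam : R) (a : I -> R) : 0 < p -> p <= 2 -> 0 < lam ->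
  0 <= w -> w * #|I|%:R = 1 ->
  w * \sum_i a i ^+ 2 <= lam ^+ 2 ->
  (w * \sum_i `|a i| `^ p) `^ p^-1 <= lam.
Proof.
move=> p0 p2 lam0 w0 wI h.
have young (x : R) : 0 <= x -> x `^ p <= p / 2 * x ^+ 2 + (1 - p / 2).
  (* At p = 2 the conjugate exponent degenerates, and the inequality is an equality. *)
  move=> x0; case: (ltrP p 2) => hp; last first.
    have -> : p = 2 by apply/eqP; rewrite eq_le p2.
    by rewrite powR_mulrn //; lra.
  have q0 : 0 < 1 - p / 2 by lra.
  have e1 : p * (2 / p) = 2 by rewrite mulrC divfK // gt_eqF.
  have e2 : (2 / p)^-1 + (1 - p / 2)^-1^-1 = 1 by rewrite invf_div invrK addrC subrK.
  have q1 : 0 < (1 - p / 2)^-1 by rewrite invr_gt0.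
  have := conjugate_powR (powR_ge0 x p) ler01 (divr_gt0 (ltr0Sn R 1) p0) q1 e2.
  rewrite mulr1 -powRrM e1 powR1 invf_div invrK mul1r powR_mulrn //.
  by rewrite [X in _ <= X + _ -> _]mulrC.
have step : w * \sum_i `|a i| `^ p <= lam `^ p.
  have -> : w * \sum_i `|a i| `^ p = lam `^ p * (w * \sum_i (`|a i| / lam) `^ p).
    rewrite mulrCA; congr (_ * _); rewrite mulr_sumr; apply: eq_bigr => i _.
    have e : `|a i| = lam * (`|a i| / lam) by rewrite mulrC divfK // gt_eqF.
    by rewrite {1}e powRM ?(ltW lam0) // divr_ge0 // ltW.
  apply: ler_piMr; first exact: powR_ge0.
  apply: le_trans (_ : _ <= w * \sum_i (p / 2 * (`|a i| / lam) ^+ 2 + (1 - p / 2))) _.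
    by apply: ler_wpM2l => //; apply: ler_sum => i _; apply: young; rewrite divr_ge0 // ltW.
  rewrite big_split /= sumr_const mulrDr -[(1 - p / 2) *+ _]mulr_natr [w * (_ * _%:R)]mulrCA wI mulr1.
  have -> : w * \sum_i p / 2 * (`|a i| / lam) ^+ 2 = p / 2 * ((w * \sum_i a i ^+ 2) / lam ^+ 2).
    rewrite -mulr_sumr mulrCA; congr (_ * _); rewrite -mulrA; congr (_ * _); rewrite mulr_suml.
    by apply: eq_bigr => i _; rewrite expr_div_n real_normK // num_real.
  have : w * (\sum_i a i ^+ 2) / lam ^+ 2 <= 1 by rewrite ler_pdivrMr ?exprn_gt0 // mul1r.
  have : 0 < p / 2 by lra.
  move: (_ / lam ^+ 2) (p / 2) => A B B0 A1.
  have : B * A <= B * 1 by rewrite ler_pM2l.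
  lra.
apply: le_trans (_ : (lam `^ p) `^ p^-1 <= _).
  apply: ge0_ler_powR; [by rewrite invr_ge0 ltW | | exact: powR_ge0 | exact: step].
  by rewrite nnegrE mulr_ge0 // sumr_ge0 // => i _; exact: powR_ge0.
by rewrite -powRrM divff ?gt_eqF // powRr1 // ltW.
Qed.

End log_counting.

Section level_sets.
Context {R : realType} {N : nat}.
Local Notation X := {ffun 'I_N.+1 -> bool}.
Local Notation W := walsh_group.
Local Notation mu := (@walsh_haar2 R).
Implicit Types (f : W * W -> R).

Definition LlogL_fun f z : R := `|f z| * log_plus `|f z|.

Lemma measurable_LlogL_fun f : measurable_fun setT f -> measurable_fun setT (LlogL_fun f).
Proof.
move=> mf; have mn : measurable_fun setT (fun z => `|f z|).
  by apply: measurableT_comp.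
apply: measurable_funM => //; rewrite /log_plus.
apply: measurable_fun_ifT => //.
  by apply: measurable_fun_ltr.
apply: measurableT_comp => //; exact: measurable_ln.
Qed.

Lemma LlogL_fun_ge0 f z : 0 <= LlogL_fun f z.
Proof. by rewrite mulr_ge0 // log_plus_ge0. Qed.

Lemma integrable_LlogL_fun f : LlogL f -> mu.-integrable setT (EFin \o LlogL_fun f).
Proof.
move=> [mf fin]; apply/integrableP; split.
  by apply/measurable_EFinP; exact: measurable_LlogL_fun.
move: fin; rewrite /LlogL_integral; congr (_ < _)%E; apply: eq_integral => z _.
by rewrite /= [in RHS]ger0_norm ?LlogL_fun_ge0.
Qed.

Lemma LlogL_integralE f : LlogL f -> LlogL_integral f = (\int[mu]_z LlogL_fun f z)%:E.
Proof.
move=> lf; rewrite /Rintegral fineK //.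
exact: (integrable_fin_num measurableT (integrable_LlogL_fun lf)).
Qed.

Lemma haar2_fin : (mu setT < +oo)%E.
Proof. by rewrite haar2_setT ltry. Qed.

Lemma integrable_LlogL f : LlogL f -> mu.-integrable setT (EFin \o f).
Proof.
move=> lf; have [mf _] := lf.
have i1 : mu.-integrable setT (EFin \o cst (1 : R)).
  apply/integrableP; split; first exact/measurable_EFinP.
  rewrite (eq_integral (cst 1%E)); last by move=> z _; rewrite /= normr1.
  by rewrite integral_cst // mul1e; exact: haar2_fin.
have := integrableD measurableT i1 (integrable_LlogL_fun lf).
apply: le_integrable => //; first exact/measurable_EFinP.
move=> z _ /=; rewrite lee_fin [leRHS]ger0_norm; first exact: le_log_plus.
by rewrite addr_ge0 // LlogL_fun_ge0.
Qed.

(** For [a > 1], integrate the tangent at the cell average [a]: its linear part gives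
    [a * (1 + ln a)] and its constant part costs at most [a]. *)
Lemma cell_jensen f (c d : X) : LlogL f ->
  cell_average (fun z => `|f z|) c d * log_plus (cell_average (fun z => `|f z|) c d) <=
  4 ^+ N * cell_integral (LlogL_fun f) c d.
Proof.
move=> lf; set a := cell_average _ c d.
have p4 : 0 < 4 ^+ N :> R by rewrite exprn_gt0.
have g0 : 0 <= cell_integral (LlogL_fun f) c d by apply: cell_integral_ge0 => z; exact: LlogL_fun_ge0.
rewrite /log_plus; case: ltP => a1; last by rewrite mulr0 mulr_ge0 // ltW.
have intf := integrable_norm (integrable_LlogL lf).
have mc := @measurable_cell N c d.
have ic := integrable_cell c d intf.
have ik : mu.-integrable (cell c d) (EFin \o cst a).
  apply: integrableS (measurableT) mc _ _ => //.
  apply/integrableP; split; first exact/measurable_EFinP.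
  rewrite (eq_integral (cst `|a|%:E)); last by move=> z _.
  rewrite integral_cst // haar2_setT mule1; exact: ltry.
have ig := integrable_cell c d (integrable_LlogL_fun lf).
have ica : mu.-integrable (cell c d) (EFin \o (fun z => `|f z| * (1 + ln a))).
  have := integrableZl mc (1 + ln a) ic.
  by apply: eq_integrable => // z _ /=; rewrite mulrC.
have h : cell_integral (fun z => `|f z| * (1 + ln a) - a) c d <= cell_integral (LlogL_fun f) c d.
  apply: le_Rintegral => //; first exact: (integrableB mc ica ik).
  by move=> z _; exact: log_plus_tangent.
apply: le_trans (ler_wpM2l (ltW p4) h).
have -> : cell_integral (fun z => `|f z| * (1 + ln a) - a) c d =
    cell_integral (fun z => `|f z|) c d * (1 + ln a) - a * fine (mu (cell c d)).
  by rewrite /cell_integral RintegralB // RintegralZr // Rintegral_cst.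
have m1 : 4 ^+ N * fine (mu (cell c d)) <= 1.
  by rewrite haar2_cell /= mulrA divff ?gt_eqF // mul1r lern1 leq_b1.
have a0 : 0 < a by exact: lt_trans a1.
have := ler_wpM2l (ltW a0) m1.
rewrite mulrBr [4 ^+ N * (_ * (1 + _))]mulrA -/(cell_average _ c d) -/a [4 ^+ N * (a * _)]mulrCA.
move: (a * (4 ^+ N * fine _)) => u; lra.
Qed.

End level_sets.

Section prefix_sets.
Context {R : realType} {N : nat}.
Local Notation X := {ffun 'I_N.+1 -> bool}.
Local Notation W := walsh_group.
Local Notation mu := (@walsh_haar2 R).

Lemma mean2E (F : X -> X -> R) :
  mean (fun x => mean (fun y => F x y)) = (4 ^+ N.+1)^-1 * \sum_c \sum_d F c d.
Proof.
have -> : 4 ^+ N.+1 = 2 ^+ N.+1 * 2 ^+ N.+1 :> R by rewrite -exprMn; congr (_ ^+ _); ring.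
by rewrite /mean -mulr_sumr mulrA invfM.
Qed.

Definition prefix_set (s : seq (X * X)) : set (W * W) := [set z | (prefix z.1, prefix z.2) \in s].

Lemma prefix_set_cons u s : prefix_set (u :: s) = cell u.1 u.2 `|` prefix_set s.
Proof.
case: u => c d; apply/seteqP; split => z; rewrite /prefix_set /cell /= in_cons.
  by case/orP => [/eqP[<- <-]|]; [left|right].
by case => [[-> ->]|->]; rewrite ?eqxx ?orbT.
Qed.

Lemma prefix_set_nil : prefix_set [::] = set0.
Proof. by apply/seteqP; split. Qed.

Lemma measurable_prefix_set s : measurable (prefix_set s).
Proof.
elim: s => [|u s ih]; first by rewrite prefix_set_nil.
by rewrite prefix_set_cons; apply: measurableU => //; exact: measurable_cell.
Qed.

Lemma haar2_prefix_set s : (mu (prefix_set s) <= ((4 ^+ N)^-1 * (size s)%:R)%:E)%E.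
Proof.
elim: s => [|u s ih]; first by rewrite prefix_set_nil measure0 mulr0.
rewrite prefix_set_cons; apply: le_trans (measureU2 _ (measurable_cell _ _) (measurable_prefix_set _)) _.
rewrite [size _]/= -[(size s).+1%:R]natr1 mulrDr EFinD [leRHS]addeC; apply: leeD; last exact: ih.
by rewrite [leLHS]haar2_cell lee_fin ler_wpM2l ?invr_ge0 ?exprn_ge0 // lern1 leq_b1.
Qed.

Lemma prefix_setE (Q : X -> X -> bool) :
  [set z : W * W | Q (prefix z.1) (prefix z.2)] = prefix_set (enum [pred u | Q u.1 u.2]).
Proof. by apply/seteqP; split => z; rewrite /prefix_set /= mem_enum. Qed.

(** [mean] runs over 4^(N+1) pairs, of which only a quarter are nonempty cells. *)
Lemma haar2_prefix_le (Q : X -> X -> bool) :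
  (mu [set z | Q (prefix z.1) (prefix z.2)] <=
   (4 * mean (fun x => mean (fun y => (Q x y)%:R)))%:E)%E.
Proof.
rewrite prefix_setE; apply: le_trans (haar2_prefix_set _) _.
rewrite lee_fin mean2E exprS invfM !mulrA divff // mul1r ler_wpM2l ?invr_ge0 ?exprn_ge0 //.
rewrite pair_bigA /= -natr_sum ler_nat -cardE -sum1_card big_mkcond /=.
by apply: leq_sum => u _; rewrite inE; case: ifP.
Qed.

(** The factor 4 of the cost combines with the 4^N of [cell_jensen] to cancel the normalisation of
    the double mean. *)
Lemma mean_cost_le f : LlogL f ->
  mean (fun x : X => mean (fun y => 1 + 4 * (cell_average (fun z => `|f z|) x y *
    log_plus (cell_average (fun z => `|f z|) x y)))) <= 1 + \int[mu]_z LlogL_fun f z.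
Proof.
move=> lf; apply: le_trans (_ : _ <= mean (fun x : X => mean (fun y =>
  1 + 4 ^+ N.+1 * cell_integral (LlogL_fun f) x y))) _.
  apply: mean_le => x; apply: mean_le => y; rewrite lerD2l exprS -mulrA ler_wpM2l //.
  exact: cell_jensen.
rewrite -(sum_cell_integral (N := N) (integrable_LlogL_fun lf)).
have -> : mean (fun x : X => mean (fun y => 1 + 4 ^+ N.+1 * cell_integral (LlogL_fun f) x y)) =
  1 + 4 ^+ N.+1 * mean (fun x : X => mean (fun y => cell_integral (LlogL_fun f) x y)).
  rewrite -(meanZ (4 ^+ N.+1)) -[X in _ = X + _](@mean_cst R N.+1) -meanD; apply: eq_mean => x.
  by rewrite -(meanZ (4 ^+ N.+1)) -[X in _ = X + _](@mean_cst R N.+1) -meanD.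
by rewrite mean2E mulrA divff ?mul1r // gt_eqF // exprn_gt0.
Qed.

End prefix_sets.

(** * Level sets and the supremum over all orders *)

Section weak_type.
Context {R : realType}.
Local Notation W := walsh_group.
Local Notation mu := (@walsh_haar2 R).
Variables (f : W * W -> R) (p lambda : R).
Hypothesis (lf : LlogL f).

Definition level_set N : set (W * W) :=
  [set z | exists n, (n <= N)%N /\ lambda < strong_mean n p f z].

Let intf := integrable_LlogL lf.

Lemma level_setE N : level_set N = [set z | [exists n : 'I_N.+1,
  lambda < ((2 ^+ n)^-1 * \sum_(m < 2 ^ n) `|quadratic_sum (N := N) (cell_integral f) m
    (prefix z.1) (prefix z.2)| `^ p) `^ p^-1]].
Proof.
have E n z : (n <= N)%N -> strong_mean n p f z = ((2 ^+ n)^-1 * \sum_(m < 2 ^ n)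
    `|quadratic_sum (N := N) (cell_integral f) m (prefix z.1) (prefix z.2)| `^ p) `^ p^-1.
  move=> nN; rewrite /strong_mean; congr (_ `^ _); congr (_ * _); apply: eq_bigr => m _.
  by rewrite (walsh_partial_sumE (N := N)) // (leq_trans (ltnW (ltn_ord m))) // leq_exp2l.
apply/seteqP; split => z /=.
  move=> [n [nN h]]; apply/existsP; exists (Ordinal (nN : (n < N.+1)%N)) => /=.
  by rewrite -E.
move=> /existsP[n h]; exists (n : nat); split; first by rewrite -ltnS ltn_ord.
by rewrite E // -ltnS ltn_ord.
Qed.

Lemma measurable_level_set N : measurable (level_set N).
Proof.
rewrite level_setE (prefix_setE (fun c d => [exists n : 'I_N.+1, lambda < ((2 ^+ n)^-1 *
  \sum_(m < 2 ^ n) `|quadratic_sum (N := N) (cell_integral f) m c d| `^ p) `^ p^-1])).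
exact: measurable_prefix_set.
Qed.

(** With [lambda = K * lam], a small [quad] bounds the square mean by [K * lam ^+ 2], which is at
    most [lambda ^+ 2]. The constant is 4 (dummy coordinates) times 2 (halves) times 15000, doubled
    because the mean cost is at most 1 plus the integral. *)
Lemma haar2_level_set N (K := 32 * (4 * 2305) : R) : 0 < p -> p <= 2 -> 2 * K <= lambda ->
  (mu (level_set N) <= (16 * 15000 * K / lambda * (1 + \int[mu]_z LlogL_fun f z))%:E)%E.
Proof.
move=> p0 p2.
have KE s : 32 * (4 * (2305 * s)) = K * s by rewrite /K -2!mulrA.
have K1 : 1 <= K by rewrite /K; lra.
have K0 : 0 < K by exact: lt_le_trans ltr01 K1.
move: (K) KE K1 K0 => {}K KE K1 K0 hl.
have l0 : 0 < lambda by apply: lt_le_trans hl; rewrite mulr_gt0.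
have [lam lamE] : exists lam, lambda = K * lam by exists (K^-1 * lambda); rewrite mulVKf ?gt_eqF.
have lam2 : 2 <= lam by move: hl; rewrite lamE [_ * K]mulrC ler_pM2l.
pose phi := cell_average (N := N) (fun z => `|f z|).
have phi0 c d : 0 <= phi c d.
  by rewrite mulr_ge0 ?exprn_ge0 //; apply: cell_integral_ge0.
pose Q x y := [exists n : 'I_N.+2, 4 * (2305 * lam ^+ 2) < quad n phi x y].
have sub : level_set N `<=` [set z | Q (prefix z.1) (prefix z.2)].
  rewrite level_setE => z /= /existsP[n]; rewrite ltNge => h.
  (* Order [n] on the Walsh group is order [n.+1] on cells with the dummy coordinate. *)
  apply/existsP; exists (lift ord0 n); rewrite ltNge; apply: contra h => h.
  apply: power_mean_le => //; first by rewrite card_ord natrX mulVf.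
  apply: le_trans (quadratic_mean_le (phi := phi) _ (prefix0 _) (prefix0 _) _ _) _.
  - by rewrite -ltnS ltn_ord.
  - exact: cell_integral_empty.
  - move=> c d; rewrite /phi /cell_average mulrA mulVf ?gt_eqF ?exprn_gt0 // mul1r.
    exact: cell_integral_norm.
  apply: le_trans (ler_wpM2l (ler0n R 32) h) _.
  rewrite KE lamE exprMn; apply: ler_wpM2r; first exact: sqr_ge0.
  by rewrite expr2 ler_peMl // ltW.
apply: le_trans (le_measure _ _ _ sub) _; rewrite ?inE.
- exact: measurable_level_set.
- by rewrite prefix_setE; exact: measurable_prefix_set.
apply: le_trans (haar2_prefix_le _) _; rewrite lee_fin.
have hw := quad_weak phi0 lam2 (@level_count_cost R).
apply: le_trans (ler_wpM2l (ler0n R 4) hw) _.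
have := mean_cost_le (N := N) lf; rewrite -/phi.
set L := Rintegral _ _ _; set M := mean _ => ML.
have L0 : 0 <= L by apply: Rintegral_ge0 => z _; exact: LlogL_fun_ge0.
have -> : 16 * 15000 * K / lambda = 16 * 15000 * lam^-1 by rewrite lamE invfM mulrA mulfK // gt_eqF.
have x0 : 0 <= lam^-1 by rewrite invr_ge0 (le_trans _ lam2).
have := ler_wpM2l x0 ML; have := mulr_ge0 x0 L0; have := x0.
move: lam^-1 => x; lra.
Qed.

Lemma level_set_limit : [set z | (lambda%:E < strong_maximal p f z)%E] = \bigcup_N level_set N.
Proof.
apply/seteqP; split => z /=.
  by move=> /ereal_sup_gt[_ [n _ <-] h]; exists n => //; exists n; split.
move=> [N _ [n [_ h]]]; apply: lt_le_trans (_ : (strong_mean n p f z)%:E <= _)%E.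
  by rewrite lte_fin.
by apply: ereal_sup_ubound; exists n.
Qed.

Lemma haar2_strong_maximal (B : \bar R) : (forall N, (mu (level_set N) <= B)%E) ->
  (mu [set z | (lambda%:E < strong_maximal p f z)%E] <= B)%E.
Proof.
move=> hB; rewrite level_set_limit.
have mU : measurable (\bigcup_N level_set N).
  by apply: bigcup_measurable => N _; exact: measurable_level_set.
have nd : nondecreasing_seq level_set.
  move=> m n mn; apply/subsetPset => z [k [km h]]; exists k; split => //.
  exact: leq_trans km mn.
have cv := nondecreasing_cvg_mu (mu := mu) measurable_level_set mU nd.
rewrite -(cvg_lim _ cv) //; apply: lime_le; first by apply/cvg_ex; eexists; exact: cv.
by apply: nearW => N; exact: hB.
Qed.

End weak_type.

Theorem theorem1 (R : realType) :
  exists c : R, 0 < c /\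
    forall (f : walsh_group * walsh_group -> R) (p lambda : R),
      LlogL f -> 0 < p -> p <= 2 -> 0 < lambda ->
      (walsh_haar2 [set z | lambda%:E < strong_maximal p f z]
         <= (c / lambda)%:E * (1 + LlogL_integral f))%E.
Proof.
have hm := @haar2_level_set R; move: hm; set K : R := 32 * (4 * 2305).
have K0 : 0 < K by rewrite /K; lra.
have : 2 <= 16 * 15000 :> R by lra.
move: (K) (16 * 15000 : R) K0 => {}K A K0 A2 hm; pose c := A * K.
have c0 : 0 < c by rewrite mulr_gt0 // (lt_le_trans _ A2).
have cK : 2 * K <= c by rewrite ler_pM2r.
exists c; split => // f p lambda lf p0 p2 l0.
have L0 : 0 <= \int[walsh_haar2]_z LlogL_fun f z :> R.
  by apply: Rintegral_ge0 => z _; exact: LlogL_fun_ge0.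
rewrite LlogL_integralE // -EFinD -EFinM.
apply: (haar2_strong_maximal lf) => N; case: (leP (2 * K) lambda) => hl.
  exact: hm.
(* For [lambda < 2 * K] the right side is at least 1, the total mass. *)
apply: le_trans (_ : 1 <= _)%E.
  rewrite -haar2_setT; apply: le_measure; rewrite ?inE //.
  exact: measurable_level_set.
rewrite lee_fin; apply: le_trans (_ : 1 <= c / lambda) _.
  by rewrite ler_pdivlMr // mul1r ltW // (lt_le_trans hl).
by rewrite ler_peMr ?lerDl // ltW // divr_gt0.
Qed.
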